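(* For $d\geq 2$ let $\Omega \subset \mathbb{R}^d$ denote a bounded Lipschitz domain. Moreover, for $1 < p < \infty$ and $f \in W^{-1}(L_{p'}(\Omega))$ (with $1/p+1/p'=1$) let $u$ be a weak solution to the $p$-Poisson equation $-\mathrm{div}(|\nabla u|^{p-2}\nabla u)=f$ in $\Omega$ which satisfies $u \in W^s(L_p(\Omega))$ for all $s<\overline{s}$, where $\overline{s}\in[\ell,\ell+1)$ with some $\ell\in\mathbb{N}$. If, additionally, $u$ is contained in $C^{\ell,\alpha}_{\gamma, \mathrm{loc}}(\Omega)$ with $$\overline{s}-\ell < \alpha \leq 1 \qquad \text{and} \qquad 0 < \gamma < \ell + \alpha + \frac{1}{p} - \frac{d-1}{d} \, \overline{s},$$ then there exists $\overline{\sigma} > \overline{s}$ such that $$u \in B^{\sigma}_{\tau}(L_{\tau}(\Omega)) \qquad \text{for all} \qquad 0< \sigma < \overline{\sigma} \qquad \text{and} \qquad \frac{1}{\tau} = \frac{\sigma}{d} + \frac{1}{p}.$$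
   Context: A domain is an open connected set; a Lipschitz domain is a domain with Lipschitz boundary. Weak solutions. A weak solution of $-\mathrm{div}(|\nabla u|^{p-2}\nabla u)=f$ in $\Omega$ is a function $u\in W^1(L_p(\Omega))$ with $\int_\Omega\langle|\nabla u|^{p-2}\nabla u,\nabla v\rangle\,dx=\int_\Omega f\,v\,dx$ for all $v\in C_0^\infty(\Omega)$ (the right-hand side being read as the duality pairing if $f$ is not a function). Sobolev spaces. $W^\ell(L_p(\Omega))$, $\ell\in\mathbb{N}_0$, is the usual Sobolev space of functions with weak derivatives of order $\le\ell$ in $L_p(\Omega)$; for $s=\ell+\beta$, $0<\beta<1$, $W^s(L_p(\Omega))$ consists of those $g\in W^\ell(L_p(\Omega))$ with $\sum_{|\nu|=\ell}\int_\Omega\int_\Omega\frac{|D^\nu g(x)-D^\nu g(y)|^p}{|x-y|^{d+\beta p}}\,dx\,dy<\infty$. $W^1_0(L_p(\Omega))$ is the closure of $C_0^\infty(\Omega)$ in $W^1(L_p(\Omega))$, and $W^{-1}(L_{p'}(\Omega))$ is its dual. Besov spaces. For $r\in\mathbb{N}$, $h\in\mathbb{R}^d$ let $\Omega_{r,h}$ be the set of all $x\in\Omega$ such that the segment $[x,x+rh]$ lies in $\Omega$, and for $x\in\Omega_{r,h}$ let $\Delta_h^r(g,x)=\sum_{k=0}^r(-1)^{r-k}\binom{r}{k}g(x+kh)$. For $0<\tau<\infty$, $g\in L_\tau(\Omega)$, $t>0$ put $\omega_r(g,t,\Omega)_\tau=\sup_{|h|\le t}\|\Delta_h^r(g,\cdot)\,|\,L_\tau(\Omega_{r,h})\|$.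 For $\sigma>0$, $B^\sigma_\tau(L_\tau(\Omega))$ consists of all $g\in L_\tau(\Omega)$ with $\int_0^\infty[t^{-\sigma}\omega_r(g,t,\Omega)_\tau]^\tau\,\frac{dt}{t}<\infty$, where $r\in\mathbb{N}$, $r\ge\lfloor\sigma\rfloor+1$ (the choice of $r$ is immaterial). Locally weighted Hölder spaces. For a closed ball $K\subset\Omega$, $C^{\ell}(K)$ is the space of real functions all of whose partial derivatives of order $\le\ell$ are uniformly continuous and bounded on $K$; $|g|_{C^{\ell,\alpha}(K)}=\sum_{|\nu|=\ell}\sup_{x\ne y\in K}\frac{|\partial^\nu g(x)-\partial^\nu g(y)|}{|x-y|^\alpha}$, and $C^{\ell,\alpha}(K)$ consists of those $g\in C^\ell(K)$ with $|g|_{C^{\ell,\alpha}(K)}<\infty$. Fix a constant $c>1$ and let $\mathcal{K}$ be the set of all closed balls $B_r(x_0)\subset\Omega$ ($x_0\in\Omega$, $r>0$) such that the open ball with center $x_0$ and radius $cr$ is contained in $\Omega$. With $\delta_K=\mathrm{dist}(K,\partial\Omega)$, for $\gamma>0$, $C^{\ell,\alpha}_{\gamma,\mathrm{loc}}(\Omega)$ is the set of all $g:\Omega\to\mathbb{R}$ with $g\in C^{\ell,\alpha}(K)$ for all $K\in\mathcal{K}$ and $\sup_{K\in\mathcal{K}}\delta_K^\gamma|g|_{C^{\ell,\alpha}(K)}<\infty$; this space does not depend on the choice of $c>1$. *)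

(* Defs.v *)
From HB Require Import structures.
From mathcomp Require Import all_boot all_order all_algebra.
From mathcomp Require Import all_classical all_reals all_analysis.

Set Implicit Arguments.
Unset Strict Implicit.
Unset Printing Implicit Defensive.

Import Order.TTheory GRing.Theory Num.Theory.
Import numFieldNormedType.Exports.

Local Open Scope classical_set_scope.
Local Open Scope ring_scope.

(** * Lebesgue measure on the Borel sets of R^n *)

Definition rV_display : measure_display. Proof. exact: default_measure_display. Qed.

Section measurable_rV.
Variables (R : realType) (n : nat).

(* The coordinates generate the Borel sigma-algebra of R^n, as for the
   library's structure on n.-tuple. *)
Definition rV_coord (i : 'I_n) (x : 'rV[R]_n) : R := x ord0 i.

Let rV_set0 : g_sigma_preimage rV_coord set0.
Proof. exact: sigma_algebra0. Qed.

Let rV_setC A : g_sigma_preimage rV_coord A -> g_sigma_preimage rV_coord (~` A).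
Proof. exact: sigma_algebraC. Qed.

Let rV_bigcup (F : (set 'rV[R]_n)^nat) :
  (forall i, g_sigma_preimage rV_coord (F i)) ->
  g_sigma_preimage rV_coord (\bigcup_i (F i)).
Proof. exact: sigma_algebra_bigcup. Qed.

HB.instance Definition _ := @isMeasurable.Build rV_display
  'rV[R]_n (g_sigma_preimage rV_coord) rV_set0 rV_setC rV_bigcup.

Lemma measurable_coord (i : 'I_n) : measurable_fun [set: 'rV[R]_n] (rV_coord i).
Proof.
move=> _ Y mY; rewrite setTI; apply: sub_sigma_algebra => /=.
rewrite -bigcup_seq/=; exists i => /=; first by rewrite mem_index_enum.
by exists Y => //; rewrite setTI.
Qed.

Lemma measurable_fun_coordP d (T : measurableType d) (f : T -> 'rV[R]_n) :
  (forall i, measurable_fun [set: T] (rV_coord i \o f)) -> measurable_fun [set: T] f.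
Proof.
move=> mf.
have prefS : g_sigma_preimage (fun i => rV_coord i \o f) `<=` measurable.
  apply: smallest_sub; first exact: sigma_algebra_measurable.
  by rewrite -bigcup_seq/=; apply: bigcup_sub => i _ A [B mB <-]; exact: mf.
by move: prefS; rewrite g_sigma_preimage_comp => prefS _ A mA; apply: prefS; exists A.
Qed.

End measurable_rV.

Section lebesgue_rV.
Variable R : realType.

Definition rV_cons n (z : R * 'rV[R]_n) : 'rV[R]_n.+1 :=
  \row_i (if unlift ord0 i is Some j then z.2 ord0 j else z.1).

Definition rV_uncons n (x : 'rV[R]_n.+1) : R * 'rV[R]_n :=
  (x ord0 ord0, \row_j x ord0 (lift ord0 j)).

Lemma rV_consK n : cancel (@rV_cons n) (@rV_uncons n).
Proof.
move=> [a x]; rewrite /rV_uncons /rV_cons mxE unlift_none; congr pair.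
by apply/rowP => j; rewrite !mxE liftK.
Qed.

Lemma measurable_rV_cons n : measurable_fun [set: (R * 'rV[R]_n)%type] (@rV_cons n).
Proof.
apply: measurable_fun_coordP => i.
case: (unliftP ord0 i) => [j|] ->.
  rewrite (_ : _ \o _ = @rV_coord R n j \o snd).
    by apply: measurableT_comp => //; exact: measurable_coord.
  by apply/funext => z; rewrite /rV_coord /rV_cons /= mxE liftK.
rewrite (_ : _ \o _ = fst) //.
by apply/funext => z; rewrite /rV_coord /rV_cons /= mxE unlift_none.
Qed.

Lemma measurable_rV_uncons n : measurable_fun [set: 'rV[R]_n.+1] (@rV_uncons n).
Proof.
apply/measurable_fun_pairP; split; first exact: (measurable_coord ord0).
apply: measurable_fun_coordP => j.
rewrite (_ : _ \o _ = @rV_coord R n.+1 (lift ord0 j)); first exact: measurable_coord.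
by apply/funext => x; rewrite /rV_coord /rV_uncons /= mxE.
Qed.

Section lebesgue_rVS.
Variables (n : nat) (m : {sigma_finite_measure set 'rV[R]_n -> \bar R}).

Definition lebesgue_rVS : set 'rV[R]_n.+1 -> \bar R :=
  pushforward (lebesgue_measure \x m)%E (@rV_cons n).

Let mcons A : measurable A -> measurable (@rV_cons n @^-1` A).
Proof. by move=> mA; rewrite -[X in measurable X]setTI; exact: measurable_rV_cons. Qed.

Let lebesgue_rVS0 : lebesgue_rVS set0 = 0%E.
Proof. by rewrite /lebesgue_rVS /pushforward preimage_set0 measure0. Qed.

Let lebesgue_rVS_ge0 A : (0 <= lebesgue_rVS A)%E.
Proof. by rewrite /lebesgue_rVS /pushforward; exact: measure_ge0. Qed.

Let lebesgue_rVS_sigma_additive : semi_sigma_additive lebesgue_rVS.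
Proof.
move=> F mF tF mUF; rewrite /lebesgue_rVS /pushforward preimage_bigcup.
apply: measure_semi_sigma_additive.
- by move=> k; exact: mcons.
- apply/trivIsetP => /= i j _ _ ij; rewrite -preimage_setI.
  by move/trivIsetP : tF => /(_ _ _ _ _ ij) ->//; rewrite preimage_set0.
- by rewrite -preimage_bigcup; exact: mcons.
Qed.

HB.instance Definition _ := isMeasure.Build _ _ _ lebesgue_rVS
  lebesgue_rVS0 lebesgue_rVS_ge0 lebesgue_rVS_sigma_additive.

Let lebesgue_rVS_sigma_finite : sigma_finite [set: 'rV[R]_n.+1] lebesgue_rVS.
Proof.
have /sigma_finiteP[F [FT ndF Foo]] := sigma_finiteT (@lebesgue_measure R).
have /sigma_finiteP[G [GT ndG Goo]] := sigma_finiteT m.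
exists (fun k => @rV_uncons n @^-1` (F k `*` G k)).
  apply/esym; rewrite -subTset => x _.
  have [i _ Fi] : (\bigcup_k F k) (@rV_uncons n x).1 by rewrite -FT.
  have [j _ Gj] : (\bigcup_k G k) (@rV_uncons n x).2 by rewrite -GT.
  exists (maxn i j) => //; split.
    by move: Fi; exact/subsetPset/ndF/leq_maxl.
  by move: Gj; exact/subsetPset/ndG/leq_maxr.
move=> k; have [mF Fk] := Foo k; have [mG Gk] := Goo k; split.
  by rewrite -[X in measurable X]setTI; apply: measurable_rV_uncons => //; exact: measurableX.
rewrite /lebesgue_rVS /pushforward -comp_preimage.
rewrite (_ : @rV_uncons n \o @rV_cons n = id); last first.
  by apply/funext => z /=; rewrite rV_consK.
by rewrite preimage_id product_measure1E// lte_mul_pinfty// ge0_fin_numE.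
Qed.

HB.instance Definition _ := Measure_isSigmaFinite.Build _ _ _ lebesgue_rVS
  lebesgue_rVS_sigma_finite.

End lebesgue_rVS.

Fixpoint lebesgue_rV (n : nat) : {sigma_finite_measure set 'rV[R]_n -> \bar R} :=
  if n is k.+1 then lebesgue_rVS (lebesgue_rV k) else \d_(0 : 'rV[R]_0).

Lemma measurable_rV_box n (I : 'I_n -> interval R) :
  measurable [set x : 'rV[R]_n | forall i, x ord0 i \in I i].
Proof.
rewrite (_ : mkset _ = \bigcap_(i in [set: 'I_n]) (@rV_coord R n i @^-1` [set` I i])).
  apply: (@fin_bigcap_measurable _ _ _ [set: 'I_n]) => [|i _]; first exact: finite_finset.
  by rewrite -[X in measurable X]setTI; apply: measurable_coord => //; apply: measurable_itv.
by apply/seteqP; split => x /= h i; [move=> _; exact: h|exact: h].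
Qed.

Lemma lebesgue_rV_box n (I : 'I_n -> interval R) :
  lebesgue_rV n [set x | forall i, x ord0 i \in I i] =
  (\prod_(i < n) lebesgue_measure [set` I i])%E.
Proof.
elim: n I => [|n IH] I.
  rewrite big_ord0 /= /dirac indicE mem_set //.
  by case.
rewrite big_ord_recl /= /lebesgue_rVS /pushforward -IH.
rewrite -product_measure1E //; last exact: measurable_rV_box.
congr ((_ \x _)%E _); apply/seteqP; split => [z /= h|z /= [h1 h2] i].
  split=> [|j].
    by have := h ord0; rewrite mxE unlift_none.
  by have := h (lift ord0 j); rewrite mxE liftK.
by case: (unliftP ord0 i) => [j|] ->; rewrite mxE ?liftK ?unlift_none.
Qed.

End lebesgue_rV.

(** * Euclidean structure and domains *)

Section euclidean.
Variables (R : realType) (d : nat).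
Local Notation E := 'rV[R]_d.
Implicit Types (x y h e z : E) (A Omega : set E).

Definition dotv x y : R := \sum_(i < d) x ord0 i * y ord0 i.

(* The library's norm on 'rV[R]_d is the sup norm. *)
Definition enorm x : R := Num.sqrt (dotv x x).

Definition eball x (r : R) : set E := [set y | enorm (y - x) < r].
Definition ecball x (r : R) : set E := [set y | enorm (y - x) <= r].

Definition boundary A : set E := closure A `\` A°.

Definition set_dist A B : R := inf [set enorm (x - y) | x in A & y in B].

Definition segment x y : set E :=
  [set x + t *: (y - x) | t in [set t : R | 0 <= t <= 1]].

(* Near each boundary point, Omega is the part above the graph of a Lipschitz
   function phi of d - 1 variables, in the orthogonal coordinates in which e is
   the vertical unit vector: x = x' + x_d e with x_d = <x, e> and x' in the
   hyperplane orthogonal to e. *)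
Definition lipschitz_boundary Omega : Prop :=
  forall z, boundary Omega z ->
  exists (U : set E) (e : E) (phi : E -> R) (L : R),
    [/\ open U /\ U z,
        dotv e e = 1,
        forall y y', dotv y e = 0 -> dotv y' e = 0 ->
          `|phi y - phi y'| <= L * enorm (y - y') &
        forall x, U x ->
          (Omega x <-> phi (x - dotv x e *: e) < dotv x e)].

Definition lipschitz_domain Omega : Prop :=
  [/\ open Omega, connected Omega & lipschitz_boundary Omega].

End euclidean.

(** * Classical partial derivatives and test functions *)

Section partial_derivatives.
Variables (R : realType) (d : nat).
Local Notation E := 'rV[R]_d.
Implicit Types (g v : E -> R) (s : seq 'I_d) (nu : 'I_d -> nat) (Omega K : set E).

Definition partial (i : 'I_d) g : E -> R := 'D_(delta_mx ord0 i) g.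

Definition partials s g : E -> R := foldr partial g s.

Definition mindex_abs nu : nat := (\sum_(i < d) nu i)%N.

(* Every multi-index of order at most l is mindex l nu for exactly one nu. *)
Definition mindex l (nu : {ffun 'I_d -> 'I_l.+1}) : 'I_d -> nat := fun i => nu i.

Definition mindex_unit (i : 'I_d) : 'I_d -> nat := fun j => (j == i) : nat.

Definition mindex_seq nu : seq 'I_d := flatten [seq nseq (nu i) i | i <- enum 'I_d].

Definition mpartial nu g : E -> R := partials (mindex_seq nu) g.

Definition grad g (x : E) : E := \row_i partial i g x.

Definition smooth v : Prop := forall s,
  continuous (partials s v) /\
  forall (i : 'I_d) x, derivable (partials s v) x (delta_mx ord0 i).

Definition test_function Omega v : Prop :=
  [/\ smooth v, compact (closure [set x | v x != 0]) &
      closure [set x | v x != 0] `<=` Omega].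

End partial_derivatives.

(** * Lebesgue and Sobolev spaces *)

Section sobolev.
Variables (R : realType) (d : nat).
Local Notation E := 'rV[R]_d.
Local Notation mu := (lebesgue_rV R d).
Implicit Types (g h u v w : E -> R) (nu : 'I_d -> nat) (Omega A : set E) (p s : R).

Definition Lnorm_on A p g : \bar R := 'N[mu]_(p%:E)[EFin \o (g \_ A)].

Definition Lp A p g : Prop :=
  measurable_fun A g /\ (Lnorm_on A p g < +oo)%E.

Definition locally_integrable_on Omega g : Prop :=
  measurable_fun Omega g /\
  forall K, compact K -> K `<=` Omega -> mu.-integrable K (EFin \o g).

Definition is_weak_deriv Omega nu g h : Prop :=
  [/\ locally_integrable_on Omega g, locally_integrable_on Omega h &
  forall v, test_function Omega v ->
    (\int[mu]_(x in Omega) (g x * mpartial nu v x)%:E =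
     ((-1) ^+ mindex_abs nu)%:E * \int[mu]_(x in Omega) (h x * v x)%:E)%E].

(* A representative of the weak derivative, which is unique almost everywhere. *)
Definition weak_deriv Omega nu g : E -> R := get (is_weak_deriv Omega nu g).

Definition weak_grad Omega g (x : E) : E :=
  \row_i weak_deriv Omega (mindex_unit i) g x.

Definition sobolevN l Omega p g : Prop :=
  Lp Omega p g /\
  forall nu, (mindex_abs nu <= l)%N ->
    is_weak_deriv Omega nu g (weak_deriv Omega nu g) /\
    Lp Omega p (weak_deriv Omega nu g).

Definition gagliardo Omega p (beta : R) g : \bar R :=
  \int[mu]_(x in Omega) \int[mu]_(y in Omega)
    (`|g x - g y| `^ p / enorm (x - y) `^ (d%:R + beta * p))%:E.

(* W^s(L_p(Omega)) for 0 <= s = l + beta with l = floor s. *)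
Definition sobolev s Omega p g : Prop :=
  let l := Num.truncn s in let beta := s - l%:R in
  sobolevN l Omega p g /\
  (0 < beta ->
   (\sum_(nu : {ffun 'I_d -> 'I_l.+1} | mindex_abs (mindex nu) == l)
      gagliardo Omega p beta (weak_deriv Omega (mindex nu) g) < +oo)%E).

Definition sobolev1_norm Omega p g : \bar R :=
  (\sum_(nu : {ffun 'I_d -> 'I_2} | (mindex_abs (mindex nu) <= 1)%N)
      Lnorm_on Omega p (weak_deriv Omega (mindex nu) g))%E.

(* W^1_0(L_p(Omega)) *)
Definition sobolev10 Omega p g : Prop :=
  sobolevN 1 Omega p g /\
  forall eps : R, 0 < eps ->
    exists2 v, test_function Omega v &
      (sobolev1_norm Omega p (g \- v)%R < eps%:E)%E.

(* W^{-1}(L_{p'}(Omega)), the bounded linear functionals on W^1_0(L_p(Omega)).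
   Boundedness forces f to respect almost everywhere equality on Omega. *)
Definition sobolev_dual Omega p (f : (E -> R) -> R) : Prop :=
  (forall (a : R) v w, sobolev10 Omega p v -> sobolev10 Omega p w ->
     f (fun x => a * v x + w x) = a * f v + f w) /\
  exists C : R, forall v, sobolev10 Omega p v ->
    (`|f v|%:E <= C%:E * sobolev1_norm Omega p v)%E.

(* 0 `^ a is 0 or 1, so the integrand vanishes at the zeros of the gradient of u,
   also for p < 2. *)
Definition weak_solution Omega p (f : (E -> R) -> R) u : Prop :=
  sobolevN 1 Omega p u /\
  forall v, test_function Omega v ->
    (\int[mu]_(x in Omega)
       (dotv (enorm (weak_grad Omega u x) `^ (p - 2) *: weak_grad Omega u x)
             (grad v x))%:E = (f v)%:E)%E.

End sobolev.

(** * Besov spaces *)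

Section besov.
Variables (R : realType) (d : nat).
Local Notation E := 'rV[R]_d.
Implicit Types (g : E -> R) (r : nat) (h x : E) (Omega : set E) (tau sigma t : R).

Definition diff_domain Omega r h : set E :=
  [set x | Omega x /\ segment x (x + r%:R *: h) `<=` Omega].

Definition finite_diff r h g (x : E) : R :=
  \sum_(k < r.+1) (-1) ^+ (r - k) * 'C(r, k)%:R * g (x + k%:R *: h).

Definition modulus r g t Omega tau : \bar R :=
  ereal_sup [set Lnorm_on (diff_domain Omega r h) tau (finite_diff r h g) |
             h in [set h | enorm h <= t]].

(* B^sigma_tau(L_tau(Omega)), measured with differences of order r > floor sigma. *)
Definition besov r sigma Omega tau g : Prop :=
  Lp Omega tau g /\
  (\int[lebesgue_measure]_(t in [set t : R | (0 < t)%R])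
     (((t `^ (- sigma))%:E * modulus r g t Omega tau) `^ tau * (t^-1)%:E) < +oo)%E.

End besov.

(** * Locally weighted Hoelder spaces *)

Section hoelder.
Variables (R : realType) (d : nat).
Local Notation E := 'rV[R]_d.
Implicit Types (g : E -> R) (l : nat) (K Omega : set E) (alpha gamma c : R).

Definition unif_continuous_on K g : Prop :=
  forall eps : R, 0 < eps -> exists2 del : R, 0 < del &
    forall x y, K x -> K y -> enorm (x - y) < del -> `|g x - g y| < eps.

(* K is meant to lie in the open set Omega on which g matters, so that 'D at a
   point of K, even on its sphere, depends only on g on Omega. All orders of
   differentiation are required. *)
Definition Cl l K g : Prop :=
  (forall s : seq 'I_d, (size s < l)%N ->
     forall (i : 'I_d) x, K x -> derivable (partials s g) x (delta_mx ord0 i)) /\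
  (forall s : seq 'I_d, (size s <= l)%N ->
     unif_continuous_on K (partials s g) /\
     exists M : R, forall x, K x -> `|partials s g x| <= M).

Definition hoelder_seminorm l alpha K g : \bar R :=
  (\sum_(nu : {ffun 'I_d -> 'I_l.+1} | mindex_abs (mindex nu) == l)
     ereal_sup [set (`|mpartial (mindex nu) g z.1 - mpartial (mindex nu) g z.2| /
                     enorm (z.1 - z.2) `^ alpha)%:E |
                z in [set z : E * E | [/\ K z.1, K z.2 & z.1 <> z.2]]])%E.

Definition Cla l alpha K g : Prop :=
  Cl l K g /\ (hoelder_seminorm l alpha K g < +oo)%E.

Definition ball_family c Omega : set (set E) :=
  [set K | exists (x : E) (r : R),
     [/\ Omega x, 0 < r, K = ecball x r, K `<=` Omega &
         eball x (c * r) `<=` Omega]].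

Definition Cla_loc l alpha gamma c Omega g : Prop :=
  (forall K, ball_family c Omega K -> Cla l alpha K g) /\
  (ereal_sup [set ((set_dist K (boundary Omega)) `^ gamma)%:E *
                  hoelder_seminorm l alpha K g |
              K in ball_family c Omega] < +oo)%E.

End hoelder.

(* Main.v *)
(** For h of norm t, the r-th difference of u is estimated separately on the part
    of Omega at distance less than A t from the boundary and on the rest. The
    boundary layer has measure O(t), so there Hoelder's inequality passes from
    L_tau to L_p, where u in W^s yields O(t^s); for s close to sbar this gives
    O(t^(s + sigma / d)) in L_tau. At distance delta >= A t from the boundary the
    weighted Hoelder seminorm gives O(t^(l + alpha) delta^(-gamma)) pointwise, and
    summing over the dyadic layers delta ~ 2^k t gives
    O(t^(l + alpha + 1 / tau - gamma')) for every gamma' >= gamma with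
    gamma' > 1 / tau. By the bound on gamma, both exponents exceed sigma if sigma is
    at most slightly larger than sbar. For sigma < sbar it suffices to bound the
    L_tau norm on the bounded set Omega by the L_p norm.

    The bound O(t^s) in L_p follows from the Gagliardo seminorm by averaging
    g(x + h) - g(x) over intermediate points y in Omega near x, which fill a fixed
    proportion of a ball because the domain is Lipschitz. This applies to the
    derivatives of u of order floor s, whose weak and classical versions agree
    almost everywhere. *)

Require Import Defs.
From mathcomp Require Import all_boot all_order all_algebra.
From mathcomp Require Import all_classical all_reals all_analysis.
From mathcomp Require Import measurable_realfun.
From mathcomp Require Import ring lra.

Set Implicit Arguments.
Unset Strict Implicit.
Unset Printing Implicit Defensive.

Import Order.TTheory GRing.Theory Num.Theory.
Import numFieldNormedType.Exports.

Local Open Scope classical_set_scope.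
Local Open Scope ring_scope.

(** The exponent tau may be below 1, where Minkowski's inequality and convexity fail. The estimates
    are therefore made on [Jp], the integral of the tau-th power, and rest on pointwise inequalities
    valid for every positive exponent. Hoelder's and Jensen's inequalities both come, up to a
    constant, from [powR_le_split] with a threshold that is chosen at each use. The Gagliardo
    seminorm says something only at nonintegral smoothness. Each s below sbar is therefore placed
    strictly between consecutive integers; if sbar = l, only derivatives of order l - 1 are
    available in L_p up to the boundary, although u is of class C^l inside. Classical derivatives
    are given only as directional derivatives along coordinate vectors. Linearity in the direction,
    symmetry of mixed derivatives, integration by parts and the existence of bump functions are
    therefore derived from mean values, translation invariance and explicit formulas. *)

(** * The sup norm, the Euclidean norm and Borel sets *)

Section norms.
Context {R : realType} {d : nat}.
Local Notation E := 'rV[R]_d.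
Implicit Types (x y h : E) (a : R).

Lemma coord_le_norm x i : `|x ord0 i| <= `|x|.
Proof.
rewrite [`|x|]mx_normrE.
exact: (le_bigmax _ (fun k : 'I_1 * 'I_d => `|x k.1 k.2|) (ord0, i)).
Qed.

Lemma norm_le_coord x a : 0 <= a -> (forall i, `|x ord0 i| <= a) -> `|x| <= a.
Proof.
move=> a0 xa; rewrite [`|x|]mx_normrE; apply: bigmax_le => // -[i j] _ /=.
by rewrite ord1.
Qed.

Lemma norm_lt_coord x a : 0 < a -> (forall i, `|x ord0 i| < a) -> `|x| < a.
Proof.
move=> a0 xa; rewrite [`|x|]mx_normrE; apply: bigmax_lt => // -[i j] _ /=.
by rewrite ord1.
Qed.

Lemma norm_delta_mx (i : 'I_d) : `|delta_mx ord0 i : E| = 1.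
Proof.
apply/eqP; rewrite eq_le; apply/andP; split.
  by apply: norm_le_coord => // j; rewrite mxE eqxx/=; case: (j == i); rewrite ?normr1 ?normr0.
by apply: le_trans (coord_le_norm _ i); rewrite mxE !eqxx normr1.
Qed.

Lemma dotv_ge0 x : 0 <= dotv x x.
Proof. by apply: sumr_ge0 => i _; rewrite -expr2 sqr_ge0. Qed.

Lemma norm_le_enorm x : `|x| <= enorm x.
Proof.
apply: norm_le_coord => [|i]; first exact: sqrtr_ge0.
rewrite -sqrtr_sqr ler_sqrt ?dotv_ge0// /dotv (bigD1 i)//= expr2 lerDl.
by apply: sumr_ge0 => j _; rewrite -expr2 sqr_ge0.
Qed.

Lemma enorm_le_norm x : enorm x <= d%:R * `|x|.
Proof.
rewrite -[leRHS]ger0_norm ?mulr_ge0// -sqrtr_sqr ler_sqrt ?sqr_ge0//.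
apply: (@le_trans _ _ (\sum_(i < d) `|x| ^+ 2)).
  apply: ler_sum => i _; rewrite -expr2 -[leLHS]ger0_norm ?sqr_ge0// normrX lerXn2r ?nnegrE//.
  exact: coord_le_norm.
rewrite sumr_const card_ord -[leLHS]mulr_natl exprMn.
apply: ler_wpM2r; first exact: sqr_ge0.
by rewrite -natrX ler_nat; case: (d) => // n; rewrite expnS leq_pmulr// expn_gt0.
Qed.

Lemma row_sum_coord x : x = \sum_(i < d) x ord0 i *: delta_mx ord0 i.
Proof. exact: row_sum_delta. Qed.

(** The open ball of the sup norm, preferred to [eball] because it is a box of known measure;
    passing between the two norms costs at most a factor d. *)
Definition nball x (r : R) : set E := [set y | `|y - x| < r].

Lemma rV_ballE x (r : R) : ball x r = nball x r.
Proof. by apply/seteqP; split => y; rewrite mx_norm_ball /ball_ /= distrC. Qed.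

Lemma norm_box x (r : R) : 0 < r ->
  nball x r = [set y : E | forall i, y ord0 i \in `]x ord0 i - r, x ord0 i + r[].
Proof.
move=> r0; apply/seteqP; split => y /= xy.
  move=> i; rewrite in_itv/= -ltr_distl; apply: le_lt_trans xy.
  by have := coord_le_norm (y - x) i; rewrite !mxE.
apply: norm_lt_coord => // i; rewrite !mxE ltr_distl.
by have := xy i; rewrite in_itv.
Qed.

Local Notation mu := (lebesgue_rV R d).

Lemma measurable_norm_ball x (r : R) : measurable (nball x r).
Proof.
have [r0|r0] := ltP 0 r; first by rewrite norm_box//; exact: measurable_rV_box.
rewrite (_ : nball x r = set0)//; apply/seteqP; split => // y; rewrite /nball/=.
by rewrite ltNge (le_trans r0).
Qed.

Lemma lebesgue_norm_ball x (r : R) : 0 < r ->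
  mu (nball x r) = ((2 * r) ^+ d)%:E.
Proof.
move=> r0; rewrite norm_box// lebesgue_rV_box.
rewrite (eq_bigr (fun=> (2 * r)%:E)); last first.
  move=> i _; rewrite lebesgue_measure_itv /= lte_fin.
  by rewrite ltrD2l gtrN// -EFinB; congr EFin; lra.
by rewrite prodEFin prodr_const card_ord.
Qed.

(** The pairs (rational center, k) form a countable family. The open ball contains x, while already
    the closed one lies in U, so that it can also serve as a compact neighbourhood in the
    fundamental lemma. *)
Lemma open_rat_ball (U : set E) x : open U -> U x ->
  exists2 q : 'rV[rat]_d * nat, nball (map_mx ratr q.1) q.2.+1%:R^-1 x &
    [set y | `|y - map_mx ratr q.1| <= q.2.+1%:R^-1] `<=` U.
Proof.
move=> oU Ux; have /nbhs_ballP[e /= e0] := open_nbhs_nbhs (conj oU Ux).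
rewrite rV_ballE => eU.
pose k := Num.truncn (2 / e).
have ke : 2 * k.+1%:R^-1 < e.
  rewrite ltr_pdivrMr// mulrC -ltr_pdivrMr//.
  by have /andP[_] := truncn_itv (divr_ge0 (ler0n R 2) (ltW e0)).
have k0 : 0 < (k.+1%:R^-1 : R) by rewrite invr_gt0.
have /choice[q qP] (i : 'I_d) : exists q : rat, `|x ord0 i - ratr q| < k.+1%:R^-1.
  have /rat_in_itvoo[q] : x ord0 i - k.+1%:R^-1 < x ord0 i + k.+1%:R^-1.
    by rewrite ltrD2l gtrN.
  by rewrite in_itv/= -ltr_distl distrC => qx; exists q.
have xB : nball (map_mx ratr (\row_i q i)) k.+1%:R^-1 x.
  by rewrite /nball /=; apply: norm_lt_coord => // i; rewrite !mxE.
exists (\row_i q i, k) => // y /= By; apply: eU => /=.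
rewrite /nball/= -(subrKA (map_mx ratr (\row_i q i))); apply: le_lt_trans (ler_normD _ _) _.
apply: lt_trans ke; rewrite mulr2n mulrDl mul1r ler_ltD// distrC; exact: xB.
Qed.

(** The sigma-algebra is defined through the coordinates; an open set belongs to it as a countable
    union of rational boxes. *)
Lemma rV_open_measurable (U : set E) : open U -> measurable U.
Proof.
move=> oU.
pose B (q : 'rV[rat]_d * nat) := nball (map_mx ratr q.1) (q.2.+1%:R^-1).
rewrite (_ : U = \bigcup_(q in [set q | B q `<=` U]) B q).
  rewrite bigcup_mkcond; apply: countable_bigcupT_measurable => [|q].
    exact: countableP.
  by case: ifP => // _; exact: measurable_norm_ball.
apply/seteqP; split => [x Ux|x [q /= qU]]; last exact: qU.
have [q qx KU] := open_rat_ball oU Ux.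
by exists q => //= y /= /ltW; exact: KU.
Qed.

Lemma measurable_fun_rV_continuous (U : set E) (g : E -> R) :
  open U -> {in U, continuous g} -> measurable_fun U g.
Proof.
move=> oU cg; apply: (measurability _ (RGenOpens.measurableE R)).
move=> _ [_ [a [b ->]] <-]; apply: rV_open_measurable.
rewrite openE => x [Ux gx]; apply: filterI; first exact: open_nbhs_nbhs.
by apply: (cg _ _ _); [rewrite inE|apply: open_nbhs_nbhs; split => //; exact: interval_open].
Qed.

End norms.

(** * Translation invariance of Lebesgue measure *)

Section translation.
Context {R : realType}.

Definition shift_rV d (h x : 'rV[R]_d) : 'rV[R]_d := x + h.

Lemma measurable_shift_rV d (h : 'rV[R]_d) : measurable_fun setT (shift_rV h).
Proof.
apply: measurable_fun_coordP => i.
rewrite (_ : _ \o _ = fun x => rV_coord i x + h ord0 i).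
  by apply: measurable_funD => //; exact: measurable_coord.
by apply/funext => x; rewrite /rV_coord /shift_rV /= mxE.
Qed.

(** By uniqueness of the measure with the given values on half-open intervals. *)
Lemma lebesgue_measure_shift (a : R) (A : set R) : measurable A ->
  lebesgue_measure ((fun x => x + a) @^-1` A) = lebesgue_measure A.
Proof.
move=> mA.
have mf : measurable_fun setT ((fun x => x + a) : measurableTypeR R -> measurableTypeR R).
  exact: measurable_funD.
suff : lebesgue_measure A = pushforward lebesgue_measure
    ((fun x => x + a) : measurableTypeR R -> measurableTypeR R) A by move->.
apply: lebesgue_measure_unique => //= _ [[b c] _ <-].
rewrite /pushforward (_ : _ @^-1` _ = `]b - a, c - a]%classic).
  rewrite !lebesgue_measure_itv/= !lte_fin ltrD2r; case: ifP => // _.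
  by rewrite -!EFinD; congr EFin; ring.
by apply/seteqP; split => x /=; rewrite !in_itv/= ltrBlDr lerBrDr.
Qed.

(** The pushforward of the product measure agrees with it on rectangles, which determines it. *)
Lemma product_measure_preserving d1 d2 (T1 : measurableType d1) (T2 : measurableType d2)
    (m1 : {sigma_finite_measure set T1 -> \bar R})
    (m2 : {sigma_finite_measure set T2 -> \bar R})
    (f1 : T1 -> T1) (f2 : T2 -> T2) :
  measurable_fun setT f1 -> measurable_fun setT f2 ->
  (forall A, measurable A -> m1 (f1 @^-1` A) = m1 A) ->
  (forall A, measurable A -> m2 (f2 @^-1` A) = m2 A) ->
  forall A, measurable A ->
  (m1 \x m2)%E ((fun z => (f1 z.1, f2 z.2)) @^-1` A) = (m1 \x m2)%E A.
Proof.
move=> mf1 mf2 m1E m2E A mA.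
set s := (X in X @^-1` _).
have ms : measurable_fun setT s.
  apply/measurable_fun_pairP; split.
    by apply: (measurableT_comp mf1).
  by apply: (measurableT_comp mf2).
pose m' := @measure_function_pushforward__canonical__measure_function_Measure _ _ _ _ _
  (m1 \x m2)%E s ms.
have m'E B C : measurable B -> measurable C -> m' (B `*` C) = (m1 B * m2 C)%E.
  move=> mB mC.
  rewrite /m' /= /pushforward (_ : _ @^-1` _ = (f1 @^-1` B) `*` (f2 @^-1` C))//.
  rewrite -(m1E _ mB) -(m2E _ mC); apply: product_measure1E.
    by rewrite -[X in measurable X]setTI; apply: mf1.
  by rewrite -[X in measurable X]setTI; apply: mf2.
exact/esym/(product_measure_unique m'E).
Qed.

(** [rV_cons] turns the translation by h into the product of the translations by the first
    coordinate of h and by the remaining ones, so induction on d applies. *)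
Lemma lebesgue_rV_shift d (h : 'rV[R]_d) (A : set 'rV[R]_d) : measurable A ->
  lebesgue_rV R d (shift_rV h @^-1` A) = lebesgue_rV R d A.
Proof.
elim: d h A => [|d IH] h A mA.
  by rewrite (_ : _ @^-1` _ = A)//; apply/seteqP; split => x;
    rewrite /shift_rV/= (_ : x + h = x)//; apply/rowP => -[].
rewrite /= /lebesgue_rVS /pushforward.
have mcA : measurable (@rV_cons R d @^-1` A).
  by rewrite -[X in measurable X]setTI; exact: measurable_rV_cons.
pose s (z : R * 'rV[R]_d) := (z.1 + h ord0 ord0, shift_rV (rV_uncons h).2 z.2).
rewrite (_ : _ @^-1` _ = s @^-1` (@rV_cons R d @^-1` A)); last first.
  apply/seteqP; split => z /=; rewrite (_ : shift_rV _ _ = rV_cons (s z))//;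
    apply/rowP => i; rewrite /shift_rV/= !mxE;
    by case: (unliftP ord0 i) => [j|] -> //=; rewrite !mxE.
have mcA' : @measurable _ (measurableTypeR R * 'rV[R]_d)%type (@rV_cons R d @^-1` A) by exact: mcA.
apply: (@product_measure_preserving _ _ (measurableTypeR R) 'rV[R]_d lebesgue_measure (lebesgue_rV R d) (fun x => x + h ord0 ord0) (shift_rV (rV_uncons h).2) _ _ _ _ _ mcA').
- exact: measurable_funD.
- exact: measurable_shift_rV.
- by move=> B mB; apply: lebesgue_measure_shift.
- by move=> B mB; apply: IH.
Qed.

End translation.

Section translation_integral.
Context {R : realType} {d : nat}.
Local Notation E := 'rV[R]_d.
Local Notation mu := (lebesgue_rV R d).

Lemma ge0_integral_shift (h : E) (A : set E) (f : E -> \bar R) :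
  measurable A -> measurable_fun A f -> (forall x, A x -> 0 <= f x)%E ->
  (\int[mu]_(x in shift_rV h @^-1` A) f (x + h)%R = \int[mu]_(x in A) f x)%E.
Proof.
move=> mA mf f0.
have := @ge0_integral_pushforward _ _ _ _ R (shift_rV h) (measurable_shift_rV h) mu A f mA mf.
move=> <-; last by move=> x; rewrite inE; exact: f0.
apply: eq_measure_integral => [|h1]; last first.
  by move=> B mB BA; apply: lebesgue_rV_shift.
exact: measurable_shift_rV.
Qed.

End translation_integral.

(** * The boundary layer *)

Section layers.
Context {R : realType} {d : nat}.
Local Notation E := 'rV[R]_d.
Local Notation mu := (lebesgue_rV R d).
Implicit Types (x y z e : E) (Omega : set E) (t rho A : R).

Lemma nbhs_rVP x (P : set E) :
  nbhs x P <-> exists2 r : R, 0 < r & forall y, `|y - x| < r -> P y.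
Proof.
split=> [/nbhs_ballP[r /= r0 rP]|[r r0 rP]].
  by exists r => // y xy; apply: rP; rewrite rV_ballE.
by apply/nbhs_ballP; exists r => //= y; rewrite rV_ballE => /rP.
Qed.

Lemma open_norm_ball x t : open (nball x t).
Proof. by rewrite -rV_ballE; exact: ball_open. Qed.

Lemma bounded_set_norm_lt Omega : bounded_set Omega ->
  exists2 M : R, 0 < M & forall x, Omega x -> `|x| < M.
Proof.
move=> /pinfty_ex_gt0[M M0 OM]; exists (M + 1); first by rewrite addr_gt0.
by move=> x Ox; apply: (le_lt_trans (OM x Ox)); rewrite ltrDl.
Qed.

Lemma bounded_compact_closure Omega : bounded_set Omega -> compact (closure Omega).
Proof.
move=> /bounded_set_norm_lt[M M0 OM]; apply: bounded_closed_compact; last exact: closed_closure.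
exists (M + 1); split; first exact: num_real.
move=> a Ma x /(_ [set y | `|y - x| < 1]).
case; first by apply/nbhs_rVP; exists 1.
move=> y [/OM yM /= yx]; rewrite -(subrK y x) (le_trans (ler_normD _ _))//.
by rewrite distrC (le_trans _ (ltW Ma))// addrC lerD// ltW.
Qed.

Lemma measure_bounded Omega (M : R) : measurable Omega -> 0 < M ->
  (forall x, Omega x -> `|x| < M) -> (mu Omega <= ((2 * M) ^+ d)%:E)%E.
Proof.
move=> mO M0 OM; rewrite -(lebesgue_norm_ball 0 M0).
apply: le_measure; rewrite ?inE//; first exact: measurable_norm_ball.
by move=> x /OM; rewrite /nball/= subr0.
Qed.

(* H is the signed height over the boundary graph, increasing at unit speed
   along e. *)
Definition height_chart Omega A rho x e (H : E -> R) : Prop :=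
  [/\ `|e| <= 1, forall y z, `|H y - H z| <= A * `|y - z|,
      forall z t, H (z + t *: e) = H z + t &
      forall y, `|y - x| < rho -> (Omega y <-> 0 < H y)].

Lemma dotvDl x y z : dotv (x + y) z = dotv x z + dotv y z.
Proof. by rewrite /dotv -big_split /=; apply: eq_bigr => i _; rewrite mxE mulrDl. Qed.

Lemma dotvZl t y z : dotv (t *: y) z = t * dotv y z.
Proof. by rewrite /dotv mulr_sumr; apply: eq_bigr => i _; rewrite mxE mulrA. Qed.

Lemma dotv_le_norm x e : `|e| <= 1 -> `|dotv x e| <= d%:R * `|x|.
Proof.
move=> e1; apply: le_trans (ler_norm_sum _ _ _) _.
rewrite (@le_trans _ _ (\sum_(i < d) `|x|))//; last by rewrite sumr_const card_ord -[leLHS]mulr_natl.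
apply: ler_sum => i _; rewrite normrM -[leRHS]mulr1.
by apply: ler_pM => //; [exact: coord_le_norm|apply: le_trans e1; exact: coord_le_norm].
Qed.

(** The height is the vertical coordinate minus the value of phi at the projection; moving along e
    leaves the projection unchanged. *)
Lemma lipschitz_height_chart Omega z :
  lipschitz_boundary Omega -> boundary Omega z ->
  exists A rho e H, [/\ 0 < A, 0 < rho & height_chart Omega A rho z e H].
Proof.
move=> lO /lO[U [e [phi [L [[oU Uz] ee phiL UO]]]]].
have /nbhs_rVP[rho rho0 rhoU] := open_nbhs_nbhs (conj oU Uz).
have e1 : `|e| <= 1 by rewrite -[leRHS]sqrtr1 -ee norm_le_enorm.
pose pr x := x - dotv x e *: e.
have pr0 x : dotv (pr x) e = 0.
  by rewrite /pr -scaleNr dotvDl dotvZl ee mulr1 subrr.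
have prB x y : pr x - pr y = (x - y) - dotv (x - y) e *: e.
  rewrite /pr (_ : dotv (x - y) e = dotv x e - dotv y e).
    by rewrite scalerBl !opprB; apply/rowP => i; rewrite !mxE; ring.
  by rewrite dotvDl -scaleN1r dotvZl mulN1r.
(* The first d bounds the inner product with e; in the second term, 1 + d bounds the projection and
   d passes from the Euclidean to the sup norm; the final 1 only makes [A] positive. *)
pose A := d%:R + `|L| * (d%:R * (1 + d%:R)) + 1.
exists A, rho, e, (fun x => dotv x e - phi (pr x)); split => //.
  by rewrite /A ltr_wpDl// addr_ge0// mulr_ge0// mulr_ge0// addr_ge0.
split => //.
- move=> x y.
  rewrite (_ : _ - _ = dotv (x - y) e - (phi (pr x) - phi (pr y))); last first.
    by rewrite [dotv (x - y) e]dotvDl -[- y]scaleN1r dotvZl; ring.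
  apply: le_trans (ler_normB _ _) _; rewrite /A -addrA mulrDl lerD ?dotv_le_norm//.
  apply: (le_trans (phiL _ _ (pr0 _) (pr0 _))).
  rewrite mulrDl mul1r ler_wpDr// -mulrA.
  apply: le_trans (ler_wpM2r (sqrtr_ge0 _) (ler_norm L)) _; rewrite ler_wpM2l//.
  apply: le_trans (enorm_le_norm _) _; rewrite -mulrA ler_wpM2l// prB.
  apply: le_trans (ler_normB _ _) _; rewrite mulrDl mul1r lerD2l normrZ.
  by rewrite -[leRHS]mulr1 ler_pM// dotv_le_norm.
- move=> x t; rewrite dotvDl dotvZl ee mulr1 (_ : pr (x + t *: e) = pr x); first by ring.
  by rewrite /pr dotvDl dotvZl ee mulr1 scalerDl; apply/rowP => i; rewrite !mxE; ring.
- by move=> y /rhoU /UO; rewrite subr_gt0.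
Qed.

Lemma height_chartW Omega A rho A' rho' x x' e H :
  A <= A' -> rho' + `|x' - x| <= rho ->
  height_chart Omega A rho x e H -> height_chart Omega A' rho' x' e H.
Proof.
move=> AA rr [e1 HA He HO]; split => // [y z|y yx].
  by apply: le_trans (HA y z) _; rewrite ler_wpM2r.
apply: HO; rewrite -(subrKA x'); apply: le_lt_trans (ler_normD _ _) _.
by apply: lt_le_trans rr; rewrite ltrD2r.
Qed.

(** A single parameter is both the radius and the inverse of the Lipschitz constant, so the property
    persists as rho decreases, and compactness of the closure gives one rho for all of its
    points. *)
Lemma uniform_height_chart Omega : bounded_set Omega -> lipschitz_domain Omega ->
  exists2 rho : R, 0 < rho & forall x, closure Omega x ->
    (forall y, `|y - x| < rho -> Omega y) \/
    exists e H, height_chart Omega rho^-1 rho x e H.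
Proof.
move=> bO [oO _ lO].
have /compact_near_coveringP cO := bounded_compact_closure bO.
pose P (rho : R) (x : E) := (forall y, `|y - x| < rho -> Omega y) \/
    exists e H, height_chart Omega rho^-1 rho x e H.
have : \forall rho \near 0^'+, closure Omega `<=` P rho.
  apply: cO => x Ox; have [Oxx|nOx] := pselect (Omega x).
    have /nbhs_rVP[r r0 rO] := open_nbhs_nbhs (conj oO Oxx).
    exists ([set y | `|y - x| < r / 2], [set rho : R | rho < r / 2]).
      split => /=; first by apply/nbhs_rVP; exists (r / 2) => //; rewrite divr_gt0.
      by apply: nbhs_right_lt; rewrite divr_gt0.
    move=> -[x' rho] /= [x'r rhor]; left => y yx'; apply: rO.
    rewrite -(subrKA x'); apply: le_lt_trans (ler_normD _ _) _.
    by rewrite (splitr r) ltrD// (lt_trans yx').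
  have bx : boundary Omega x by split => // /interior_subset.
  have [A [r [e [H [A0 r0 hc]]]]] := lipschitz_height_chart lO bx.
  exists ([set y | `|y - x| < r / 2], [set rho : R | [/\ 0 < rho, rho < r / 2 & rho < A^-1]]).
    split => /=; first by apply/nbhs_rVP; exists (r / 2) => //; rewrite divr_gt0.
    near=> rho; split; near: rho; first exact: nbhs_right_gt.
      by apply: nbhs_right_lt; rewrite divr_gt0.
    by apply: nbhs_right_lt; rewrite invr_gt0.
  move=> -[x' rho] /= [x'r [rho0 rhor rhoA]]; right; exists e, H.
  apply: height_chartW hc; first by rewrite -[A]invrK lef_pV2 ?posrE ?invr_gt0// ltW.
  by rewrite (splitr r) lerD// ltW.
move=> rhoP; have : \forall rho \near 0^'+, 0 < rho /\ closure Omega `<=` P rho.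
  by near=> rho; split; near: rho; [exact: nbhs_right_gt|exact: rhoP].
by move=> /filter_ex[rho [rho0 HP]]; exists rho.
Unshelve. all: by end_near. Qed.

(** Distance to the boundary is expressed by a point of the complement: a point x of Omega lies
    outside the layer exactly when [nball x t] is contained in Omega. *)
Definition layer Omega t : set E :=
  [set x | Omega x /\ exists2 y, ~ Omega y & `|x - y| < t].

Lemma layer_open Omega t : open Omega -> open (layer Omega t).
Proof.
move=> oO; rewrite (_ : layer _ _ = Omega `&` \bigcup_(y in ~` Omega) nball y t).
  by apply: openI => //; apply: bigcup_open => y _; exact: open_norm_ball.
by apply/seteqP; split => x [Ox [y]]; split => //; exists y.
Qed.

Lemma measurable_layer Omega t : open Omega -> measurable (layer Omega t).
Proof. by move=> oO; apply: rV_open_measurable; exact: layer_open. Qed.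

Lemma layerS Omega t t' : t <= t' -> layer Omega t `<=` layer Omega t'.
Proof. by move=> tt' x [Ox [y Oy xy]]; split => //; exists y => //; exact: lt_le_trans xy tt'. Qed.

(* Translates of the layer by multiples of A t e have disjoint height ranges,
   and about rho / (A t) of them fit into a fixed ball. *)
Lemma layer_chart_measure Omega A rho x e H t : open Omega ->
  4 <= A -> 0 < rho -> 0 < t -> height_chart Omega A rho x e H ->
  (mu (layer Omega t `&` nball x (rho / 4)%R) <=
   ((4 * rho) ^+ d * (2 * A / rho) * t)%:E)%E.
Proof.
move=> oO A4 rho0 t0 [e1 HA He HO].
have A1 : 1 <= A by apply: le_trans A4; rewrite ler1n.
have A0 : 0 < A by apply: lt_le_trans A1.
set S := layer Omega t `&` _.
have mS : measurable S by apply: measurableI; [exact: measurable_layer|exact: measurable_norm_ball].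
have Sball : S `<=` nball x rho.
  by move=> y [_]; rewrite /nball/=; lra.
(* For A t > rho the claimed bound exceeds the measure of the whole ball of radius rho. *)
have [Atrho|rhoAt] := ltP rho (A * t).
  apply: (@le_trans _ _ ((2 * rho) ^+ d)%:E).
    rewrite -(lebesgue_norm_ball x rho0); apply: le_measure; rewrite ?inE//.
    exact: measurable_norm_ball.
  rewrite lee_fin -mulrA -[leLHS]mulr1; apply: ler_pM => //.
  - by rewrite exprn_ge0// mulr_ge0// ltW.
  - by rewrite lerXn2r ?nnegrE ?mulr_ge0 ?(ltW rho0)// ler_pM2r// ler_nat.
  - by rewrite mulrAC ler_pdivlMr// mul1r -mulrA; nra.
have At0 : 0 < A * t by rewrite mulr_gt0.
have rat1 : 1 <= rho / (A * t) by rewrite ler_pdivlMr// mul1r.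
pose N := Num.truncn (rho / (A * t)).
have /andP[Nle ltN] := truncn_itv (le_trans ler01 rat1).
have N1 : 1 <= N%:R :> R by rewrite ler1n truncn_gt0.
(* A point of the complement within t has height at most 0, and H grows by less than A t over that
   distance. As A >= 4 gives t <= rho / 4, this point is still inside the chart. *)
have tH z : S z -> 0 < H z < A * t.
  move=> [[Oz [y nOy zy]]]; rewrite /nball/= => zx.
  have trho4 : t <= rho / 4 by rewrite ler_pdivlMr//; apply: le_trans rhoAt; rewrite mulrC ler_pM2r.
  have yx : `|y - x| < rho.
    rewrite -(subrKA z); apply: le_lt_trans (ler_normD _ _) _; rewrite distrC; lra.
  have zx' : `|z - x| < rho by lra.
  have Hz := (HO z zx').1 Oz.
  have Hy : H y <= 0 by rewrite leNgt; apply/negP => /(HO y yx).2.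
  rewrite Hz /=; apply: (@le_lt_trans _ _ `|H z - H y|).
    by apply: le_trans (ler_norm _); lra.
  by apply: le_lt_trans (HA z y) _; rewrite ltr_pM2l.
pose F (j : nat) := shift_rV (- (j%:R * (A * t)) *: e) @^-1` S.
have mF j : measurable (F j).
  by rewrite -[X in measurable X]setTI; exact: measurable_shift_rV.
have HF j z : F j z -> j%:R * (A * t) < H z < j.+1%:R * (A * t).
  move=> /tH; rewrite /shift_rV He => /andP[h1 h2].
  by rewrite -natr1 mulrDl mul1r; apply/andP; split; lra.
have tF : trivIset setT F.
  apply/trivIsetP => i j _ _ /eqP ij; apply/seteqP; split => // z [/HF/andP[i1 i2] /HF/andP[j1 j2]].
  have := lt_trans i1 j2; have := lt_trans j1 i2.
  rewrite !(ltr_pM2r At0) !ltr_nat !ltnS => ji ij'; case: ij.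
  by apply/eqP; rewrite eqn_leq ij' ji.
(* The translations have length at most N A t <= rho, so all translates stay in the ball of radius 2
   rho. *)
have sub : \big[setU/set0]_(j < N) F j `<=` nball x (2 * rho).
  rewrite -bigcup_mkord => z [j /= jN [_ zx]].
  rewrite /shift_rV /nball/= in zx *.
  have -> : z - x = (z + - (j%:R * (A * t)) *: e - x) + (j%:R * (A * t)) *: e.
    by apply/rowP => i; rewrite !mxE; ring.
  apply: le_lt_trans (ler_normD _ _) _; rewrite mulr2n mulrDl mul1r.
  have zx4 : `|z + - (j%:R * (A * t)) *: e - x| < rho by apply: lt_le_trans zx _; lra.
  apply: ltr_leD => //; rewrite normrZ -[leRHS]mulr1; apply: ler_pM => //.
  rewrite ger0_norm; last by rewrite mulr_ge0// ltW.
  by rewrite -ler_pdivlMr//; apply: le_trans Nle; rewrite ler_nat ltnW.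
have : (mu (\big[setU/set0]_(j < N) F j) <= ((2 * (2 * rho)) ^+ d)%:E)%E.
  rewrite -(lebesgue_norm_ball x); last by rewrite mulr_gt0.
  apply: le_measure; rewrite ?inE//; last exact: measurable_norm_ball.
  by apply: bigsetU_measurable.
rewrite measure_bigsetU//.
rewrite (eq_bigr (fun=> mu S)); last by move=> j _; apply: lebesgue_rV_shift.
have Sfin : mu S \is a fin_num.
  rewrite ge0_fin_numE ?measure_ge0//; apply: (@le_lt_trans _ _ ((2 * rho) ^+ d)%:E); last by rewrite ltry.
  rewrite -(lebesgue_norm_ball x rho0); apply: le_measure; rewrite ?inE//.
  exact: measurable_norm_ball.
rewrite -(fineK Sfin) sumEFin sumr_const card_ord !lee_fin.
have s0 : 0 <= fine (mu S) by apply: fine_ge0; exact: measure_ge0.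
rewrite mulrA (_ : 2 * 2 = 4 :> R); last by ring.
set D := (4 * rho) ^+ d; set s := fine _ in s0 *.
rewrite -[s *+ N]mulr_natl => NsD.
(* As N >= 1, rho / (A t) < N + 1 <= 2 N; this is the factor 2 in the bound. *)
have NAt : rho / (A * t) <= 2 * N%:R.
  by apply: ltW; apply: lt_le_trans ltN _; rewrite -natr1 -/N; lra.
have D0 : 0 <= D by rewrite exprn_ge0// mulr_ge0// ltW.
have -> : D * (2 * A / rho) * t = D * 2 / (rho / (A * t)).
  by field; rewrite !gt_eqF.
rewrite ler_pdivlMr ?divr_gt0//; nra.
Qed.

(** Finitely many balls of radius rho / 4 cover the closure. A ball around a point with a chart is
    handled by [layer_chart_measure]; around a point whose rho-ball lies in Omega the layer is empty
    for t <= rho / 4, and for larger t the measure of the ball is itself O(t). *)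
Lemma layer_measure Omega : bounded_set Omega -> lipschitz_domain Omega ->
  exists2 C : R, 0 < C & forall t, 0 < t -> (mu (layer Omega t) <= (C * t)%:E)%E.
Proof.
move=> bO lO; have [oO _ _] := lO.
have [rho rho0 chart] := uniform_height_chart bO lO.
have cO := bounded_compact_closure bO.
rewrite compact_cover in cO.
have [D DO Dcov] : finite_subset_cover (closure Omega) (fun x => nball x (rho / 4)) (closure Omega).
  apply: cO => [x _|x Ox]; first exact: open_norm_ball.
  by exists x => //; rewrite /nball/= subrr normr0 divr_gt0.
pose A := Num.max 4 rho^-1.
have A4 : 4 <= A by rewrite le_max lexx.
have A0 : 0 < A by lra.
pose C := (4 * rho) ^+ d * (2 * A / rho).
have C0 : 0 < C by rewrite mulr_gt0 ?exprn_gt0 ?divr_gt0 ?mulr_gt0.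
have local x t : closure Omega x -> 0 < t -> (mu (layer Omega t `&` nball x (rho / 4)%R) <= (C * t)%:E)%E.
  move=> Ox t0; have [bO'|[e [H hc]]] := chart x Ox.
    have [trho|rhot] := leP t (rho / 4).
      have Ct0 : 0 <= C * t by rewrite mulr_ge0// ltW.
      rewrite (_ : _ `&` _ = set0) ?measure0//.
      apply/seteqP; split => // y [[Oy [z nOz yz]] yx]; apply: nOz; apply: bO'.
      rewrite -(subrKA y); apply: le_lt_trans (ler_normD _ _) _.
      rewrite /nball/= in yx; rewrite distrC; lra.
    apply: (@le_trans _ _ (mu (nball x (rho / 4)))).
      apply: le_measure; rewrite ?inE//; last exact: measurable_norm_ball.
      by apply: measurableI; [exact: measurable_layer|exact: measurable_norm_ball].
    rewrite lebesgue_norm_ball ?divr_gt0// lee_fin /C -mulrA -[leLHS]mulr1.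
    apply: ler_pM => //; first by rewrite exprn_ge0// mulr_ge0// divr_ge0// ltW.
      by rewrite lerXn2r ?nnegrE ?mulr_ge0 ?divr_ge0 ?(ltW rho0)//; lra.
    by rewrite mulrAC ler_pdivlMr// mul1r; nra.
  apply: layer_chart_measure t0 (height_chartW _ _ hc) => //.
  by rewrite le_max lexx orbT.
  by rewrite subrr normr0 addr0.
pose S (s : seq E) := [set y | exists2 x, x \in s & nball x (rho / 4) y].
have mS s : measurable (S s).
  rewrite (_ : S s = \bigcup_(x in [set` s]) nball x (rho / 4)).
    by apply: fin_bigcup_measurable => // x _; exact: measurable_norm_ball.
  by apply/seteqP; split => y [x]; exists x.
have bound s t : 0 < t -> (forall x, x \in s -> closure Omega x) ->
    (mu (layer Omega t `&` S s) <= ((size s)%:R * C * t)%:E)%E.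
  move=> t0; elim: s => [_|x s IH xs].
    by rewrite (_ : _ `&` _ = set0) ?measure0 ?mul0r//; apply/seteqP; split => // y [_ []].
  apply: (@le_trans _ _ (mu ((layer Omega t `&` nball x (rho / 4)%R) `|` (layer Omega t `&` S s)))).
    apply: le_measure; rewrite ?inE//.
    - by apply: measurableI => //; exact: measurable_layer.
    - by apply: measurableU; apply: measurableI => //; [exact: measurable_layer|exact: measurable_norm_ball|exact: measurable_layer].
    - move=> y [ly [z]]; rewrite inE => /orP[/eqP ->|zs zy]; first by left.
      by right; split => //; exists z.
  apply: le_trans (measureU2 _ _ _) _.
  - by apply: measurableI; [exact: measurable_layer|exact: measurable_norm_ball].
  - by apply: measurableI => //; exact: measurable_layer.
  rewrite (_ : _ * t = C * t + (size s)%:R * C * t); last by rewrite /= -natr1; ring.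
  rewrite EFinD; apply: leeD.
    by apply: local => //; apply: xs; rewrite inE eqxx.
  by apply: IH => z zs; apply: xs; rewrite inE zs orbT.
pose s : seq E := finmap.enum_fset D.
exists ((size s).+1%:R * C) => [|t t0]; first by rewrite mulr_gt0.
apply: (@le_trans _ _ ((size s)%:R * C * t)%:E); last first.
  by rewrite lee_fin ler_pM2r// ler_pM2r// ler_nat.
apply: le_trans (bound s t t0 _); last by move=> x /DO; rewrite inE.
apply: le_measure; rewrite ?inE//; first exact: measurable_layer.
  by apply: measurableI => //; exact: measurable_layer.
move=> x lx; split => //; have [|y yD yx] := Dcov x; last by exists y.
by apply: subset_closure; case: lx.
Qed.

(** Moving x by t along e raises its height by t, so the ball of radius t / A around the new point
    stays above the graph. The radius rho / 3 leaves room for this ball inside the chart. *)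
Lemma corkscrew Omega : bounded_set Omega -> lipschitz_domain Omega ->
  exists c rho : R, [/\ 0 < c <= 1, 0 < rho & forall x t, Omega x -> 0 < t <= rho ->
    exists2 y, `|y - x| <= t & nball y (c * t) `<=` Omega].
Proof.
move=> bO lO; have [rho rho0 chart] := uniform_height_chart bO lO.
pose A := Num.max 1 rho^-1.
have A1 : 1 <= A by rewrite le_max lexx.
have A0 : 0 < A by lra.
exists A^-1, (rho / 3); split; [|by rewrite divr_gt0|].
  by rewrite invr_gt0 A0/= invf_le1.
move=> x t Ox /andP[t0 trho].
have At : A^-1 * t <= t by apply: ler_piMl; rewrite ?invf_le1// ltW.
have [bO'|[e [H [e1 HA He HO]]]] := chart x (subset_closure Ox).
  exists x; first by rewrite subrr normr0 ltW.
  by move=> y yx; apply: bO'; apply: lt_le_trans yx _; lra.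
exists (x + t *: e) => [|y].
  by rewrite addrC addKr normrZ gtr0_norm// ler_piMr// ltW.
rewrite /nball/= => yxt.
have te : `|t *: e| <= t by rewrite normrZ gtr0_norm// ler_piMr// ltW.
have yx : `|y - x| < rho.
  have -> : y - x = (y - (x + t *: e)) + t *: e by apply/rowP => i; rewrite !mxE; ring.
  by apply: le_lt_trans (ler_normD _ _) _; lra.
apply/(HO y yx).
have Hx : 0 < H x by apply/(HO x); rewrite ?subrr ?normr0.
have := HA y (x + t *: e); rewrite He.
have : rho^-1 * `|y - (x + t *: e)| < t.
  apply: (@le_lt_trans _ _ (A * `|y - (x + t *: e)|)).
    by apply: ler_wpM2r => //; rewrite le_max lexx orbT.
  by rewrite mulrC -ltr_pdivlMr// mulrC.
move: (rho^-1 * _) => q qt; rewrite ler_norml => /andP[]; lra.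
Qed.

Lemma complement_neq0 Omega : (0 < d)%N -> bounded_set Omega -> exists y, ~ Omega y.
Proof.
move=> d0 /bounded_set_norm_lt[M M0 OM]; exists (const_mx M) => /OM.
apply/negP; rewrite -leNgt; have := coord_le_norm (const_mx M) (Ordinal d0).
by rewrite mxE gtr0_norm.
Qed.

(** No point of Omega is farther than T from the complement, so finitely many dyadic layers exhaust
    Omega. *)
Lemma layer_all Omega : (0 < d)%N -> bounded_set Omega ->
  exists2 T : R, 0 < T & layer Omega T = Omega.
Proof.
move=> d0 bO; have [y nOy] := complement_neq0 d0 bO.
have [M M0 OM] := bounded_set_norm_lt bO.
exists (M + `|y|); first by rewrite ltr_pwDl.
apply/seteqP; split => [x []//|x Ox]; split => //; exists y => //.
by apply: le_lt_trans (ler_normB _ _) _; rewrite ltrD2r OM.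
Qed.

End layers.

(** * Classical derivatives and finite differences *)

Section directional.
Context {R : realType} {d : nat}.
Local Notation E := 'rV[R]_d.
Implicit Types (x y h e v : E) (g : E -> R) (s t c : R).

Lemma is_derive_line g y e s : derivable g (y + s *: e) e ->
  is_derive s 1 (fun t => g (y + t *: e)) ('D_e g (y + s *: e)).
Proof.
move=> dg.
have E : (fun t => t^-1 *: (((fun t => g (y + t *: e)) \o shift s) (t *: 1) - g (y + s *: e))) =
    (fun t => t^-1 *: ((g \o shift (y + s *: e)) (t *: e) - g (y + s *: e))).
  apply/funext => t /=; congr (_ *: (g _ - _)).
  by rewrite [t *: 1]mulr1 scalerDl addrCA.
by apply: DeriveDef; rewrite /derivable /derive E.
Qed.

Lemma line_continuous g y e s : derivable g (y + s *: e) e ->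
  {for s, continuous (fun t => g (y + t *: e))}.
Proof.
by move=> /is_derive_line dg; apply/differentiable_continuous/derivable1_diffP.
Qed.

Lemma line_MVT g y e c :
  (forall s, `|s| <= `|c| -> derivable g (y + s *: e) e) ->
  exists2 s, `|s| <= `|c| & g (y + c *: e) - g y = c * 'D_e g (y + s *: e).
Proof.
pose f t := g (y + t *: e).
have f0 : g y = f 0 by rewrite /f scale0r addr0.
move=> dg; rewrite f0 -/(f c).
have [c0|c0|<-] := ltgtP 0 c.
- have [||s] := @MVT R f (fun s => 'D_e g (y + s *: e)) 0 c c0.
  + move=> s; rewrite in_itv/= => /andP[s0 sc]; apply: is_derive_line; apply: dg.
    by rewrite !gtr0_norm ?ltW.
  + apply: continuous_in_subspaceT => s; rewrite inE/= in_itv/= => /andP[s0 sc].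
    by apply: line_continuous; apply: dg; rewrite !ger0_norm// (le_trans s0).
  rewrite in_itv/= => /andP[s0 sc] fE.
  exists s; first by rewrite !gtr0_norm ?ltW.
  by rewrite fE subr0 mulrC.
- have [||s] := @MVT R f (fun s => 'D_e g (y + s *: e)) c 0 c0.
  + move=> s; rewrite in_itv/= => /andP[s0 sc]; apply: is_derive_line; apply: dg.
    by rewrite !ltr0_norm// lerN2 ltW.
  + apply: continuous_in_subspaceT => s; rewrite inE/= in_itv/= => /andP[s0 sc].
    by apply: line_continuous; apply: dg; rewrite !ler0_norm ?lerN2// ltW.
  rewrite in_itv/= => /andP[s0 sc] fE.
  exists s; first by rewrite !ltr0_norm// lerN2 ltW.
  by rewrite -opprB fE sub0r mulrN opprK mulrC.
- by exists 0; rewrite ?normr0// subrr mul0r.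
Qed.

(** The extra increment along e is a mean value of the derivative in direction e at points tending
    to x, so continuity of that derivative suffices; along v the derivative need only exist at x. *)
Lemma is_derive_add g x v e c (A : R) : is_derive x v g A ->
  (\forall y \near x, derivable g y e) -> {for x, continuous ('D_e g)} ->
  is_derive x (v + c *: e) g (A + c * 'D_e g x).
Proof.
move=> dA de ce.
suff H : (fun t => t^-1 *: ((g \o shift x) (t *: (v + c *: e)) - g x)) @ 0^' -->
    A + c * 'D_e g x.
  apply: DeriveDef; first by apply/cvg_ex; exists (A + c * 'D_e g x).
  exact: cvg_lim H.
have -> : (fun t => t^-1 *: ((g \o shift x) (t *: (v + c *: e)) - g x)) =
    (fun t => t^-1 *: ((g \o shift x) (t *: v) - g x)) \+
    (fun t => t^-1 * (g (x + t *: v + (t * c) *: e) - g (x + t *: v))).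
  apply/funext => t /=; rewrite -[_ *: (g (_ *: v + x) - _)]/(t^-1 * _) -[LHS]/(t^-1 * _).
  rewrite -mulrDr scalerDr scalerA [_ + x]addrC addrA [t *: v + x]addrC; ring.
apply: cvgD.
  by have := @ex_derive _ _ _ _ _ _ _ dA; rewrite -(@derive_val _ _ _ _ _ _ _ dA).
apply/cvgrPdist_lt => eps eps0.
have eps1 : 0 < eps / (`|c| + 1) by rewrite divr_gt0// ltr_wpDl.
have /nbhs_rVP[r r0 rP] : \forall y \near x, derivable g y e /\
    `|'D_e g x - 'D_e g y| < eps / (`|c| + 1).
  by apply: filterI de _; move/cvgrPdist_lt : ce; exact.
pose M := `|v| + `|c| * `|e| + 1.
have M0 : 0 < M by rewrite ltr_wpDl// addr_ge0// mulr_ge0.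
near=> t.
have t0 : t != 0 by near: t; exact: nbhs_dnbhs_neq.
have tr : `|t| * M < r.
  rewrite -ltr_pdivlMr//; near: t; apply: dnbhs0_lt; exact: divr_gt0.
have nx s : `|s| <= `|t * c| -> `|x + t *: v + s *: e - x| < r.
  move=> sc; apply: le_lt_trans tr; rewrite addrAC [x + _]addrC addrK.
  apply: le_trans (ler_normD _ _) _; rewrite !normrZ /M !mulrDr.
  rewrite mulr1 ler_wpDr// lerD2l mulrA ler_wpM2r//.
  by rewrite -normrM.
have [s sc ->] := @line_MVT g (x + t *: v) e (t * c) (fun s sc => (rP _ (nx s sc)).1).
rewrite -mulrA mulKf// -mulrBr normrM.
have [_ lt] := rP _ (nx s sc).
apply: (@le_lt_trans _ _ (`|c| * (eps / (`|c| + 1)))).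
  by apply: ler_wpM2l => //; exact: ltW.
by rewrite mulrC -mulrA gtr_pMr// mulrC ltr_pdivrMr ?ltr_wpDl// mul1r ltrDl.
Unshelve. all: by end_near. Qed.

Lemma is_derive_coord g x h :
  (\forall y \near x, forall i, derivable g y (delta_mx ord0 i)) ->
  (forall i, {for x, continuous (partial i g)}) ->
  is_derive x h g (\sum_i h ord0 i * partial i g x).
Proof.
move=> dg cg; rewrite {1}(row_sum_coord h).
elim/big_rec2 : _ => [|i A v _ IH]; first exact: is_derive0.
rewrite addrC [_ + A]addrC; apply: is_derive_add => //.
  by apply: filterS dg => y; exact.
exact: cg.
Qed.

End directional.

(** * Functions of class C^k and symmetry of their derivatives *)

Section classes_Ck.
Context {R : realType} {d : nat}.
Local Notation E := 'rV[R]_d.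
Implicit Types (x y h e v : E) (g : E -> R) (Omega : set E) (s : seq 'I_d).

(** Ordered sequences of directions are used, so that passing to a derivative is concatenation and
    needs no symmetry. *)
Definition Ck_on Omega k g : Prop :=
  (forall s i x, (size s < k)%N -> Omega x -> derivable (partials s g) x (delta_mx ord0 i)) /\
  (forall s x, (size s <= k)%N -> Omega x -> {for x, continuous (partials s g)}).

Lemma partials_rcons s i g : partials (rcons s i) g = partials s (partial i g).
Proof. by rewrite /partials foldr_rcons. Qed.

Lemma partials_cat s s' g : partials (s ++ s') g = partials s (partials s' g).
Proof. by rewrite /partials foldr_cat. Qed.

Lemma Ck_onW Omega k m g : (m <= k)%N -> Ck_on Omega k g -> Ck_on Omega m g.
Proof.
move=> mk [dg cg]; split=> [s i x sm Ox|s x sm Ox]; [apply: dg|apply: cg] => //.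
  exact: leq_trans mk.
exact: leq_trans mk.
Qed.

Lemma Ck_on_partials Omega k s g : Ck_on Omega (size s + k) g -> Ck_on Omega k (partials s g).
Proof.
move=> [dg cg]; split=> [s' i x sk Ox|s' x sk Ox]; rewrite -partials_cat; [apply: dg|apply: cg] => //.
  by rewrite size_cat addnC ltn_add2l.
by rewrite size_cat addnC leq_add2l.
Qed.

Lemma Ck_on_partial Omega k i g : Ck_on Omega k.+1 g -> Ck_on Omega k (partial i g).
Proof. exact: (@Ck_on_partials Omega k [:: i]). Qed.

Lemma Ck_on_continuous Omega k g x : Ck_on Omega k g -> Omega x -> {for x, continuous g}.
Proof. by move=> [_ /(_ [::])]; exact. Qed.

Lemma Ck_on_measurable Omega k g : open Omega -> Ck_on Omega k g -> measurable_fun Omega g.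
Proof.
move=> oO Cg; apply: measurable_fun_rV_continuous => // x; rewrite inE.
exact: Ck_on_continuous Cg.
Qed.

Lemma eq_partial Omega g g' i x : open Omega -> (forall y, Omega y -> g y = g' y) ->
  Omega x -> partial i g x = partial i g' x.
Proof.
move=> oO gg Ox; apply: near_eq_derive.
by apply: filterS (open_nbhs_nbhs (conj oO Ox)) => y /gg.
Qed.

Lemma is_derive_Ck Omega g x h : open Omega -> Ck_on Omega 1 g -> Omega x ->
  is_derive x h g (\sum_i h ord0 i * partial i g x).
Proof.
move=> oO [dg cg] Ox; apply: is_derive_coord => [|i]; last exact: (cg [:: i]).
by apply: filterS (open_nbhs_nbhs (conj oO Ox)) => y Oy i; exact: (dg [::]).
Qed.

(** Apply the mean value theorem in direction i to the difference in direction j, then in direction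
    j to the i-th derivative. Two steps of length r / 3 stay in the ball. *)
Lemma second_difference Omega g x i j r : open Omega -> Ck_on Omega 2 g ->
  nball x r `<=` Omega -> 0 < r ->
  let a := r / 3 in
  exists2 p, nball x r p &
    g (x + a *: delta_mx ord0 i + a *: delta_mx ord0 j) - g (x + a *: delta_mx ord0 i)
    - (g (x + a *: delta_mx ord0 j) - g x) = a ^+ 2 * partials [:: j; i] g p.
Proof.
move=> oO [dg cg] xO r0 a; have a0 : 0 < a by rewrite divr_gt0.
have near_x (s t : R) k m : `|s| <= a -> `|t| <= a -> nball x r (x + s *: delta_mx ord0 k + t *: delta_mx ord0 m).
  move=> sa ta; rewrite /nball/=.
  have -> : x + s *: delta_mx ord0 k + t *: delta_mx ord0 m - x = s *: delta_mx ord0 k + t *: delta_mx ord0 m :> E.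
    by apply/rowP => k'; rewrite !mxE; ring.
  apply: le_lt_trans (ler_normD _ _) _; rewrite !normrZ !norm_delta_mx !mulr1.
  by rewrite /a in sa ta; lra.
have near_x1 (s : R) k : `|s| <= a -> nball x r (x + s *: delta_mx ord0 k).
  by move=> sa; have := near_x s 0 k k sa; rewrite scale0r addr0 normr0; apply; exact: ltW.
pose psi (y : E) := g (y + a *: delta_mx ord0 j) - g y.
have aa : `|a| = a by rewrite gtr0_norm.
have dshift y : Omega (y + a *: delta_mx ord0 j) ->
    is_derive y (delta_mx ord0 i) (fun y => g (y + a *: delta_mx ord0 j))
      (partial i g (y + a *: delta_mx ord0 j)).
  move=> Oy; have dy := dg [::] i _ isT Oy.
  have E : (fun t => t^-1 *: (((fun y => g (y + a *: delta_mx ord0 j)) \o shift y) (t *: delta_mx ord0 i) - g (y + a *: delta_mx ord0 j))) =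
      (fun t => t^-1 *: ((g \o shift (y + a *: delta_mx ord0 j)) (t *: delta_mx ord0 i) - g (y + a *: delta_mx ord0 j))).
    by apply/funext => t /=; rewrite addrA.
  by apply: DeriveDef; rewrite /derivable /partial /derive E.
have dpsi (s : R) : `|s| <= `|a| -> is_derive (x + s *: delta_mx ord0 i) (delta_mx ord0 i) psi
    (partial i g (x + s *: delta_mx ord0 i + a *: delta_mx ord0 j) - partial i g (x + s *: delta_mx ord0 i)).
  rewrite aa => sa; apply: is_deriveB.
    by apply: dshift; apply/xO/near_x; rewrite ?aa.
  by apply/derivableP; apply: (dg [::]) => //; exact/xO/near_x1.
have [s] := @line_MVT _ _ psi x (delta_mx ord0 i) a (fun (s : R) sa => @ex_derive _ _ _ _ _ _ _ (dpsi s sa)).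
rewrite aa => sa; rewrite {1 2}/psi [x + _ + a *: delta_mx _ j]addrAC.
rewrite [X in _ = a * X -> _](@derive_val _ _ _ _ _ _ _ (dpsi s _)) ?aa// => ->.
have dt (t : R) : `|t| <= `|a| ->
    derivable (partial i g) (x + s *: delta_mx ord0 i + t *: delta_mx ord0 j) (delta_mx ord0 j).
  by rewrite aa => ta; apply: (dg [:: i]) => //; exact/xO/near_x.
have [t] := line_MVT dt.
rewrite aa => ta ->; exists (x + s *: delta_mx ord0 i + t *: delta_mx ord0 j); first exact: near_x.
by rewrite expr2 mulrA.
Qed.

Lemma dist_half (a b c eps : R) :
  `|a - c| < eps / 2 -> `|b - c| < eps / 2 -> `|a - b| <= eps.
Proof.
by rewrite !ltr_norml ler_norml => /andP[? ?] /andP[? ?]; apply/andP; split; lra.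
Qed.

(** The second difference is symmetric in i and j, so the two mixed derivatives coincide at some
    points p and q near x; continuity at x concludes. *)
Lemma schwarz Omega g x i j : open Omega -> Ck_on Omega 2 g -> Omega x ->
  partials [:: i; j] g x = partials [:: j; i] g x.
Proof.
move=> oO Cg Ox; have [dg cg] := Cg.
apply/eqP; rewrite -subr_eq0 -normr_le0; apply/ler_addgt0Pl => eps eps0; rewrite addr0.
have e2 : 0 < eps / 2 by rewrite divr_gt0.
have h0 : nbhs x Omega by exact: oO.
have /cvgrPdist_lt/(_ _ e2) h1 := cg [:: i; j] x isT Ox.
have /cvgrPdist_lt/(_ _ e2) h2 := cg [:: j; i] x isT Ox.
have [r r0 rP] := (nbhs_rVP x _).1 (filterI h0 (filterI h1 h2)).
have xO : nball x r `<=` Omega by move=> y /rP[].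
have {}rP y : nball x r y -> `|partials [:: i; j] g x - partials [:: i; j] g y| < eps / 2 /\
    `|partials [:: j; i] g x - partials [:: j; i] g y| < eps / 2 by move=> /rP[_].
have [p px pE] := second_difference i j oO Cg xO r0.
have [q qx qE] := second_difference j i oO Cg xO r0.
have r3 : (r / 3) ^+ 2 != 0 by rewrite expf_neq0// gt_eqF// divr_gt0.
have pq : partials [:: j; i] g p = partials [:: i; j] g q.
  apply: (mulfI r3); move: pE qE; rewrite [x + _ + _ *: delta_mx ord0 i]addrAC.
  move: (partials _ g p) (partials _ g q) (_ ^+ 2) => P Q k <- <-.
  by move: (g _) (g _) (g _) (g _) => *; ring.
have [_ hp] := rP _ px; have [hq _] := rP _ qx.
by rewrite pq in hp; exact: dist_half hq hp.
Qed.

Lemma partials_swap Omega g s i j x k : open Omega -> Ck_on Omega k g ->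
  ((size s).+2 <= k)%N -> Omega x ->
  partials (i :: j :: s) g x = partials (j :: i :: s) g x.
Proof.
move=> oO Cg sk Ox; apply: (schwarz _ _ oO (g := partials s g)) => //.
by apply: Ck_on_partials; apply: Ck_onW Cg; rewrite addn2.
Qed.

Lemma partials_rem Omega g s i x k : open Omega -> Ck_on Omega k g ->
  (size s <= k)%N -> i \in s -> Omega x ->
  partials s g x = partials (i :: rem i s) g x.
Proof.
move=> oO Cg; elim: s x => //= j s IH x sk; rewrite inE.
have [<-//|ij /= is_ Ox] := eqVneq j i.
transitivity (partials (j :: i :: rem i s) g x).
  by apply: (eq_partial _ oO _ Ox) => y Oy; apply: IH => //; exact: ltnW.
apply: (partials_swap _ _ oO Cg _ Ox); rewrite size_rem//.
by case: (s) is_ sk.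
Qed.

(** The first entry of s' is brought to the front of s by adjacent swaps, each an instance of
    Schwarz's theorem; then the tails are compared. *)
Lemma perm_partials Omega g s s' x k : open Omega -> Ck_on Omega k g ->
  (size s <= k)%N -> perm_eq s s' -> Omega x -> partials s g x = partials s' g x.
Proof.
move=> oO Cg; elim: s' s x => [|i s' IH] s x sk ss' Ox; first by rewrite (perm_nilP ss').
have is_ : i \in s by rewrite (perm_mem ss') inE eqxx.
rewrite (partials_rem oO Cg sk is_ Ox).
apply: (eq_partial _ oO _ Ox) => y Oy; apply: IH => //.
  by rewrite size_rem// (leq_trans (leq_pred _) sk).
by rewrite -(perm_cons i) -(permPl (perm_to_rem is_)).
Qed.

End classes_Ck.

(** * Finite differences along segments *)

Section differences.
Context {R : realType} {d : nat}.
Local Notation E := 'rV[R]_d.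
Implicit Types (x y h e v : E) (g : E -> R) (Omega : set E) (a b t : R).

Lemma finite_diff0 h g : finite_diff 0 h g = g.
Proof.
apply/funext => x; rewrite /finite_diff big_ord_recl big_ord0 addr0 /=.
by rewrite subnn expr0 bin0 !mul1r scale0r addr0.
Qed.

(** Pascal's rule for the alternating binomial sum. *)
Lemma finite_diffS r h g x :
  finite_diff r.+1 h g x = finite_diff r h g (x + h) - finite_diff r h g x.
Proof.
have E (j : nat) : x + j.+1%:R *: h = x + h + j%:R *: h :> E.
  by apply/rowP => i; rewrite !mxE -natr1; ring.
rewrite /finite_diff [LHS]big_ord_recl /=.
under eq_bigr => j _ do rewrite /bump /= add1n binS natrD subSS mulrDr mulrDl.
rewrite big_split /= addrA [LHS]addrC; congr (_ + _).
  by apply: eq_bigr => j _; rewrite E.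
rewrite -sumrN [RHS]big_ord_recl; congr (_ + _).
  by rewrite /= !subn0 !bin0 exprS; ring.
rewrite big_ord_recr /= bin_small// mulr0 mul0r addr0.
apply: eq_bigr => j _; rewrite /bump /= add1n.
have -> : (r - j = (r - j.+1).+1)%N by rewrite subnSK.
by rewrite exprS; ring.
Qed.

(** [diff_domain] with a real length [a], so that a starting point can be moved by a fraction of
    h. *)
Definition ddom Omega a h : set E := [set x | forall t, 0 <= t <= a -> Omega (x + t *: h)].

Lemma diff_domainE Omega (r : nat) h : diff_domain Omega r h = ddom Omega r%:R h.
Proof.
apply/seteqP; split => x /=.
  move=> [Ox sO] t /andP[t0 tr]; case: r => [|r] in sO tr *.
    by have /eqP -> : t == 0 by [rewrite eq_le tr]; rewrite scale0r addr0.
  apply: sO; exists (t / r.+1%:R) => /=.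
    by rewrite divr_ge0//= ler_pdivrMr// mul1r.
  by rewrite addrAC subrr add0r scalerA divfK.
move=> H; split; first by have := H 0; rewrite lexx ler0n scale0r addr0; exact.
move=> _ [t /= /andP[t0 t1] <-]; rewrite addrAC subrr add0r scalerA; apply: H.
by rewrite mulr_ge0//= ler_piMl.
Qed.

Lemma ddomW Omega a b h : a <= b -> ddom Omega b h `<=` ddom Omega a h.
Proof. by move=> ab x H t /andP[t0 ta]; apply: H; rewrite t0 (le_trans ta). Qed.

Lemma ddom_sub Omega a h : 0 <= a -> ddom Omega a h `<=` Omega.
Proof. by move=> a0 x /(_ 0); rewrite lexx a0 scale0r addr0; exact. Qed.

Lemma ddom_shift Omega a b h x t : ddom Omega (a + b) h x -> 0 <= t <= b ->
  ddom Omega a h (x + t *: h).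
Proof.
move=> H /andP[t0 tb] s /andP[s0 sa]; rewrite -addrA -scalerDl; apply: H.
by rewrite addr_ge0//= addrC lerD.
Qed.

Lemma ddom_shift1 Omega (r : nat) h x : ddom Omega r.+1%:R h x -> ddom Omega r%:R h (x + h).
Proof.
rewrite -natr1 => Dx; rewrite -[h in x + h]scale1r.
by apply: ddom_shift Dx _; rewrite ler01 lexx.
Qed.

Lemma ddom_nat Omega (r j : nat) h x : (j <= r)%N -> ddom Omega r%:R h x -> Omega (x + j%:R *: h).
Proof. by move=> jr; apply; rewrite ler0n ler_nat. Qed.

(** The tube lemma for the compact interval [0, a]. *)
Lemma open_ddom Omega a h : open Omega -> open (ddom Omega a h).
Proof.
move=> oO; rewrite openE => x Ox.
have /compact_near_coveringP cI := @segment_compact R 0 a.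
suff : \forall y \near x, `[0, a] `<=` (fun t => Omega (y + t *: h)).
  by apply: filterS => y H t t0a; apply: H; rewrite /= in_itv.
apply: (cI _ (nbhs x) (fun y t => Omega (y + t *: h)) _).
move=> t /=; rewrite in_itv/= => /Ox /oO /nbhs_rVP[r r0 rO].
have e0 : 0 < r / (2 * (`|h| + 1)) by rewrite divr_gt0// mulr_gt0// ltr_wpDl.
exists ([set s | `|s - t| < r / (2 * (`|h| + 1))], nball x (r / 2)).
  split => /=; last by apply/nbhs_rVP; exists (r / 2) => //; rewrite divr_gt0.
  by apply/nbhs_ballP; exists (r / (2 * (`|h| + 1))) => //= s; rewrite /ball/= distrC.
move=> -[s y] /= [st]; rewrite /nball/= => yx; apply: rO.
have -> : y + s *: h - (x + t *: h) = (y - x) + (s - t) *: h by apply/rowP => i; rewrite !mxE; ring.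
apply: le_lt_trans (ler_normD _ _) _; rewrite normrZ (splitr r); apply: ltr_leD => //.
rewrite ltr_pdivlMr ?mulr_gt0 ?ltr_wpDl// in st.
have := normr_ge0 h; have := normr_ge0 (s - t); move: st.
by move: `|s - t| `|h| => p q; clear; nra.
Qed.

Lemma measurable_ddom Omega a h : open Omega -> measurable (ddom Omega a h).
Proof. by move=> oO; apply: rV_open_measurable; exact: open_ddom. Qed.

Lemma is_derive_shift_rV g y v e (L : R) :
  is_derive (y + v) e g L -> is_derive y e (fun z => g (z + v)) L.
Proof.
move=> [dg <-].
have E : (fun t => t^-1 *: (((fun y => g (y + v)) \o shift y) (t *: e) - g (y + v))) =
    (fun t => t^-1 *: ((g \o shift (y + v)) (t *: e) - g (y + v))).
  by apply/funext => t /=; rewrite addrA.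
by apply: DeriveDef; rewrite /derivable /derive E.
Qed.

Lemma finite_diff_derive Omega g r h y : open Omega -> Ck_on Omega 1 g ->
  (forall j : nat, (j <= r)%N -> Omega (y + j%:R *: h)) ->
  is_derive y h (finite_diff r h g)
    (\sum_i h ord0 i * finite_diff r h (partial i g) y).
Proof.
move=> oO Cg; elim: r y => [|r IH] y Hy.
  rewrite finite_diff0; under eq_bigr do rewrite finite_diff0.
  by apply: is_derive_Ck oO Cg _; have := Hy 0%N isT; rewrite scale0r addr0.
rewrite (_ : finite_diff r.+1 h g = (fun z => finite_diff r h g (z + h)) - finite_diff r h g); last first.
  by apply/funext => z; rewrite finite_diffS.
under eq_bigr do rewrite finite_diffS mulrBr.
rewrite sumrB; apply: is_deriveB.
  apply: is_derive_shift_rV; apply: IH => j jr.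
  have := Hy j.+1 jr; congr (Omega _).
  by apply/rowP => i; rewrite !mxE -natr1; ring.
by apply: IH => j jr; apply: Hy; exact: leqW.
Qed.

Lemma finite_diff_continuous Omega g r h y : open Omega -> Ck_on Omega 0 g ->
  (forall j : nat, (j <= r)%N -> Omega (y + j%:R *: h)) ->
  {for y, continuous (finite_diff r h g)}.
Proof.
move=> oO Cg; elim: r y => [|r IH] y Hy.
  rewrite finite_diff0; apply: Ck_on_continuous Cg _.
  by have := Hy 0%N isT; rewrite scale0r addr0.
rewrite (_ : finite_diff r.+1 h g = (finite_diff r h g \o shift h) \- finite_diff r h g); last first.
  by apply/funext => z; rewrite finite_diffS.
apply: continuousB; last by apply: IH => j jr; apply: Hy; exact: leqW.
apply: continuous_comp; last first.
  apply: IH => j jr; have := Hy j.+1 jr; congr (Omega _).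
  by apply/rowP => i; rewrite !mxE -natr1; ring.
by apply: (@continuousD _ _ _ id (cst h)); [by move=> P|apply: cst_continuous].
Qed.

(** Unlike [line_MVT], this looks only in the direction of e, since only the segment from y to y + e
    is known to lie in the domain. *)
Lemma line_MVT01 g y e :
  (forall s : R, 0 <= s <= 1 -> derivable g (y + s *: e) e) ->
  exists2 s : R, 0 <= s <= 1 & g (y + e) - g y = 'D_e g (y + s *: e).
Proof.
move=> dg; have [||s] := @MVT R (fun t => g (y + t *: e)) (fun s => 'D_e g (y + s *: e)) 0 1 ltr01.
- move=> s; rewrite in_itv/= => /andP[s0 s1]; apply: is_derive_line; apply: dg.
  by rewrite !ltW.
- by apply: continuous_in_subspaceT => s; rewrite inE/= in_itv/= => s01; apply: line_continuous; exact: dg.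
rewrite in_itv/= scale1r scale0r addr0 subr0 mulr1 => /andP[s0 s1] gE.
by exists s; rewrite ?ltW.
Qed.

(** Each of k differences is traded for a derivative by the mean value theorem, at the price d |h|;
    one difference of derivatives of order k remains. [A] is the part of Omega, later a ball, that
    the segments must not leave. *)
Lemma finite_diff_bound Omega A h g k M : open Omega -> A `<=` Omega ->
  Ck_on Omega k g -> 0 <= M ->
  (forall s, size s = k -> forall x, ddom A 1 h x -> `|finite_diff 1 h (partials s g) x| <= M) ->
  forall x, ddom A k.+1%:R h x -> `|finite_diff k.+1 h g x| <= (d%:R * `|h|) ^+ k * M.
Proof.
move=> oO AO + M0; elim: k g => [|k IH] g Cg HM x Dx.
  by rewrite expr0 mul1r; apply: (HM [::]).
rewrite finite_diffS.
have dF (s : R) : 0 <= s <= 1 -> is_derive (x + s *: h) h (finite_diff k.+1 h g)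
    (\sum_i h ord0 i * finite_diff k.+1 h (partial i g) (x + s *: h)).
  move=> s01; apply: finite_diff_derive oO (Ck_onW _ Cg) _ => // j jk.
  apply/AO; apply: ddom_nat jk _; apply: ddom_shift s01; by rewrite natr1.
have [s s01 ->] := line_MVT01 (fun s s01 => @ex_derive _ _ _ _ _ _ _ (dF s s01)).
rewrite (@derive_val _ _ _ _ _ _ _ (dF s s01)).
apply: le_trans (ler_norm_sum _ _ _) _.
apply: (@le_trans _ _ (\sum_(i < d) `|h| * ((d%:R * `|h|) ^+ k * M))).
  apply: ler_sum => i _; rewrite normrM ler_pM//; first exact: coord_le_norm.
  apply: IH; first exact: Ck_on_partial.
    move=> s' sk y Dy; rewrite -partials_rcons; apply: HM => //.
    by rewrite size_rcons sk.
  by apply: ddom_shift s01; rewrite natr1.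
by rewrite sumr_const card_ord -[leLHS]mulr_natl exprS !mulrA.
Qed.

End differences.

(** * Integrals of powers *)

Section power_inequalities.
Context {R : realType}.
Implicit Types (a b p x y la : R).

(** Both terms are at most the maximum, which works for all p >= 0, also below 1. *)
Lemma powR_normD p x y : 0 <= p ->
  `|x + y| `^ p <= 2 `^ p * (`|x| `^ p + `|y| `^ p).
Proof.
move=> p0; set m := Num.max `|x| `|y|.
have m0 : 0 <= m by rewrite le_max normr_ge0.
apply: (@le_trans _ _ ((2 * m) `^ p)).
  apply: ge0_ler_powR; rewrite ?nnegrE ?mulr_ge0//.
  apply: le_trans (ler_normD _ _) _; rewrite mulr2n mulrDl mul1r.
  by apply: lerD; rewrite /m le_max lexx ?orbT.
rewrite powRM// ler_wpM2l ?powR_ge0// /m.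
by case: (leP `|x| `|y|) => _; rewrite ?lerDl ?lerDr powR_ge0.
Qed.

Lemma powR_norm_sum n p (f : 'I_n -> R) : 0 < p ->
  `|\sum_i f i| `^ p <= n%:R `^ p * \sum_i `|f i| `^ p.
Proof.
move=> p0; case: n f => [|n] f.
  by rewrite !big_ord0 normr0 powR0 ?gt_eqF// mulr0.
have [i _ imax] := @arg_maxP _ _ _ ord0 predT (fun i => `|f i|) isT.
apply: (@le_trans _ _ ((n.+1%:R * `|f i|) `^ p)).
  apply: ge0_ler_powR; rewrite ?nnegrE ?mulr_ge0 ?(ltW p0)//.
  apply: le_trans (ler_norm_sum _ _ _) _.
  apply: (@le_trans _ _ (\sum_(j < n.+1) `|f i|)); first by apply: ler_sum => j _; exact: imax.
  by rewrite sumr_const card_ord mulr_natl.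
rewrite powRM// ler_wpM2l ?powR_ge0// (bigD1 i)//= lerDl.
by apply: sumr_ge0 => j _; exact: powR_ge0.
Qed.

(* Choosing la optimally turns this into Hoelder's inequality, up to a factor 2. *)
Lemma powR_le_split a b la y : 0 <= a <= b -> 0 < la -> 0 <= y ->
  y `^ a <= la `^ a + la `^ (a - b) * y `^ b.
Proof.
move=> /andP[a0 ab] la0 y0; have [yla|lay] := leP y la.
  apply: ler_wpDr; first by rewrite mulr_ge0 ?powR_ge0.
  by apply: ge0_ler_powR; rewrite ?nnegrE ?(ltW la0).
apply: ler_wpDl; first exact: powR_ge0.
have yp : 0 < y by apply: lt_trans lay.
rewrite -{1}(subrK b a) (@powRD _ y); last by rewrite (gt_eqF yp) implybT.
rewrite ler_wpM2r ?powR_ge0// -(opprB b a) !powRN lef_pV2 ?posrE ?powR_gt0//.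
by apply: ge0_ler_powR; rewrite ?nnegrE ?subr_ge0// ltW.
Qed.

End power_inequalities.

Section integral_tools.
Context d (T : measurableType d) (R : realType) (mu : {measure set T -> \bar R}).
Local Open Scope ereal_scope.

(** The integral is a supremum over simple functions below the integrand, so no measurability is
    involved. In particular the modulus of smoothness need not be shown measurable in t. *)
Lemma ge0_le_integral_nomeas (D : set T) (f g : T -> \bar R) :
  (forall x, D x -> 0 <= f x) -> (forall x, D x -> f x <= g x) ->
  \int[mu]_(x in D) f x <= \int[mu]_(x in D) g x.
Proof.
move=> f0 fg; rewrite [leLHS]integral_mkcond [leRHS]integral_mkcond.
have f0' x : 0 <= (f \_ D) x by apply: erestrict_ge0.
have fg' x : (f \_ D) x <= (g \_ D) x.
  by rewrite /patch; case: ifPn => //; rewrite inE => /fg.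
rewrite !ge0_integralTE//; last by move=> x; apply: le_trans (fg' x).
apply: ereal_sup_le => _ [h /= hf <-]; exists h => // x.
exact: le_trans (fg' x).
Qed.

Lemma measurable_fun_normpow (D : set T) (f : T -> R) (p : R) :
  measurable_fun D f -> measurable_fun D (fun x => (`|f x| `^ p)%:E).
Proof.
move=> mf; apply/measurable_EFinP.
apply: (measurableT_comp (measurable_powR p)).
exact: measurableT_comp.
Qed.

(** The p-th power of the L_p norm; it remains subadditive up to a constant for p below 1. *)
Definition Jp (A : set T) (p : R) (f : T -> R) := \int[mu]_(x in A) (`|f x| `^ p)%:E.

Lemma Jp_ge0 A p f : 0 <= Jp A p f.
Proof. by apply: integral_ge0 => x _; rewrite lee_fin powR_ge0. Qed.

Lemma Jp_subset A B p f : measurable A -> measurable B -> measurable_fun B f ->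
  A `<=` B -> Jp A p f <= Jp B p f.
Proof.
move=> mA mB mf AB; by apply: ge0_subset_integral => //; exact: measurable_fun_normpow.
Qed.

Lemma Jp_add (A : set T) (p : R) (f g h : T -> R) : measurable A -> measurable_fun A f -> measurable_fun A g ->
  (0 <= p)%R -> (forall x, A x -> h x = f x + g x)%R ->
  Jp A p h <= (2 `^ p)%:E * (Jp A p f + Jp A p g).
Proof.
move=> mA mf mg p0 hE.
have mfp := measurable_fun_normpow p mf; have mgp := measurable_fun_normpow p mg.
rewrite /Jp -ge0_integralD//; [|by move=> x _; rewrite lee_fin powR_ge0..].
rewrite -ge0_integralZl_EFin ?powR_ge0//; last 2 first.
- by move=> x _; rewrite adde_ge0// lee_fin powR_ge0.
- exact: emeasurable_funD.
apply: ge0_le_integral_nomeas => x Ax; first by rewrite lee_fin powR_ge0.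
by rewrite hE// -EFinD -EFinM lee_fin powR_normD.
Qed.

(** Stands in for Hoelder's inequality: [la] is chosen at each use so that the two terms have the
    same order in |h|. *)
Lemma Jp_split (A : set T) (a b la : R) (f : T -> R) : measurable A -> measurable_fun A f ->
  (0 <= a <= b)%R -> (0 < la)%R ->
  Jp A a f <= (la `^ a)%:E * mu A + (la `^ (a - b))%:E * Jp A b f.
Proof.
move=> mA mf ab la0; have mfp := measurable_fun_normpow b mf.
rewrite -integral_cst// /Jp -ge0_integralZl_EFin ?powR_ge0//.
rewrite -ge0_integralD//.
- apply: ge0_le_integral_nomeas => x Ax; first by rewrite lee_fin powR_ge0.
  by rewrite -EFinM -EFinD lee_fin powR_le_split.
- by move=> x _; rewrite lee_fin powR_ge0.
- by move=> x _; rewrite mule_ge0// lee_fin powR_ge0.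
- exact: measurable_funeM.
Qed.

End integral_tools.

(** * Jensen's inequality on the unit interval, up to a constant *)

Section jensen.
Context {R : realType}.

(** The term a / 2 is absorbed on the left, which leaves (a / 2)^p <= J. *)
Lemma powR_le_of_split (a p : R) (J : \bar R) : 1 <= p -> 0 < a -> (0 <= J)%E ->
  (a%:E <= (a / 2)%:E + ((a / 2) `^ (1 - p))%:E * J)%E ->
  ((a `^ p)%:E <= (2 `^ p)%:E * J)%E.
Proof.
move=> p1 a0; have la0 : 0 < a / 2 by rewrite divr_gt0.
case: J => [P| |//]; last by move=> _ _; rewrite gt0_muley ?lte_fin ?powR_gt0// leey.
rewrite -!EFinM -EFinD !lee_fin => P0 H3.
have {H3} : a / 2 <= (a / 2) `^ (1 - p) * P by lra.
have -> : a `^ p = 2 `^ p * (a / 2) `^ p by rewrite -powRM ?(ltW la0)// mulrC divfK.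
move: (a / 2) la0 => b b0 H; rewrite ler_wpM2l ?powR_ge0//.
have bne : b != 0 by rewrite gt_eqF.
rewrite -(subrK 1 p) powRD ?bne ?implybT// powRr1 ?(ltW b0)//.
apply: le_trans (ler_wpM2l (powR_ge0 _ _) H) _.
rewrite mulrA -powRD ?bne ?implybT// (_ : p - 1 + (1 - p) = 0) ?powRr0 ?mul1r//; ring.
Qed.

Lemma lebesgue_measure01 : lebesgue_measure (`[0%R, 1%R]%classic : set R) = 1%E.
Proof. by rewrite lebesgue_measure_itv/= lte_fin ltr01 oppr0 adde0. Qed.

(** Split |w| with exponents 1 <= p at the threshold |I| / 2 and absorb; the loss is the factor
    2^p. *)
Lemma unit_interval_power (w : R -> R) (I p : R) : 1 <= p ->
  measurable_fun (`[0%R, 1%R] : set R) w ->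
  (\int[lebesgue_measure]_(t in `[0%R, 1%R]) (w t)%:E = I%:E)%E ->
  ((`|I| `^ p)%:E <= (2 `^ p)%:E * Jp lebesgue_measure `[0%R, 1%R] p w)%E.
Proof.
move=> p1 mw wI; have p0 : 0 < p by lra.
have [->|I0] := eqVneq I 0.
  by rewrite normr0 powR0 ?gt_eqF// mule_ge0 ?lee_fin ?powR_ge0//; exact: Jp_ge0.
have a0 : 0 < `|I| by rewrite normr_gt0.
have la0 : 0 < `|I| / 2 by rewrite divr_gt0.
have H1 : (`|I|%:E <= Jp lebesgue_measure `[0%R, 1%R] 1 w)%E.
  rewrite -abse_EFin -wI; apply: le_trans (le_abse_integral _ _ _) _ => //; first exact/measurable_EFinP.
  by rewrite /Jp le_eqVlt; apply/orP; left; apply/eqP; apply: eq_integral => t _; rewrite /= powRr1.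
have := @Jp_split _ _ _ lebesgue_measure `[0%R, 1%R]%classic 1 p _ w (measurable_itv _) mw _ la0.
rewrite ler01 p1 [X in (_ * X + _)%E](_ : _ = 1%E); last exact: lebesgue_measure01.
rewrite mule1 powRr1 ?(ltW la0)// => /(_ isT) H2.
exact: powR_le_of_split p1 a0 (Jp_ge0 _ _ _ _) (le_trans H1 H2).
Qed.

End jensen.

(** * Integrals of powers of finite differences *)

Section difference_norms.
Context {R : realType} {d : nat}.
Local Notation E := 'rV[R]_d.
Local Notation mu := (lebesgue_rV R d).
Implicit Types (x y h e v : E) (g : E -> R) (Omega : set E).

Lemma continuous_bigsum I (s : seq I) (f : I -> E -> R) y :
  (forall i, {for y, continuous (f i)}) ->
  {for y, continuous (fun z => \sum_(i <- s) f i z)}.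
Proof.
move=> cf; elim: s => [|i s IH].
  rewrite (_ : (fun z => _) = cst 0); first exact: cst_continuous.
  by apply/funext => z; rewrite big_nil.
rewrite (_ : (fun z => _) = f i \+ (fun z => \sum_(i <- s) f i z)); first exact: continuousD.
by apply/funext => z; rewrite big_cons.
Qed.

Lemma continuous_line (w : E -> R) x h (s : R) : {for x + s *: h, continuous w} ->
  {for s, continuous (fun t : R => w (x + t *: h))}.
Proof.
move=> cw; apply: continuous_comp; last exact: cw.
apply: (@continuousD _ _ _ (cst x) (fun t : R => t *: h)); first exact: cst_continuous.
exact: scalel_continuous.
Qed.

Lemma line_FTC (F w : E -> R) x h :
  (forall s : R, 0 <= s <= 1 -> is_derive (x + s *: h) h F (w (x + s *: h))) ->
  (forall s : R, 0 <= s <= 1 -> {for x + s *: h, continuous w}) ->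
  (\int[lebesgue_measure]_(t in `[0%R, 1%R]) (w (x + t *: h))%:E = (F (x + h) - F x)%:E)%E.
Proof.
move=> dF cw.
have dl (s : R) : 0 <= s <= 1 -> is_derive s 1 (fun t : R => F (x + t *: h)) (w (x + s *: h)).
  move=> s01; have dFs := dF s s01.
  have := is_derive_line (@ex_derive _ _ _ _ _ _ _ dFs).
  by rewrite (@derive_val _ _ _ _ _ _ _ dFs).
have cF (s : R) : 0 <= s <= 1 -> {for s, continuous (fun t : R => F (x + t *: h))}.
  by move=> /dl ds; apply/differentiable_continuous/derivable1_diffP.
rewrite (@continuous_FTC2 _ (fun t => w (x + t *: h)) (fun t => F (x + t *: h)) 0 1 ltr01).
- by rewrite scale1r scale0r addr0 EFinB.
- apply: continuous_in_subspaceT => s; rewrite inE/= in_itv/= => s01.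
  by apply: continuous_line; exact: cw.
- split.
  + by move=> s; rewrite in_itv/= => /andP[s0 s1]; apply: (@ex_derive _ _ _ _ _ _ _ (dl s _)); rewrite !ltW.
  + by apply: cvg_at_right_filter; apply: cF; rewrite lexx ler01.
  + by apply: cvg_at_left_filter; apply: cF; rewrite lexx ler01.
- move=> s; rewrite in_itv/= => /andP[s0 s1].
  by rewrite derive1E (@derive_val _ _ _ _ _ _ _ (dl s _))// !ltW.
Qed.

Lemma ge0_integral_shift_le (A B : set E) v (f : E -> \bar R) :
  measurable A -> measurable B -> measurable_fun B f -> (forall x, B x -> 0 <= f x)%E ->
  (forall x, A x -> B (x + v)) ->
  (\int[mu]_(x in A) f (x + v)%R <= \int[mu]_(x in B) f x)%E.
Proof.
move=> mA mB mf f0 AB; rewrite -(ge0_integral_shift v mB mf f0).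
have mB' : measurable (shift_rV v @^-1` B).
  by rewrite -[X in measurable X]setTI; exact: measurable_shift_rV.
apply: ge0_subset_integral => //.
  apply: (measurable_comp mB) mf _ => //; first by move=> _ [x Bx <-].
  by apply: measurable_funS (measurable_shift_rV v).
by move=> x /f0.
Qed.

Lemma measurable_finite_diff Omega g r h : open Omega -> Ck_on Omega 0 g ->
  measurable_fun (ddom Omega r%:R h) (finite_diff r h g).
Proof.
move=> oO Cg; apply: measurable_fun_rV_continuous; first exact: open_ddom.
move=> x; rewrite inE => Dx; apply: finite_diff_continuous oO Cg _ => j jr.
exact: ddom_nat jr Dx.
Qed.

Lemma Jp_diffS Omega g r h p : open Omega -> Ck_on Omega 0 g -> 0 <= p ->
  (Jp mu (ddom Omega r.+1%:R h) p (finite_diff r.+1 h g) <=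
   (2 `^ (p + 1))%:E * Jp mu (ddom Omega r%:R h) p (finite_diff r h g))%E.
Proof.
move=> oO Cg p0; set A := ddom _ r.+1%:R h; set B := ddom _ r%:R h.
have AB : A `<=` B by apply: ddomW; rewrite ler_nat.
have mA : measurable A by exact: measurable_ddom.
have mB : measurable B by exact: measurable_ddom.
have mf := measurable_finite_diff (r := r) (h := h) oO Cg.
have mAs : measurable_fun A (fun x => finite_diff r h g (x + h)).
  apply: (measurable_comp mB) mf _ => //.
    by move=> _ [x Ax <-]; exact: ddom_shift1.
  by apply: measurable_funS (measurable_shift_rV h).
have mAN : measurable_fun A (fun x => - finite_diff r h g x).
  by apply: measurable_funN; exact: measurable_funS mf.
have hE x : A x -> finite_diff r.+1 h g x = finite_diff r h g (x + h) + - finite_diff r h g x.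
  by rewrite finite_diffS.
apply: le_trans (Jp_add mu mA mAs mAN p0 hE) _.
rewrite powRD ?pnatr_eq0 ?implybT// powRr1// EFinM -muleA.
rewrite lee_wpmul2l ?lee_fin ?powR_ge0//.
rewrite EFinD ge0_muleDl ?lee_fin// mul1e.
apply: leeD.
  apply: (ge0_integral_shift_le mA mB (measurable_fun_normpow p mf)).
    by move=> x _; rewrite lee_fin powR_ge0.
  by move=> x Ax; exact: ddom_shift1.
rewrite /Jp; under eq_integral do rewrite normrN.
exact: Jp_subset.
Qed.

(** The last difference is the integral over [0, 1] of the derivative [w] along h. After Jensen's
    inequality, Tonelli and translation invariance in x remove the parameter t. *)
Lemma Jp_diff_derivatives Omega g k h p : open Omega -> Ck_on Omega 1 g -> 1 <= p ->
  (Jp mu (ddom Omega k.+1%:R h) p (finite_diff k.+1 h g) <=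
   (2 `^ p * (d%:R * `|h|) `^ p)%:E *
   \sum_(i < d) Jp mu (ddom Omega k%:R h) p (finite_diff k h (partial i g)))%E.
Proof.
move=> oO Cg p1; have p0 : 0 < p by lra.
set A := ddom _ k.+1%:R h; set B := ddom _ k%:R h.
have mA : measurable A by exact: measurable_ddom.
have mB : measurable B by exact: measurable_ddom.
pose w y := \sum_i h ord0 i * finite_diff k h (partial i g) y.
have C0 i : Ck_on Omega 0 (partial i g) by exact: Ck_on_partial.
have cw y : B y -> {for y, continuous w}.
  move=> By; apply: continuous_bigsum => i; apply: continuousM; first exact: cst_continuous.
  by apply: finite_diff_continuous oO (C0 i) _ => j jk; exact: ddom_nat jk By.
have mw : measurable_fun B w.
  by apply: measurable_fun_rV_continuous; [exact: open_ddom|move=> x; rewrite inE; exact: cw].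
(* Extended by 0 outside [B], the integrand can be translated and integrated over the whole
   space. *)
pose W y : \bar R := ((fun y => (`|w y| `^ p)%:E) \_ B) y.
have W0 y : (0 <= W y)%E by apply: erestrict_ge0 => ? _; rewrite lee_fin powR_ge0.
have mW : measurable_fun setT W.
  by apply/(measurable_restrictT _ mB); exact: measurable_fun_normpow.
have BAt x (t : R) : A x -> 0 <= t <= 1 -> B (x + t *: h).
  by move=> Ax t01; apply: ddom_shift t01; rewrite natr1.
have pointwise x : A x -> ((`|finite_diff k.+1 h g x| `^ p)%:E <=
    (2 `^ p)%:E * \int[lebesgue_measure]_(t in `[0%R, 1%R]) W (x + t *: h)%R)%E.
  move=> Ax; have wF := @line_FTC (finite_diff k h g) w x h _ _.
  have {}wF : (\int[lebesgue_measure]_(t in `[0%R, 1%R]) (w (x + t *: h))%:E = (finite_diff k.+1 h g x)%:E)%E.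
    rewrite finite_diffS; apply: wF => s s01; last exact/cw/BAt.
    apply: finite_diff_derive oO Cg _ => j jk.
    by apply: ddom_nat jk _; exact: BAt.
  have mwl : measurable_fun (`[0%R, 1%R] : set R) (fun t => w (x + t *: h)).
    apply: subspace_continuous_measurable_fun => //.
    apply: continuous_in_subspaceT => s; rewrite inE/= in_itv/= => s01.
    by apply: continuous_line; exact/cw/BAt.
  apply: (le_trans (unit_interval_power p1 mwl wF)).
  rewrite lee_wpmul2l ?lee_fin ?powR_ge0// /Jp.
  apply: ge0_le_integral_nomeas => t; first by rewrite lee_fin powR_ge0.
  rewrite /= in_itv/= => t01; rewrite /W patchE mem_set//; exact: BAt.
pose f (z : E * measurableTypeR R) := (W (z.1 + (z.2 : R) *: h)%R * (\1_(`[0%R, 1%R]%classic) (z.2 : R))%:E)%E.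
have mf : measurable_fun setT f.
  apply: emeasurable_funM.
    apply: (measurableT_comp mW); apply: measurable_fun_coordP => i.
    rewrite (_ : _ \o _ = (fun z => rV_coord i z.1 + (z.2 : R) * h ord0 i)); last first.
      by apply/funext => z; rewrite /rV_coord /= !mxE.
    apply: measurable_funD.
      by apply: measurableT_comp; [exact: measurable_coord|exact: measurable_fst].
    by apply: measurable_funM => //; exact: measurable_snd.
  apply/measurable_EFinP; 
  apply: (measurableT_comp (@measurable_indic _ (measurableTypeR R) R setT _ (measurable_itv _))).
  exact: measurable_snd.
have f0 z : (0 <= f z)%E by rewrite mule_ge0// lee_fin.
have step1 : (Jp mu A p (finite_diff k.+1 h g) <=
    (2 `^ p)%:E * \int[mu]_x \int[lebesgue_measure]_t f (x, t))%E.
  rewrite -ge0_integralZl_EFin ?powR_ge0//; last 2 first.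
  - by move=> x _; exact: integral_ge0.
  - exact: measurable_fun_fubini_tonelli_F.
  rewrite /Jp integral_mkcond; apply: ge0_le_integral_nomeas => x _.
    by apply: erestrict_ge0 => ? _; rewrite lee_fin powR_ge0.
  rewrite patchE; case: ifPn => [|_]; last first.
    by rewrite mule_ge0// ?lee_fin ?powR_ge0//; exact: integral_ge0.
  rewrite inE => /pointwise /le_trans; apply.
  rewrite lee_wpmul2l ?lee_fin ?powR_ge0// integral_mkcond.
  apply: ge0_le_integral_nomeas => t _; first by apply: erestrict_ge0.
  by rewrite /f/= patchE indicE; case: (t \in _); rewrite ?mule1 ?mule0.
have step2 : (\int[mu]_x \int[lebesgue_measure]_t f (x, t) <= \int[mu]_(y in B) (`|w y| `^ p)%:E)%E.
  rewrite fubini_tonelli//.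
  apply: (@le_trans _ _ (\int[lebesgue_measure]_(t in `[0%R, 1%R]) (cst (\int[mu]_y W y) t))%E).
    rewrite [leRHS]integral_mkcond; apply: ge0_le_integral_nomeas => t _; first exact: integral_ge0.
    rewrite /f/= patchE indicE; case: (t \in _); last by under eq_integral do rewrite mule0; rewrite integral0.
    under eq_integral do rewrite mule1.
    exact: ge0_integral_shift_le.
  rewrite integral_cst// [X in (_ * X)%E](_ : _ = 1%E) ?mule1; last exact: lebesgue_measure01.
  by rewrite [leRHS]integral_mkcond.
apply: (le_trans step1); rewrite EFinM -muleA.
rewrite lee_wpmul2l ?lee_fin ?powR_ge0//; apply: (le_trans step2).
have mBi i : measurable_fun B (fun x => (`|finite_diff k h (partial i g) x| `^ p)%:E).
  by apply: measurable_fun_normpow; exact: measurable_finite_diff.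
rewrite /Jp -ge0_integral_sum//.
rewrite -ge0_integralZl_EFin ?powR_ge0//; last 2 first.
- by move=> x _; apply: sume_ge0 => i _; rewrite lee_fin powR_ge0.
- exact: emeasurable_sum.
apply: ge0_le_integral_nomeas => x Bx; first by rewrite lee_fin powR_ge0.
rewrite sumEFin -EFinM lee_fin; apply: (le_trans (powR_norm_sum _ p0)).
rewrite powRM// -mulrA ler_wpM2l ?powR_ge0// mulr_sumr; apply: ler_sum => i _.
rewrite normrM powRM// ler_wpM2r ?powR_ge0//.
by apply: ge0_ler_powR; rewrite ?nnegrE ?(ltW p0)//; exact: coord_le_norm.
Qed.

End difference_norms.

(** * Differences of functions with finite Gagliardo seminorm *)

Section gagliardo_difference.
Context {R : realType} {d : nat}.
Local Notation E := 'rV[R]_d.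
Local Notation mu := (lebesgue_rV R d).
Implicit Types (x y h : E) (w : E -> R) (Omega : set E) (p beta : R).

Lemma measurable_enorm : measurable_fun [set: E] (@enorm R d).
Proof.
apply: (measurableT_comp (continuous_measurable_fun (@sqrt_continuous R))).
apply: measurable_sum => i; apply: measurable_funM; exact: (measurable_coord i).
Qed.

Definition gagliardo_kernel w p beta x y : R :=
  `|w x - w y| `^ p / enorm (x - y) `^ (d%:R + beta * p).

Lemma gagliardo_kernel_ge0 w p beta x y : 0 <= gagliardo_kernel w p beta x y.
Proof. by rewrite divr_ge0 ?powR_ge0. Qed.

Lemma measurable_gagliardo_kernel w p beta : measurable_fun setT w ->
  measurable_fun setT (fun z : E * E => (gagliardo_kernel w p beta z.1 z.2)%:E).
Proof.
move=> mw; apply/measurable_EFinP; apply: measurable_funM.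
  apply: (measurableT_comp (measurable_powR p)); apply: measurableT_comp => //.
  by apply: measurable_funB; apply: measurableT_comp.
under eq_fun do rewrite -powRN.
apply: (measurableT_comp (measurable_powR _)); apply: (measurableT_comp measurable_enorm).
apply: measurable_fun_coordP => i.
rewrite (_ : _ \o _ = (fun z => rV_coord i z.1 - rV_coord i z.2)); last first.
  by apply/funext => z; rewrite /rV_coord /= !mxE.
by apply: measurable_funB; apply: measurableT_comp; [exact: measurable_coord|exact: measurable_fst|exact: measurable_coord|exact: measurable_snd].
Qed.

Lemma enorm0 : enorm (0 : E) = 0.
Proof. by apply/eqP; rewrite eq_le (le_trans (enorm_le_norm _)) ?normr0 ?mulr0// sqrtr_ge0. Qed.

Lemma le_gagliardo_kernel w p beta x y (r : R) : 0 < p -> 0 < beta -> 0 <= r -> enorm (x - y) <= r ->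
  `|w x - w y| `^ p <= r `^ (d%:R + beta * p) * gagliardo_kernel w p beta x y.
Proof.
move=> p0 b0 r0 xyr; have [->|xy] := eqVneq x y.
  rewrite subrr normr0 powR0 ?gt_eqF// mulr_ge0 ?powR_ge0//; exact: gagliardo_kernel_ge0.
have e0 : 0 < enorm (x - y).
  by apply: lt_le_trans (norm_le_enorm _); rewrite normr_gt0 subr_eq0.
rewrite /gagliardo_kernel mulrCA ler_peMr ?powR_ge0// ler_pdivlMr ?powR_gt0// mul1r.
apply: ge0_ler_powR; rewrite ?nnegrE ?sqrtr_ge0//.
by rewrite addr_ge0// mulr_ge0 ?ltW.
Qed.

(** The kernel is at least |w(x) - w(y)|^p / (3 d |h|)^(d + beta p) on a corkscrew ball of measure
    (2 c |h|)^d, and likewise with x + h for x; the quotient of these powers leaves |h|^(beta p).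
    Measurability of w on the whole space makes the kernel jointly measurable. *)
Lemma gagliardo_difference_total Omega w p beta : (0 < d)%N ->
  bounded_set Omega -> lipschitz_domain Omega -> 0 < p -> 0 < beta ->
  measurable_fun setT w -> (gagliardo Omega p beta w < +oo)%E ->
  exists C h0 : R, [/\ 0 < C, 0 < h0 & forall h, `|h| <= h0 ->
    (Jp mu (ddom Omega 1 h) p (finite_diff 1 h w) <= (C * `|h| `^ (beta * p))%:E)%E].
Proof.
move=> d0 bO lO p0 b0 mw Goo; have [oO _ _] := lO.
have mO : measurable Omega by exact: rV_open_measurable.
have [c [rho [/andP[c0 c1] rho0 cork]]] := corkscrew bO lO.
pose q := d%:R + beta * p.
have q0 : 0 < q by rewrite ltr_wpDl// mulr_gt0.
pose K := gagliardo_kernel w p beta.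
pose Phi x := (\int[mu]_(y in Omega) (K x y)%:E)%E.
have K0 x y : (0 <= (K x y)%:E)%E by rewrite lee_fin; exact: gagliardo_kernel_ge0.
have mK := measurable_gagliardo_kernel p beta mw.
have mKx x : measurable_fun setT (fun y => (K x y)%:E).
  exact: (measurableT_comp mK (measurable_pair1 x)).
have mPhi : measurable_fun setT Phi.
  pose f (z : E * E) := ((K z.1 z.2)%:E * (\1_Omega z.2)%:E)%E.
  have mf : measurable_fun setT f.
    apply: emeasurable_funM => //; apply/measurable_EFinP.
    by apply: (measurableT_comp (@measurable_indic _ E R setT _ mO)); exact: measurable_snd.
  have f0 z : (0 <= f z)%E by rewrite mule_ge0// lee_fin.
  rewrite (_ : Phi = fun x => \int[mu]_y f (x, y))%E; first exact: measurable_fun_fubini_tonelli_F.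
  apply/funext => x; rewrite /Phi integral_mkcond; apply: eq_integral => y _.
  by rewrite /f/= patchE indicE; case: (y \in _); rewrite ?mule1 ?mule0.
have Phi0 x : (0 <= Phi x)%E by exact: integral_ge0.
pose G := gagliardo Omega p beta w.
have GE : G = (\int[mu]_(x in Omega) Phi x)%E by [].
have G0 : (0 <= G)%E by rewrite GE; exact: integral_ge0.
have Gfin : G \is a fin_num by rewrite ge0_fin_numE.
(* 2^p splits the difference at w(y), 3 d bounds the Euclidean distance from y to x and to x + h in
   units of |h|, and (2 c)^d comes from the measure of the corkscrew ball. *)
pose M := 2 `^ p * (3 * d%:R) `^ q / (2 * c) ^+ d.
have M0 : 0 < M.
  by rewrite divr_gt0 ?mulr_gt0 ?powR_gt0 ?exprn_gt0 ?mulr_gt0// ltr0n.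
have C0 : 0 < M * (2 * fine G) + 1.
  apply: ltr_wpDl => //; apply: mulr_ge0; first exact: ltW.
  by apply: mulr_ge0 => //; exact: fine_ge0.
exists (M * (2 * fine G) + 1), rho; split => //.
move=> h hrho; set D1 := ddom _ 1 h.
have mD1 : measurable D1 by exact: measurable_ddom.
have [->|hn0] := eqVneq h 0.
  rewrite normr0 /Jp; under eq_integral do rewrite finite_diffS finite_diff0 addr0 subrr normr0 powR0 ?gt_eqF//.
  by rewrite integral0 lee_fin mulr_ge0 ?powR_ge0// ltW.
have t0 : 0 < `|h| by rewrite normr_gt0.
set t := `|h| in hrho t0 *.
have pw x : D1 x -> ((`|finite_diff 1 h w x| `^ p)%:E <= (M * t `^ (beta * p))%:E * (Phi (x + h)%R + Phi x))%E.
  move=> Dx.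
  have Ox : Omega x by apply: ddom_sub Dx.
  have [y0 y0x y0O] := cork x t Ox (introT andP (conj t0 hrho)).
  set B := nball y0 (c * t) in y0O.
  have mB : measurable B by exact: measurable_norm_ball.
  have muB : mu B = ((2 * (c * t)) ^+ d)%:E by rewrite lebesgue_norm_ball// mulr_gt0.
  have ct : c * t <= t by rewrite ler_piMl// ltW.
  have yx y : B y -> enorm (x - y) <= d%:R * (3 * t) /\ enorm (x + h - y) <= d%:R * (3 * t).
    rewrite /B /nball/= => yB.
    have a1 : `|x - y| <= 2 * t.
      rewrite distrC -(subrKA y0); apply: le_trans (ler_normD _ _) _.
      by move: (`|y - y0|) (`|y0 - x|) yB y0x ct => ? ?; clear; lra.
    split; apply: le_trans (enorm_le_norm _) _; rewrite ler_wpM2l//.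
      by move: a1 t0; clear; lra.
    rewrite addrAC; apply: le_trans (ler_normD _ _) _.
    by rewrite -/t; move: a1 t0; clear; lra.
  pose K0' := 2 `^ p * (d%:R * (3 * t)) `^ q.
  have dt0 : 0 <= d%:R * (3 * t) by rewrite mulr_ge0// mulr_ge0// ltW.
  have H1 : ((`|finite_diff 1 h w x| `^ p)%:E * mu B <= K0'%:E * (Phi (x + h)%R + Phi x))%E.
    rewrite -integral_cst//.
    apply: (@le_trans _ _ (\int[mu]_(y in B) (K0'%:E * ((K (x + h)%R y)%:E + (K x y)%:E)))%E).
      apply: ge0_le_integral_nomeas => y By; first by rewrite lee_fin powR_ge0.
      rewrite -EFinD -EFinM lee_fin finite_diffS finite_diff0.
      rewrite -(subrKA (w y)); apply: le_trans (powR_normD _ _ (ltW p0)) _.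
      rewrite -mulrA ler_wpM2l ?powR_ge0// mulrDr [`|w y - _|]distrC.
      have [e1 e2] := yx y By.
      by apply: lerD; exact: le_gagliardo_kernel.
    rewrite ge0_integralZl_EFin//; last 3 first.
    - by move=> y _; rewrite adde_ge0.
    - by apply: emeasurable_funD; exact: measurable_funTS.
    - by rewrite mulr_ge0 ?powR_ge0.
    rewrite lee_wpmul2l//; first by rewrite lee_fin mulr_ge0 ?powR_ge0.
    rewrite ge0_integralD//; [|exact: measurable_funTS..].
    by apply: leeD; apply: ge0_subset_integral => //; exact: measurable_funTS.
  have V0 : 0 < (2 * (c * t)) ^+ d by rewrite exprn_gt0// mulr_gt0// mulr_gt0.
  rewrite (_ : M * t `^ (beta * p) = ((2 * (c * t)) ^+ d)^-1 * K0'); last first.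
    rewrite /M /K0' (_ : d%:R * (3 * t) = 3 * d%:R * t); last by ring.
    have tq : t `^ q = t ^+ d * t `^ (beta * p).
      by rewrite /q powRD ?(gt_eqF t0) ?implybT// powR_mulrn ?(ltW t0).
    rewrite (@powRM _ (3 * d%:R) t) ?mulr_ge0 ?(ltW t0)// tq [2 * (c * t)]mulrA (exprMn d (2 * c) t).
    have : t ^+ d != 0 by rewrite expf_neq0// gt_eqF.
    have : (2 * c) ^+ d != 0 by rewrite expf_neq0// mulf_neq0// gt_eqF.
    move: (t ^+ d) ((2 * c) ^+ d) (t `^ (beta * p)) (_ `^ q) (2 `^ p) => a b e1 e2 e3 b0' a0.
    by clear -a0 b0'; field; rewrite a0 b0'.
  rewrite EFinM -muleA; apply: le_trans (lee_wpmul2l _ H1); last by rewrite lee_fin invr_ge0 ltW.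
  by rewrite muB -!EFinM lee_fin mulrCA mulVf ?gt_eqF// mulr1.
apply: (@le_trans _ _ ((M * t `^ (beta * p))%:E * (G + G))%E); last first.
  rewrite -(fineK Gfin) -EFinD -EFinM lee_fin.
  have -> : M * t `^ (beta * p) * (fine G + fine G) = M * (2 * fine G) * t `^ (beta * p) by ring.
  by rewrite ler_wpM2r ?powR_ge0// lerDl.
have Mt0 : 0 <= M * t `^ (beta * p) by rewrite mulr_ge0 ?powR_ge0 ?ltW.
apply: (@le_trans _ _ (\int[mu]_(x in D1) ((M * t `^ (beta * p))%:E * (Phi (x + h)%R + Phi x)))%E).
  by apply: ge0_le_integral_nomeas => // x _; rewrite lee_fin powR_ge0.
have mPhih : measurable_fun setT (fun x => Phi (x + h)) by exact: (measurableT_comp mPhi (measurable_shift_rV h)).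
have mPhiD : measurable_fun D1 Phi := measurable_funTS mPhi.
have mPhihD : measurable_fun D1 (fun x => Phi (x + h)) := measurable_funTS mPhih.
rewrite ge0_integralZl_EFin//; last 2 first.
- by move=> x _; rewrite adde_ge0.
- exact: (emeasurable_funD mPhihD mPhiD).
rewrite lee_wpmul2l ?lee_fin//.
have := @ge0_integralD _ _ _ mu D1 mD1 (fun x => Phi (x + h)) Phi (fun x _ => Phi0 _) mPhihD (fun x _ => Phi0 x) mPhiD.
move=> ->; rewrite GE; apply: leeD.
  apply: (@ge0_integral_shift_le _ _ D1 Omega h Phi mD1 mO (measurable_funTS mPhi)) => // x Dx.
  by have := Dx 1; rewrite scale1r ler01 lexx; exact.
by apply: (@ge0_subset_integral _ _ _ mu D1 Omega mD1 mO Phi (measurable_funTS mPhi)) => //; exact: ddom_sub.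
Qed.

Lemma eq_gagliardo Omega p beta w w' : {in Omega, w =1 w'} ->
  gagliardo Omega p beta w = gagliardo Omega p beta w'.
Proof.
by move=> ww'; rewrite /gagliardo; apply: eq_integral => x xO; apply: eq_integral => y yO; rewrite !ww'.
Qed.

(** Transfers the estimate from a weak derivative [w], extended by 0, to a function [f] equal to it
    almost everywhere, here the classical derivative. *)
Lemma gagliardo_difference Omega f w p beta : (0 < d)%N ->
  bounded_set Omega -> lipschitz_domain Omega -> 0 < p -> 0 < beta ->
  measurable_fun Omega w -> (gagliardo Omega p beta w < +oo)%E ->
  measurable_fun Omega f -> ae_eq mu Omega f w ->
  exists C h0 : R, [/\ 0 < C, 0 < h0 & forall h, `|h| <= h0 ->
    (Jp mu (ddom Omega 1 h) p (finite_diff 1 h f) <= (C * `|h| `^ (beta * p))%:E)%E].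
Proof.
move=> d0 bO lO p0 b0 mw Goo mf fw; have [oO _ _] := lO.
have mO : measurable Omega by exact: rV_open_measurable.
have mw' : measurable_fun setT (w \_ Omega) by apply/(measurable_restrictT _ mO).
have ww' : {in Omega, w =1 w \_ Omega} by move=> x xO; rewrite patchE xO.
rewrite (eq_gagliardo _ _ ww') in Goo.
have [C [h0 [C0 h00 HC]]] := gagliardo_difference_total d0 bO lO p0 b0 mw' Goo.
exists C, h0; split; [exact: C0|exact: h00|] => h hh0; apply: le_trans (HC h hh0).
have [N [mN N0 subN]] := fw.
set D1 := ddom _ 1 h; have mD1 : measurable D1 by exact: measurable_ddom.
have mD g : measurable_fun Omega g -> measurable_fun D1 (fun x => (`|finite_diff 1 h g x| `^ p)%:E).
  move=> mg; apply: measurable_fun_normpow.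
  rewrite (_ : finite_diff 1 h g = (fun x => g (x + h)) \- g); last first.
    by apply/funext => x; rewrite finite_diffS finite_diff0.
  apply: measurable_funB; last by apply: measurable_funS mg => //; exact: ddom_sub.
  apply: (measurable_comp mO) mg _ => //.
    by move=> _ [x Dx <-]; have := Dx 1; rewrite scale1r ler01 lexx; exact.
  by apply: measurable_funS (measurable_shift_rV h).
(* The difference is evaluated at x and at x + h, so x must avoid both the null set and its
   translate by -h. *)
pose Nh := N `|` shift_rV h @^-1` N.
have mNh' : measurable (shift_rV h @^-1` N) by rewrite -[X in measurable X]setTI; exact: measurable_shift_rV.
have mNh : measurable Nh by exact: measurableU.
have Nh0 : mu Nh = 0%E.
  apply/eqP; rewrite eq_le measure_ge0 andbT; apply: le_trans (measureU2 _ mN mNh') _.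
  have Nh0 : mu (shift_rV h @^-1` N) = 0%E by rewrite -N0; exact: lebesgue_rV_shift.
  by rewrite le_eqVlt; apply/orP; left; apply/eqP; rewrite -[RHS]adde0; congr (_ + _)%E.
have drop g : measurable_fun Omega g -> Jp mu D1 p (finite_diff 1 h g) =
    (\int[mu]_(x in D1 `\` Nh) (`|finite_diff 1 h g x| `^ p)%:E)%E.
  move=> mg; apply: ge0_negligible_integral; [exact: mNh|exact: mD1|exact: mD| |exact: Nh0].
  by move=> x _; rewrite lee_fin powR_ge0.
rewrite (drop f mf) (drop _ (measurable_funTS mw')).
rewrite le_eqVlt; apply/orP; left; apply/eqP; apply: eq_integral => x; rewrite inE => -[Dx nN].
have Ox : Omega x by apply: ddom_sub Dx.
have Oxh : Omega (x + h) by have := Dx 1; rewrite scale1r ler01 lexx; exact.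
have ef y : Omega y -> ~ N y -> f y = w y.
  by move=> Oy nNy; apply: contrapT => fwy; apply: nNy; apply: subN => /(_ Oy).
rewrite !finite_diffS !finite_diff0 !patchE !mem_set// !ef//.
  by move=> Nx; apply: nN; left.
by move=> Nx; apply: nN; right.
Qed.

End gagliardo_difference.

(** * Smooth bump functions *)

Section flat_functions.
Context {R : realType} (q : {poly R}).
Implicit Types (s : {poly R}) (k : nat) (t : R).

(* s(t) q(t)^-k exp(-1/q(t)) where q > 0, and 0 elsewhere. *)
Definition flat k s t : R :=
  if 0 < q.[t] then s.[t] * (q.[t])^-1 ^+ k * expR (- (q.[t])^-1) else 0.

(** The numerator of the derivative of [flat k s] over q^(k + 2). Its three terms come from s, from
    q^-k and from exp(-1 / q), so the class of functions [flat] is closed under differentiation. *)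
Definition flat_num k s : {poly R} :=
  s^`() * q ^+ 2 - (k%:R)%:P * (s * q^`() * q) + s * q^`().

Lemma exprn_expRN_le (y : R) n : 0 <= y -> y ^+ n.+1 * expR (- y) <= n.+1%:R ^+ n.+1.
Proof.
move=> y0; rewrite expRN ler_pdivrMr ?expR_gt0//.
have -> : expR y = expR (n.+1%:R * (y / n.+1%:R)) by rewrite mulrC divfK.
rewrite expRM_natl -exprMn lerXn2r ?nnegrE ?mulr_ge0 ?expR_ge0//.
rewrite -ler_pdivrMl// mulrC; apply: le_trans (expR_ge1Dx _).
by rewrite lerDr.
Qed.

(** With y = 1 / q, y^(k + 2) exp(-y) is bounded, which leaves q^2. Hence the function vanishes to
    second order at the zeros of q. *)
Lemma flat_bound k s t : `|flat k s t| <= `|s.[t]| * k.+2%:R ^+ k.+2 * `|q.[t]| ^+ 2.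
Proof.
rewrite /flat; case: ifPn => [qt|_]; last first.
  by rewrite normr0; apply: mulr_ge0; [apply: mulr_ge0 => //; exact: exprn_ge0|exact: exprn_ge0].
have y0 : 0 < (q.[t])^-1 by rewrite invr_gt0.
rewrite -mulrA normrM -mulrA ler_wpM2l// (gtr0_norm qt).
rewrite ger0_norm; last by rewrite mulr_ge0 ?expR_ge0// exprn_ge0 ?ltW.
rewrite -ler_pdivrMr ?exprn_gt0// mulrAC -exprVn -exprD addn2.
exact: exprn_expRN_le (ltW y0).
Qed.

Lemma is_derive_quadratic_zero (f : R -> R) t C : f t = 0 -> 0 <= C ->
  (\forall u \near t, `|f u| <= C * `|u - t| ^+ 2) -> is_derive t 1 f 0.
Proof.
move=> ft0 C0 fC.
suff H : (fun h => h^-1 *: ((f \o shift t) (h *: 1) - f t)) @ 0^' --> (0 : R).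
  apply: DeriveDef; first by apply/cvg_ex; exists 0.
  exact: cvg_lim H.
apply/cvgr0Pnorm_lt => eps eps0.
have [r /= r0 rC] := fC.
have eC : 0 < eps / (C + 1) by rewrite divr_gt0// ltr_wpDl.
near=> h.
have h0 : h != 0 by near: h; exact: nbhs_dnbhs_neq.
have hr : `|h| < r by near: h; apply: dnbhs0_lt.
have he : `|h| < eps / (C + 1) by near: h; apply: dnbhs0_lt.
rewrite /= ft0 subr0 [h *: 1]mulr1 [_ *: _]/(h^-1 * _) normrM normfV.
have := rC (h + t); rewrite /ball_/= addrK (_ : t - (h + t) = - h); last by ring.
rewrite normrN => /(_ hr) fh.
have hp : 0 < `|h| by rewrite normr_gt0.
rewrite mulrC ltr_pdivrMr//; apply: le_lt_trans fh _.
rewrite expr2 mulrA ltr_pM2r//.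
move: he; rewrite ltr_pdivlMr ?ltr_wpDl// => he; apply: le_lt_trans he.
by rewrite mulrC ler_wpM2l// lerDl.
Unshelve. all: by end_near. Qed.

Lemma is_derive_flat k s t : is_derive t 1 (flat k s) (flat k.+2 (flat_num k s) t).
Proof.
have [qt|qt|qt] := ltrgtP 0 q.[t].
- have nq : \forall u \near t, 0 < q.[u].
    by have := @continuous_horner _ q t => /cvgr_gt/(_ _ qt).
  have D : is_derive t 1 ((horner s : R -> R) * ((fun u => (q.[u])^-1) ^+ k) * (expR \o (fun u => - (q.[u])^-1)))
      (flat k.+2 (flat_num k s) t).
    have q0 : q.[t] != 0 by rewrite gt_eqF.
    have dV : is_derive t 1 (fun u => (q.[u])^-1) (- (q.[t]) ^-2 *: q^`().[t]).
      have dq := is_derive_poly q t.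
      by apply: DeriveDef; [exact: derivableV|rewrite deriveV// derive_val].
    have dE : is_derive t 1 (expR \o (fun u => - (q.[u])^-1)) (expR (- (q.[t])^-1) * - (- q.[t] ^-2 *: q^`().[t])).
      exact: is_derive1_comp.
    have nE : (flat_num k s).[t] = s^`().[t] * q.[t] ^+ 2 -
        k%:R * (s.[t] * q^`().[t] * q.[t]) + s.[t] * q^`().[t].
      by rewrite /flat_num hornerD hornerD hornerN !hornerM hornerC expr2.
    apply: is_derive_eq; rewrite exprfctE /flat qt nE.
    have ZE : (q.[t])^-1 ^+ k.+2 = (q.[t])^-1 ^+ k * (q.[t])^-1 ^+ 2 by rewrite -exprD addn2.
    rewrite ZE -exprVn; clear ZE.
    rewrite -[LHS]/(s.[t] * (q.[t])^-1 ^+ k * (expR (- (q.[t])^-1) * - (- (q.[t])^-1 ^+ 2 * q^`().[t])) +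
      expR (- (q.[t])^-1) * (s.[t] * (k%:R * (q.[t])^-1 ^+ k.-1 * (- (q.[t])^-1 ^+ 2 * q^`().[t])) +
      (q.[t])^-1 ^+ k * s^`().[t])).
    move: (s^`().[t]) (s.[t]) (q^`().[t]) (q.[t]) q0 (expR _) => s' s0 q' a a0 e.
    clear -a0; case: k => [|k]; rewrite /= ?exprS; first by rewrite !expr0; field.
    by move: (a^-1 ^+ k) => y; field.
  apply: (near_eq_is_derive _ D).
  by apply: filterS nq => u qu; rewrite /flat qu exprfctE.
- have nq : \forall u \near t, q.[u] < 0.
    by have := @continuous_horner _ q t => /cvgr_lt/(_ _ qt).
  have -> : flat k.+2 (flat_num k s) t = 0 by rewrite /flat ltNge (ltW qt).
  apply: (near_eq_is_derive _ (is_derive_cst 0 t 1)).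
  by apply: filterS nq => u qu; rewrite /flat ltNge (ltW qu).
(* At a zero t of q, the factor 'X - t of q turns the bound by q^2 into a bound by (u - t)^2, so the
   derivative there is 0. *)
- have f0 j s' : flat j s' t = 0 by rewrite /flat -qt ltxx.
  rewrite f0.
  have /factor_theorem[r qE] : root q t by rewrite /root -qt.
  pose C := (`|s.[t]| + 1) * k.+2%:R ^+ k.+2 * (`|r.[t]| + 1) ^+ 2.
  apply: (@is_derive_quadratic_zero _ t C) => //.
    apply: mulr_ge0; last by apply: exprn_ge0; exact: addr_ge0.
    by apply: mulr_ge0; [exact: addr_ge0|exact: exprn_ge0].
  have ns (p : {poly R}) : \forall u \near t, `|p.[u]| < `|p.[t]| + 1.
    have := @continuous_horner _ p t => /(@cvg_norm _ _ _ _ _ _)/cvgr_lt; apply.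
    by rewrite ltrDl.
  near=> u; apply: le_trans (flat_bound _ _ _) _.
  have -> : `|q.[u]| ^+ 2 = `|r.[u]| ^+ 2 * `|u - t| ^+ 2.
    by rewrite qE hornerM hornerXsubC normrM exprMn.
  rewrite mulrA; apply: ler_wpM2r; first exact: exprn_ge0.
  rewrite /C; apply: ler_pM; [|exact: exprn_ge0| |].
  - by apply: mulr_ge0 => //; exact: exprn_ge0.
  - by apply: ler_wpM2r; [exact: exprn_ge0|apply: ltW; near: u; exact: ns].
  - by apply: lerXn2r; rewrite ?nnegrE ?addr_ge0// ltW//; near: u; exact: ns.
Unshelve. all: by end_near. Qed.

End flat_functions.

Section bump.
Context {R : realType} {d : nat}.
Local Notation E := 'rV[R]_d.
Implicit Types (x y a b : E).

Definition prod_flat (q : 'I_d -> {poly R}) (k : 'I_d -> nat) (s : 'I_d -> {poly R}) x : R :=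
  \prod_i flat (q i) (k i) (s i) (x ord0 i).

Lemma is_derive_prod_flat q k s i x :
  is_derive x (delta_mx ord0 i) (prod_flat q k s)
    (prod_flat q (fun j => if j == i then (k j).+2 else k j)
       (fun j => if j == i then flat_num (q j) (k j) (s j) else s j) x).
Proof.
pose P := \prod_(j | j != i) flat (q j) (k j) (s j) (x ord0 j).
pose phi := flat (q i) (k i) (s i).
have dphi := is_derive_flat (q i) (k i) (s i) (x ord0 i).
set L := prod_flat _ _ _ _.
have -> : L = flat (q i) (k i).+2 (flat_num (q i) (k i) (s i)) (x ord0 i) * P.
  rewrite /L /prod_flat (bigD1 i)//= eqxx; congr (_ * _).
  by apply: eq_bigr => j /negbTE ->.
have E t : prod_flat q k s (t *: delta_mx ord0 i + x) = phi (t + x ord0 i) * P.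
  rewrite /prod_flat (bigD1 i)//= !mxE !eqxx mulr1; congr (_ * _).
  by apply: eq_bigr => j /negbTE ji; rewrite !mxE ji andbF mulr0 add0r.
have E0 : prod_flat q k s x = phi (x ord0 i) * P by rewrite /prod_flat (bigD1 i).
suff H : (fun t => t^-1 *: ((prod_flat q k s \o shift x) (t *: delta_mx ord0 i) - prod_flat q k s x)) @ 0^' -->
    flat (q i) (k i).+2 (flat_num (q i) (k i) (s i)) (x ord0 i) * P.
  apply: DeriveDef; last exact: cvg_lim H.
  by apply/cvg_ex; exists (flat (q i) (k i).+2 (flat_num (q i) (k i) (s i)) (x ord0 i) * P).
have -> : (fun t => t^-1 *: ((prod_flat q k s \o shift x) (t *: delta_mx ord0 i) - prod_flat q k s x)) =
    (fun t => (t^-1 *: ((phi \o shift (x ord0 i)) (t *: 1) - phi (x ord0 i))) * P).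
  apply/funext => t.
  rewrite -[LHS]/(t^-1 * (prod_flat q k s (t *: delta_mx ord0 i + x) - prod_flat q k s x)).
  rewrite -[RHS]/(t^-1 * (phi (t * 1 + x ord0 i) - phi (x ord0 i)) * P).
  by rewrite E E0 mulr1; ring.
apply: cvgMl.
by have := @ex_derive _ _ _ _ _ _ _ dphi; rewrite -(@derive_val _ _ _ _ _ _ _ dphi).
Qed.

Lemma continuous_bigprod I (r : seq I) (f : I -> E -> R) y :
  (forall i, {for y, continuous (f i)}) ->
  {for y, continuous (fun z => \prod_(i <- r) f i z)}.
Proof.
move=> cf; elim: r => [|i r IH].
  rewrite (_ : (fun z => _) = cst 1); first exact: cst_continuous.
  by apply/funext => z; rewrite big_nil.
rewrite (_ : (fun z => _) = f i \* (fun z => \prod_(i <- r) f i z)); first exact: continuousM.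
by apply/funext => z; rewrite big_cons.
Qed.

Lemma continuous_prod_flat q k s : continuous (prod_flat q k s).
Proof.
move=> y; apply: continuous_bigprod => i.
apply: (@continuous_comp _ _ _ (fun z : E => z ord0 i) (flat (q i) (k i) (s i))).
  exact: coord_continuous.
have dphi := is_derive_flat (q i) (k i) (s i) (y ord0 i).
exact/differentiable_continuous/derivable1_diffP.
Qed.

(** A partial derivative changes only k i and s i, so all derivatives stay in this family of
    continuous functions. *)
Lemma smooth_prod_flat q k s : smooth (prod_flat q k s).
Proof.
move=> r; have [k' [s' ->]] : exists k' s', partials r (prod_flat q k s) = prod_flat q k' s'.
  elim: r => [|i r [k' [s' IH]]]; first by exists k, s.
  rewrite /= IH; exists (fun j => if j == i then (k' j).+2 else k' j),
       (fun j => if j == i then flat_num (q j) (k' j) (s' j) else s' j).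
  apply/funext => x; exact: (@derive_val _ _ _ _ _ _ _ (is_derive_prod_flat q k' s' i x)).
split; first exact: continuous_prod_flat.
by move=> i x; exact: (@ex_derive _ _ _ _ _ _ _ (is_derive_prod_flat q k' s' i x)).
Qed.

Definition box a b : set E := [set x | forall i, a ord0 i < x ord0 i < b ord0 i].

(** The quadratic polynomial is positive exactly between the endpoints when a < b. The factor n + 1
    drives exp(-1 / q) to 1 there, so the bumps tend to the indicator of the box. *)
Definition bump a b (n : nat) : E -> R :=
  prod_flat (fun i => n.+1%:R%:P * (('X - (a ord0 i)%:P) * ((b ord0 i)%:P - 'X)))
    (fun=> 0%N) (fun=> 1).

Let bumpE a b n x : bump a b n x =
  \prod_i (if 0 < n.+1%:R * ((x ord0 i - a ord0 i) * (b ord0 i - x ord0 i))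
            then expR (- (n.+1%:R * ((x ord0 i - a ord0 i) * (b ord0 i - x ord0 i)))^-1) else 0).
Proof.
by apply: eq_bigr => i _; rewrite /flat !hornerM hornerC hornerXsubC !hornerE.
Qed.

Lemma bump_itv a b n x : 0 <= bump a b n x <= 1.
Proof.
rewrite bumpE; apply: (big_ind (fun v => 0 <= v <= 1)).
- by rewrite ler01 lexx.
- by move=> u v /andP[u0 u1] /andP[v0 v1]; rewrite mulr_ge0//= mulr_ile1.
move=> i _; case: ifP => [qi|_]; last by rewrite lexx ler01.
by rewrite expR_ge0/= -[leRHS]expR0 ler_expR oppr_le0 invr_ge0 ltW.
Qed.

(** If b < a in some coordinate, the quadratic is positive between b and a while the box is empty;
    hence the condition on a and b. *)
Lemma bump_neq0 a b n x : (forall i, a ord0 i < b ord0 i) -> bump a b n x != 0 -> box a b x.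
Proof.
move=> ab; rewrite bumpE => /prodf_neq0 H i; have := H i isT.
case: ifP => [|_]; last by rewrite eqxx.
rewrite pmulr_rgt0// => + _; move: (ab i) => {ab H}.
move: (a ord0 i) (b ord0 i) (x ord0 i) => {}a {}b {}x; clear => ab axb.
by apply/andP; split; nra.
Qed.

Lemma cvg_bigprod1 I (r : seq I) (f : I -> nat -> R) :
  (forall i, f i n @[n --> \oo] --> (1 : R)) ->
  (\prod_(i <- r) f i n) @[n --> \oo] --> (1 : R).
Proof.
move=> cf; elim: r => [|i r IH].
  by under eq_fun do rewrite big_nil; exact: cvg_cst.
under eq_fun do rewrite big_cons.
by have := cvgM (cf i) IH; rewrite mulr1; exact.
Qed.

Lemma bump_cvg a b x : box a b x -> bump a b n x @[n --> \oo] --> (1 : R).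
Proof.
move=> xab; under eq_fun do rewrite bumpE.
apply: cvg_bigprod1 => i; have /andP[ax xb] := xab i.
set c := (x ord0 i - _) * _.
have c0 : 0 < c by rewrite mulr_gt0// subr_gt0.
under eq_fun do rewrite mulr_gt0// invfM.
have H : (- (n.+1%:R^-1 / c)) @[n --> \oo] --> (0 : R).
  rewrite -[X in _ --> X]oppr0; apply: cvgN; rewrite -[X in _ --> X](mul0r c^-1).
  by apply: cvgMl; exact: cvg_harmonic.
by have := cvg_comp _ _ H (@continuous_expR R 0); rewrite expR0; exact.
Qed.

End bump.

(** * Weak and classical derivatives *)

Section compact_support.
Context {R : realType} {d : nat}.
Local Notation E := 'rV[R]_d.
Local Notation mu := (lebesgue_rV R d).
Implicit Types (x y h : E) (F g v : E -> R) (Omega : set E).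

Definition compactly_supported F : Prop :=
  continuous F /\ exists2 M : R, 0 < M & forall x, M < `|x| -> F x = 0.

Lemma closed_norm_ball x (r : R) : closed [set y : E | `|y - x| <= r].
Proof.
rewrite -openC; move=> y /negP; rewrite -ltNge => ry.
apply/nbhs_rVP; exists (`|y - x| - r); first by rewrite subr_gt0.
move=> z zy /=; apply/negP; rewrite -ltNge.
have := ler_distD z y x; rewrite (distrC y z).
by move: zy; move: (`|y - x|) (`|z - y|) (`|z - x|) => a b c; clear; lra.
Qed.

Lemma compact_norm_ball x (r : R) : compact [set y : E | `|y - x| <= r].
Proof.
apply: bounded_closed_compact; last exact: closed_norm_ball.
exists (`|x| + r); split; first exact: num_real.
move=> M xrM y /= yx; rewrite -(subrK x y); apply: le_trans (ler_normD _ _) _.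
by move: yx xrM; move: (`|x|) (`|y - x|) => a b; clear; lra.
Qed.

Lemma compact_bounded_fun (K : set E) F : compact K ->
  (forall x, K x -> {for x, continuous F}) -> exists2 B : R, 0 <= B & forall x, K x -> `|F x| <= B.
Proof.
move=> cK cF; have : compact (F @` K).
  by apply: continuous_compact => //; apply: continuous_in_subspaceT => x; rewrite inE; exact: cF.
move=> /compact_bounded/pinfty_ex_gt0[B B0 FB]; exists B; first exact: ltW.
by move=> x Kx; apply: FB; exists x.
Qed.

Lemma compactly_supported_bounded F : compactly_supported F ->
  exists2 B : R, 0 <= B & forall x, `|F x| <= B.
Proof.
move=> [cF [M M0 FM]].
have [B B0 FB] := compact_bounded_fun (@compact_norm_ball 0 M) (fun x _ => cF x).
exists B => // x; have [xM|Mx] := leP `|x| M; first by apply: FB; rewrite /= subr0.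
by rewrite FM// normr0.
Qed.

Lemma continuous_measurable_rV F : continuous F -> measurable_fun setT F.
Proof. by move=> cF; apply: measurable_fun_rV_continuous => [|x _]; [exact: openT|exact: cF]. Qed.

Lemma bounded_support_integrable F (M B : R) : measurable_fun setT F -> 0 < M ->
  (forall x, M < `|x| -> F x = 0) -> (forall x, `|F x| <= B) ->
  mu.-integrable setT (EFin \o F).
Proof.
move=> mF M0 FM FB.
have M1 : 0 < M + 1 by rewrite addr_gt0.
have mb := measurable_norm_ball (0 : E) (M + 1).
have -> : EFin \o F = (EFin \o F) \_ (nball (0 : E) (M + 1)).
  apply/funext => x; rewrite patchE; case: ifPn => //; rewrite notin_setE /nball/= subr0 => /negP.
  by rewrite -leNgt => Mx; rewrite /= FM// (lt_le_trans _ Mx)// ltrDl.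
apply/(integrable_mkcond _ mb).1; apply: measurable_bounded_integrable => //.
- by apply: (@le_lt_trans _ _ ((2 * (M + 1)) ^+ d)%:E); [rewrite -(lebesgue_norm_ball (0 : E) M1)|exact: ltry].
- exact: measurable_funTS.
- by exists B; split; [exact: num_real|move=> b Bb x _; apply: le_trans (ltW Bb)].
Qed.

Lemma compactly_supported_integrable F : compactly_supported F -> mu.-integrable setT (EFin \o F).
Proof.
move=> cF; have [B _ FB] := compactly_supported_bounded cF; case: cF => cF [M M0 FM].
exact: bounded_support_integrable (continuous_measurable_rV cF) M0 FM FB.
Qed.

Lemma integral_shift_EFin F h : mu.-integrable setT (EFin \o F) ->
  (\int[mu]_x (F (x + h))%:E = \int[mu]_x (F x)%:E)%E.
Proof.
move=> iF; have mF := measurable_int _ iF.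
rewrite integralE [RHS]integralE; congr (_ - _)%E.
  have := @ge0_integral_shift _ _ h setT ((EFin \o F)^\+)%E measurableT (measurable_funepos mF) (fun x _ => funepos_ge0 _ x).
  by rewrite preimage_setT => H; apply: etrans H; apply: eq_integral => x _; rewrite !funeposE.
have := @ge0_integral_shift _ _ h setT ((EFin \o F)^\-)%E measurableT (measurable_funeneg mF) (fun x _ => funeneg_ge0 _ x).
by rewrite preimage_setT => H; apply: etrans H; apply: eq_integral => x _; rewrite !funenegE.
Qed.

(** The difference quotients have integral 0 by translation invariance, and dominated convergence
    carries this to the limit. *)
Lemma integral_partial_eq0 F i : compactly_supported F ->
  (forall x, derivable F x (delta_mx ord0 i)) -> continuous (partial i F) ->
  (\int[mu]_x (partial i F x)%:E = 0)%E.
Proof.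
move=> cF dF cdF; have [cF' [M M0 FM]] := cF.
have iF := compactly_supported_integrable cF.
set e := delta_mx ord0 i in dF *; have e1 : `|e| = 1 := norm_delta_mx i.
have dFM x : M < `|x| -> partial i F x = 0.
  move=> Mx; rewrite /partial.
  rewrite (@near_eq_derive _ _ _ F (cst 0)) ?derive_cst//.
  apply/nbhs_rVP; exists (`|x| - M); first by rewrite subr_gt0.
  move=> y yx; rewrite FM//; have := ler_distD y x 0; rewrite !subr0 distrC.
  by move: yx; move: (`|y - x|) (`|x|) (`|y|) => p q r; clear; lra.
have csdF : compactly_supported (partial i F) by split => //; exists M.
have [B B0 dFB] := compactly_supported_bounded csdF.
have M2 : 0 < M + 2 by rewrite addr_gt0.
pose t n : R := n.+1%:R^-1.
have t0 n : 0 < t n by rewrite invr_gt0.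
have t1 n : t n <= 1 by rewrite invf_le1// ler1n.
pose f_ n x : \bar R := (n.+1%:R * (F (x + t n *: e) - F x))%:E.
have mFs n : measurable_fun setT (fun x => F (x + t n *: e)).
  exact: (measurableT_comp (continuous_measurable_rV cF') (measurable_shift_rV _)).
have mf_ n : measurable_fun setT (f_ n).
  apply/measurable_EFinP; apply: measurable_funM; first exact: measurable_cst.
  by apply: measurable_funB; [exact: mFs|exact: continuous_measurable_rV].
have mdF : measurable_fun setT (fun x => (partial i F x)%:E).
  by apply/measurable_EFinP; exact: continuous_measurable_rV.
(* By the mean value theorem the quotients are values of the derivative within distance 1; they are
   bounded by [B] and vanish for |x| >= M + 2. *)
pose g x : \bar R := (B * \1_(nball (0 : E) (M + 2)) x)%:E.
have ig : mu.-integrable setT g.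
  apply: (@bounded_support_integrable _ (M + 2) B) => //.
  - by apply: measurable_funM; [exact: measurable_cst|apply: measurable_indic; exact: measurable_norm_ball].
  - move=> x Mx; rewrite indicE memNset ?mulr0//.
    by rewrite /nball/= subr0; apply/negP; rewrite -leNgt ltW.
  - move=> x; rewrite indicE; case: (_ \in _); rewrite ?mulr1 ?mulr0 ?normr0// ger0_norm//.
have fg n x : (`|f_ n x| <= g x)%E.
  rewrite /f_ /g /= lee_fin indicE.
  have [s st ->] := @line_MVT _ _ F x e (t n) (fun s _ => dF _).
  rewrite mulrA /t mulfV// mul1r.
  case: (boolP (x \in _)) => [_|]; first by rewrite mulr1; exact: dFB.
  rewrite notin_setE /nball/= subr0 => /negP; rewrite -leNgt => Mx.
  rewrite mulr0 (_ : 'D_e F (x + s *: e) = 0) ?normr0//; apply: dFM.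
  have := ler_distD (x + s *: e) x 0; rewrite !subr0.
  rewrite opprD addrA subrr add0r normrN normrZ e1 mulr1.
  have : `|s| <= 1 by apply: (le_trans st); rewrite gtr0_norm.
  by move: Mx; move: (`|s|) (`|x|) (`|x + s *: e|) => p q r; clear; lra.
have ff x : f_ ^~ x @ \oo --> (partial i F x)%:E.
  apply/fine_cvgP; split; first by apply: nearW.
  have := dF x; rewrite /derivable => /cvg_ex[L HL].
  have -> : partial i F x = L by exact: cvg_lim HL.
  apply/cvgrPdist_lt => eps eps0; move/cvgrPdist_lt : HL => /(_ _ eps0) [r /= r0 Hr].
  have /cvgrPdist_lt/(_ _ r0) hr := @cvg_harmonic R.
  near=> n.
  have tr : t n < r.
    have : `|0 - t n| < r by near: n; exact: hr.
    by rewrite sub0r normrN gtr0_norm.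
  have := Hr (t n); rewrite /ball_/= sub0r normrN gtr0_norm// => /(_ tr).
  have tn0 : t n != 0 by rewrite gt_eqF.
  move=> /(_ tn0); rewrite [t n *: e + x]addrC /f_ /=.
  by rewrite [(t n)^-1 *: _]/((t n)^-1 * _) /t invrK.
have [_ _ lim] := @dominated_convergence _ _ _ mu setT measurableT f_ _ g mf_ mdF
  (aeW _ (fun x _ => ff x)) ig (aeW _ (fun x n _ => fg n x)).
have I0 n : (\int[mu]_x f_ n x = 0)%E.
  rewrite /f_; under eq_integral do rewrite EFinM.
  have iFs : mu.-integrable setT (EFin \o (fun x => F (x + t n *: e))).
    have [B' _ FB] := compactly_supported_bounded cF.
    apply: (@bounded_support_integrable _ (M + 1) B' (mFs n)).
    - by rewrite addr_gt0.
    - move=> x Mx; apply: FM.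
      have := ler_distD (x + t n *: e) x 0; rewrite !subr0.
      rewrite opprD addrA subrr add0r normrN normrZ e1 mulr1 gtr0_norm//.
      by move: Mx (t1 n); move: (t n) (`|x|) (`|x + t n *: e|) => p q r; clear; lra.
    - by move=> x; exact: FB.
  rewrite integralZl//; first last.
    have := integrableB measurableT iFs iF; apply: eq_integrable => // x _.
  under eq_integral do rewrite EFinB.
  rewrite integralB_EFin// integral_shift_EFin// subee ?mule0//.
  exact: integrable_fin_num iF.
have E0 : (fun n => \int[mu]_x f_ n x)%E = cst 0%E by apply/funext.
move: lim; rewrite E0 => lim; exact: (cvg_unique _ lim (@cvg_cst _ _ _ _ _)).
Unshelve. all: by end_near. Qed.

End compact_support.

(** * Test functions, integration by parts and the fundamental lemma *)

Section weak_derivatives.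
Context {R : realType} {d : nat}.
Local Notation E := 'rV[R]_d.
Local Notation mu := (lebesgue_rV R d).
Implicit Types (x y h a b : E) (F g v f w : E -> R) (Omega : set E) (s : seq 'I_d).

Lemma support_near0 v x : ~ closure [set y | v y != 0] x ->
  \forall y \near x, v y = 0.
Proof.
move=> nx; have : open_nbhs x (~` closure [set y | v y != 0]).
  by split => //; exact/closed_openC/closed_closure.
move=> /open_nbhs_nbhs; apply: filterS => y ny; apply: contrapT => /eqP vy.
by apply: ny; exact: subset_closure.
Qed.

Lemma near0_partial i v x : (\forall y \near x, v y = 0) -> partial i v x = 0.
Proof.
move=> vx; rewrite /partial (@near_eq_derive _ _ _ v (cst 0)) ?derive_cst//.
Qed.

Lemma test_function_partial Omega i v : test_function Omega v -> test_function Omega (partial i v).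
Proof.
move=> tv; have [sv cv vO] := tv.
have sub : closure [set x | partial i v x != 0] `<=` closure [set x | v x != 0].
  rewrite [X in _ `<=` X](closure_id _).1; last exact: closed_closure.
  apply: closure_subset => x /= /eqP px; apply: contrapT => /support_near0 /near0_partial.
  by move=> /(_ i); exact: px.
split.
- by move=> s; rewrite -partials_rcons; exact: sv.
- by apply: subclosed_compact cv sub; exact: closed_closure.
- exact: subset_trans vO.
Qed.

Lemma test_function_partials Omega s v : test_function Omega v -> test_function Omega (partials s v).
Proof. by move=> tv; elim: s => //= i s; exact: test_function_partial. Qed.

Lemma test_function_bounded_support Omega v : test_function Omega v ->
  exists2 M : R, 0 < M & forall x, M < `|x| -> v x = 0.
Proof.
move=> [_ /compact_bounded/pinfty_ex_gt0[M M0 HM] _]; exists M => // x Mx.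
apply/eqP; apply/negPn/negP => vx; move: Mx; rewrite ltNge => /negP; apply.
by apply: HM; exact: subset_closure.
Qed.

Lemma test_function_out Omega v x : test_function Omega v -> ~ Omega x -> v x = 0.
Proof.
move=> [_ _ vO] nx; apply/eqP; apply/negPn/negP => vx; apply: nx; apply: vO.
exact: subset_closure.
Qed.

(** Continuity of g on Omega is enough, because v vanishes near every point outside Omega. *)
Lemma test_function_mul Omega g v : open Omega -> (forall x, Omega x -> {for x, continuous g}) ->
  test_function Omega v -> compactly_supported (fun x => g x * v x).
Proof.
move=> oO cg tv; have [sv cv vO] := tv; split; last first.
  have [M M0 vM] := test_function_bounded_support tv.
  by exists M => // x /vM ->; rewrite mulr0.
move=> x; have [Ox|nOx] := pselect (Omega x).
  by apply: (@continuousM _ _ g v x); [exact: cg|exact: (sv [::]).1].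
have nx : ~ closure [set y | v y != 0] x by move=> /vO.
have v0 := support_near0 nx.
rewrite /prop_for /continuous_at (nbhs_singleton v0) mulr0.
have : {for x, continuous (cst (0 : R) : E -> R)} by exact: cst_continuous.
move=> c0; apply: (cvg_trans _ c0); apply: (near_eq_cvg (F := nbhs x)).
by apply: filterS v0 => y ->; rewrite mulr0.
Qed.

Lemma partial_mul_test Omega i g v x : open Omega -> Ck_on Omega 1 g -> test_function Omega v ->
  is_derive x (delta_mx ord0 i) (fun x => g x * v x) (partial i g x * v x + g x * partial i v x).
Proof.
move=> oO [dg cg] tv; have [sv cv vO] := tv.
have [Ox|nOx] := pselect (Omega x).
  have Dg : is_derive x (delta_mx ord0 i) g (partial i g x).
    by apply/derivableP; exact: (dg [::]).
  have Dv : is_derive x (delta_mx ord0 i) v (partial i v x).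
    by apply/derivableP; exact: (sv [::]).2.
  by apply: is_derive_eq; rewrite addrC [v x *: _]mulrC.
have nx : ~ closure [set y | v y != 0] x by move=> /vO.
have v0 := support_near0 nx.
rewrite (near0_partial i v0) (nbhs_singleton v0) !mulr0 addr0.
apply: (@near_eq_is_derive _ _ _ (cst (0 : R)) _ _ _ _ _ (is_derive_cst (0 : R) x (delta_mx ord0 i))).
by apply: filterS v0 => y ->; rewrite mulr0.
Qed.

Lemma integral_by_parts Omega i g v : open Omega -> Ck_on Omega 1 g -> test_function Omega v ->
  (\int[mu]_x (g x * partial i v x)%:E = - \int[mu]_x (partial i g x * v x)%:E)%E.
Proof.
move=> oO Cg tv.
have cg x : Omega x -> {for x, continuous g} by move=> Ox; exact: Ck_on_continuous Cg Ox.
have cdg x : Omega x -> {for x, continuous (partial i g)}.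
  by move=> Ox; exact: (Ck_on_continuous (Ck_on_partial i Cg) Ox).
have D x := partial_mul_test i x oO Cg tv.
have cF1 := test_function_mul oO cdg tv.
have cF2 := test_function_mul oO cg (test_function_partial i tv).
have dE : partial i (fun x => g x * v x) = fun x => partial i g x * v x + g x * partial i v x.
  by apply/funext => x; exact: derive_val.
have := @integral_partial_eq0 _ _ (fun x => g x * v x) i (test_function_mul oO cg tv).
have dF x : derivable (fun x => g x * v x) x (delta_mx ord0 i) by case: (D x).
rewrite dE => /(_ dF (fun x => continuousD (cF1.1 x) (cF2.1 x))).
under eq_integral do rewrite EFinD.
rewrite integralD_EFin//; [|exact: compactly_supported_integrable..].
have key (a b : \bar R) : a \is a fin_num -> b \is a fin_num -> (a + b = 0 -> b = - a)%E.
  case: a b => [a| |] [b| |]// _ _ /eqP; rewrite -EFinD eqe => /eqP ab; congr EFin.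
  by apply/eqP; rewrite -addr_eq0 addrC ab.
by apply: key; apply: integrable_fin_num => //; exact: compactly_supported_integrable.
Qed.

Lemma integral_support (A B : set E) (F : E -> \bar R) : A `<=` B ->
  (forall x, B x -> ~ A x -> F x = 0%E) -> (\int[mu]_(x in B) F x = \int[mu]_(x in A) F x)%E.
Proof.
move=> AB F0; rewrite integral_mkcond [RHS]integral_mkcond; apply: eq_integral => x _.
rewrite !patchE; case: ifPn => [/set_mem Bx|/negP nBx]; case: ifPn => [/set_mem Ax|/negP nAx] //.
  by apply: F0 => // /mem_set.
by exfalso; apply: nBx; apply/mem_set/AB.
Qed.

Lemma integral_test Omega g v : test_function Omega v ->
  (\int[mu]_(x in Omega) (g x * v x)%:E = \int[mu]_x (g x * v x)%:E)%E.
Proof.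
move=> tv; apply/esym; apply: integral_support => // x _ nx.
by rewrite (test_function_out tv nx) mulr0.
Qed.

(** Derivatives move to g one at a time, outermost first, which reverses their order; symmetry of
    derivatives later undoes this. *)
Lemma integral_partials_by_parts Omega s g v : open Omega -> Ck_on Omega (size s) g ->
  test_function Omega v ->
  (\int[mu]_x (g x * partials s v x)%:E =
   ((-1) ^+ size s)%:E * \int[mu]_x (partials (rev s) g x * v x)%:E)%E.
Proof.
move=> oO + tv; elim: s g => [g _|i s IH g Cg]; first by rewrite expr0 mul1e.
rewrite /= (integral_by_parts i oO (Ck_onW _ Cg)) ?IH//; last exact: test_function_partials.
  by rewrite rev_cons partials_rcons exprS mulN1r EFinN mulNe.
exact: Ck_on_partial.
Qed.

Definition boxes : set (set E) := [set A | exists a b, A = box a b].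

Lemma setI_closed_boxes : setI_closed boxes.
Proof.
move=> _ _ [a [b ->]] [a' [b' ->]].
exists (\row_i Num.max (a ord0 i) (a' ord0 i)), (\row_i Num.min (b ord0 i) (b' ord0 i)).
apply/seteqP; split=> [x [xab xab'] i|x xab].
  by rewrite !mxE gt_max lt_min; have /andP[-> ->] := xab i; have /andP[-> ->] := xab' i.
by split=> i; have := xab i; rewrite !mxE gt_max lt_min => /andP[/andP[? ?] /andP[? ?]]; apply/andP.
Qed.

Lemma measurable_box a b : measurable (box a b).
Proof.
rewrite (_ : box a b = [set x | forall i, x ord0 i \in `]a ord0 i, b ord0 i[]).
  exact: measurable_rV_box.
by apply/seteqP; split=> x /= xab i; have := xab i; rewrite in_itv.
Qed.

(** The half-spaces x_i > t generate the Borel sets and are countable unions of boxes. *)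
Lemma measurable_sub_boxes (A : set E) : measurable A -> <<s boxes >> A.
Proof.
move: A; apply: smallest_sub; first exact: smallest_sigma_algebra.
rewrite -bigcup_seq/=; apply: bigcup_sub => i _ A [B mB <-].
rewrite setTI.
suff : measurable_fun setT (@rV_coord R d i : g_sigma_algebraType boxes -> R).
  by move=> /(_ measurableT _ mB); rewrite setTI.
apply: (measurability _ (RGenOInfty.measurableE R)) => _ [_ [t ->] <-]; rewrite setTI.
rewrite (_ : _ @^-1` _ = \bigcup_n box (\row_j if j == i then t else - n%:R)
                                        (\row_j if j == i then t + n%:R else n%:R)).
  by apply: sigma_algebra_bigcup => n; apply: sub_sigma_algebra; do 2 eexists.
apply/seteqP; split=> [x /=|x [n _ /(_ i)]]; last first.
  by rewrite !mxE eqxx /= in_itv/= andbT => /andP[].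
rewrite in_itv/= andbT => tx.
have [n nx] : exists n : nat, `|x| + `|t| < n%:R.
  by exists (Num.bound (`|x| + `|t|)); apply: le_lt_trans (archi_boundP _); rewrite ?addr_ge0.
exists n => // j; rewrite !mxE; have := coord_le_norm x j; rewrite ler_norml => /andP[xj1 xj2].
have := ler_norm t; have := ler_norm (- t); rewrite normrN.
case: eqP => [ji|_]; last first.
  move: xj1 xj2 nx (normr_ge0 t); move: (`|x|) (`|t|) (x ord0 j) (n%:R) => p q r s; clear.
  by move=> *; apply/andP; split; lra.
rewrite ji in xj1 xj2 *; move: tx; rewrite /rV_coord.
move: xj1 xj2 nx (normr_ge0 t); move: (`|x|) (`|t|) (x ord0 i) (n%:R) => p q r s; clear.
by move=> *; apply/andP; split; lra.
Qed.

(** The sets with vanishing integral over their part in D form a Dynkin system. It contains the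
    boxes, which generate the Borel sets, and an integrable function with vanishing integrals on all
    Borel subsets of D is 0 almost everywhere. *)
Lemma integral_boxes_eq0 (D : set E) w : boxes D -> mu.-integrable D (EFin \o w) ->
  (forall A, boxes A -> A `<=` D -> (\int[mu]_(x in A) (w x)%:E = 0)%E) ->
  ae_eq mu D (EFin \o w) (cst 0%E).
Proof.
move=> bD iw wA.
have mbox A : boxes A -> measurable A by move=> [a [b ->]]; exact: measurable_box.
have mD := mbox _ bD.
pose L := [set A : set E | measurable A /\ (\int[mu]_(x in D `&` A) (w x)%:E = 0)%E].
have dL : dynkin L.
  split.
  - by split => //; rewrite setIT; exact: wA.
  - move=> A [mA A0]; split; first exact: measurableC.
    have := wA _ bD (@subset_refl _ _).
    rewrite -{1}(setUIDK D A) integral_setU_EFin//.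
    + by rewrite A0 add0e setDE.
    + exact: measurableI.
    + exact: measurableD.
    + by rewrite setUIDK; apply/measurable_EFinP; exact: measurable_int iw.
    + by rewrite disj_set2E; apply/eqP; rewrite setDE setIACA setICr setI0.
  - move=> F tF LF; split; first by apply: bigcup_measurable => k _; case: (LF k).
    rewrite setI_bigcupr integral_bigcup.
    + by apply: eseries0 => k _ _; case: (LF k).
    + exact: trivIset_setIl.
    + by move=> k; apply: measurableI => //; case: (LF k).
    + apply: integrableS iw => //; last by move=> x [k _ []].
      by apply: bigcup_measurable => k _; apply: measurableI => //; case: (LF k).
apply: integral_ae_eq => //.
move=> A AD mA; rewrite integral0.
have : <<s boxes >> A by exact: measurable_sub_boxes.
rewrite -setI_closed_g_dynkin_g_sigma_algebra; last exact: setI_closed_boxes.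
move=> /(_ L) []; last by rewrite setIidr.
split => //; move=> B bB; split; first exact: mbox.
by apply: wA; [exact: setI_closed_boxes|exact: subIsetl].
Qed.

Lemma nball_boxes x (r : R) : 0 < r -> boxes (nball x r).
Proof.
move=> r0; exists (\row_i (x ord0 i - r)), (\row_i (x ord0 i + r)).
by rewrite norm_box//; apply/seteqP; split=> y /= xy i; have := xy i; rewrite in_itv !mxE.
Qed.

Lemma test_function_bump Omega (K : set E) a b n : (forall i, a ord0 i < b ord0 i) ->
  compact K -> K `<=` Omega -> box a b `<=` K -> test_function Omega (bump a b n).
Proof.
move=> ab cK KO abK.
have sub : closure [set x | bump a b n x != 0] `<=` K.
  rewrite [X in _ `<=` X](closure_id _).1; last exact: compact_closed.
  by apply: closure_subset => x /= /(bump_neq0 ab) /abK.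
split; first exact: smooth_prod_flat.
  by apply: subclosed_compact cK sub; exact: closed_closure.
exact: subset_trans sub KO.
Qed.

Lemma bump_integral_cvg (A : set E) a b w : A = box a b -> mu.-integrable A (EFin \o w) ->
  (\int[mu]_(x in A) (w x * bump a b n x)%:E @[n --> \oo] --> \int[mu]_(x in A) (w x)%:E)%E.
Proof.
move=> Aab iw; have mA : measurable A by rewrite Aab; exact: measurable_box.
have mw := measurable_int _ iw.
have mb n : measurable_fun A (bump a b n).
  by apply: measurable_funTS; apply: continuous_measurable_rV; exact: continuous_prod_flat.
have mwb n : measurable_fun A (fun x => (w x * bump a b n x)%:E).
  by apply/measurable_EFinP; apply: measurable_funM => //; exact/measurable_EFinP.
have wb1 : {ae mu, forall x, A x -> (fun n => (w x * bump a b n x)%:E) @ \oo --> (EFin \o w) x}.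
  apply: aeW => x Ax; apply: cvg_EFin; first exact: nearW.
  rewrite -[X in _ --> X]mulr1; apply: cvgM; first exact: cvg_cst.
  by apply: bump_cvg; rewrite -Aab.
have wb2 : {ae mu, forall x n, A x -> (`|(w x * bump a b n x)%:E| <= (abse \o (EFin \o w)) x)%E}.
  apply: aeW => x n Ax; rewrite /= lee_fin normrM ler_piMr//.
  by have /andP[? ?] := bump_itv a b n x; rewrite ger0_norm.
by have [_ _ ] := @dominated_convergence _ _ _ mu A mA _ _ _ mwb mw wb1 (integrable_abse iw) wb2.
Qed.

(** The closed ball is a compact subset of Omega, so f and w are integrable on it and bumps
    supported in it are test functions. Letting the bumps tend to indicators gives equal integrals
    over all boxes in the ball. *)
Lemma fundamental_lemma_ball Omega w f x (r : R) : 0 < r ->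
  [set y | `|y - x| <= r] `<=` Omega ->
  locally_integrable_on Omega w -> locally_integrable_on Omega f ->
  (forall v, test_function Omega v ->
    \int[mu]_(x in Omega) (w x * v x)%:E = \int[mu]_(x in Omega) (f x * v x)%:E)%E ->
  ae_eq mu (nball x r) (EFin \o f) (EFin \o w).
Proof.
move=> r0 KO [_ iw] [_ if_] wf.
have cK := @compact_norm_ball R d x r.
have bK : nball x r `<=` [set y | `|y - x| <= r] by move=> y /= /ltW.
have mb := measurable_norm_ball x r.
have mK : measurable [set y : E | `|y - x| <= r].
  by rewrite -[X in measurable X]setCK; apply: measurableC; apply: rV_open_measurable; apply: closed_openC; exact: closed_norm_ball.
have iwb : mu.-integrable (nball x r) (EFin \o w) by apply: integrableS (iw _ cK KO).
have ifb : mu.-integrable (nball x r) (EFin \o f) by apply: integrableS (if_ _ cK KO).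
have : ae_eq mu (nball x r) (EFin \o (fun y => f y - w y)) (cst 0%E).
  apply: integral_boxes_eq0; first exact: nball_boxes.
    exact: (integrableB mb ifb iwb).
  move=> A [a [b Aab]] AD.
  have [ab|/existsNP[i /negP ba]] := pselect (forall i, a ord0 i < b ord0 i); last first.
    rewrite (_ : A = set0) ?integral_set0// Aab; apply/seteqP; split=> // y /(_ i) /andP[ay yb].
    by case/negP: ba; exact: lt_trans yb.
  have mA : measurable A by rewrite Aab; exact: measurable_box.
  have iwA : mu.-integrable A (EFin \o w) by apply: integrableS iwb.
  have ifA : mu.-integrable A (EFin \o f) by apply: integrableS ifb.
  have AO := subset_trans AD (subset_trans bK KO).
  under eq_integral do rewrite EFinB.
  rewrite integralB_EFin//.
  suff -> : (\int[mu]_(x in A) (EFin \o f) x = \int[mu]_(x in A) (EFin \o w) x)%E.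
    by rewrite subee//; exact: integrable_fin_num.
  apply: (cvg_unique _ (bump_integral_cvg Aab ifA)) => //.
  rewrite (_ : (fun n => _) = fun n => (\int[mu]_(x in A) (w x * bump a b n x)%:E)%E).
    exact: bump_integral_cvg.
  apply/funext => n.
  have tb : test_function Omega (bump a b n).
    by apply: (test_function_bump n ab cK KO); rewrite -Aab; exact: subset_trans bK.
  have z (h : E -> R) y : Omega y -> ~ A y -> ((h y * bump a b n y)%:E = 0)%E.
    move=> _ nA; rewrite (_ : bump a b n y = 0) ?mulr0//; apply: contra_notP nA => /eqP.
    by move=> /(bump_neq0 ab); rewrite Aab.
  by rewrite -(integral_support AO (z f)) -(integral_support AO (z w)) wf.
apply: filterS => y /[apply] /= [[/eqP]]; rewrite subr_eq0 => /eqP ->.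
by [].
Qed.

(** Countably many rational balls whose closures lie in Omega cover it, and the exceptional sets in
    them have a negligible union. *)
Lemma fundamental_lemma Omega w f : open Omega ->
  locally_integrable_on Omega w -> locally_integrable_on Omega f ->
  (forall v, test_function Omega v ->
    \int[mu]_(x in Omega) (w x * v x)%:E = \int[mu]_(x in Omega) (f x * v x)%:E)%E ->
  ae_eq mu Omega (EFin \o f) (EFin \o w).
Proof.
move=> oO lw lf wf.
pose K (q : 'rV[rat]_d * nat) := [set y : E | `|y - map_mx ratr q.1| <= q.2.+1%:R^-1].
pose N q := [set x | nball (map_mx ratr q.1) q.2.+1%:R^-1 x /\ f x <> w x].
have Nq q : K q `<=` Omega -> mu.-negligible (N q).
  move=> KO; have q0 : 0 < (q.2.+1%:R^-1 : R) by rewrite invr_gt0.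
  have := fundamental_lemma_ball q0 KO lw lf wf.
  by apply: negligibleS => x [qx fw] /(_ qx) [].
pose F n := if unpickle n is Some q then if `[< K q `<=` Omega >] then N q else set0 else set0.
have : mu.-negligible (\bigcup_n F n).
  apply: negligible_bigcup => n; rewrite /F; case: (unpickle n) => [q|]; last exact: negligible_set0.
  by case: asboolP => [/Nq//|_]; exact: negligible_set0.
apply: negligibleS => x /not_implyP [Ox fw].
have [q qx KO] := open_rat_ball oO Ox.
exists (pickle q) => //; rewrite /F pickleK; case: asboolP => // _; split=> //.
by move=> fwx; apply: fw; rewrite /= fwx.
Qed.

Lemma Ck_on_locally_integrable Omega k g : open Omega -> Ck_on Omega k g -> locally_integrable_on Omega g.
Proof.
move=> oO Cg; split; first exact: Ck_on_measurable Cg.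
move=> K cK KO.
have mK : measurable K by rewrite -[K]setCK; apply: measurableC; apply: rV_open_measurable; apply: closed_openC; exact: compact_closed.
have [B B0 gB] := compact_bounded_fun cK (fun x Kx => Ck_on_continuous Cg (KO _ Kx)).
apply: measurable_bounded_integrable => //.
- have [M M0 KM] := bounded_set_norm_lt (compact_bounded cK).
  by apply: le_lt_trans (measure_bounded mK M0 KM) _; exact: ltry.
- by apply: measurable_funS (Ck_on_measurable oO Cg) => //; exact: rV_open_measurable.
- by exists B; split; [exact: num_real|move=> b Bb x Kx; apply: le_trans (gB _ Kx) (ltW Bb)].
Qed.

Lemma size_mindex_seq (nu : 'I_d -> nat) : size (mindex_seq nu) = mindex_abs nu.
Proof.
rewrite /mindex_seq /mindex_abs size_flatten /shape -map_comp sumnE big_map big_enum /=.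
by apply: eq_bigr => i _; rewrite size_nseq.
Qed.

Lemma weak_deriv_classical Omega (nu : 'I_d -> nat) g w : open Omega ->
  Ck_on Omega (mindex_abs nu) g -> is_weak_deriv Omega nu g w ->
  ae_eq mu Omega (EFin \o mpartial nu g) (EFin \o w).
Proof.
move=> oO Cg [lg lw gw].
have Cs : Ck_on Omega 0 (mpartial nu g) by apply: Ck_on_partials; rewrite addn0 size_mindex_seq.
apply: (fundamental_lemma oO lw); first exact: Ck_on_locally_integrable Cs.
move=> v tv; have := gw v tv.
rewrite integral_test; last exact: test_function_partials.
rewrite (integral_partials_by_parts (s := mindex_seq nu) oO _ tv) ?size_mindex_seq//.
rewrite -(integral_test _ tv).
rewrite (eq_integral (fun x => (mpartial nu g x * v x)%:E)); last first.
  move=> x /set_mem Ox; congr (_ * _)%:E.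
  by apply: (perm_partials oO Cg _ _ Ox); rewrite ?size_rev ?size_mindex_seq// perm_rev.
move=> /(congr1 (fun z => ((-1) ^+ mindex_abs nu)%:E * z)%E).
by rewrite !muleA -EFinM -expr2 sqrr_sign !mul1e.
Qed.

End weak_derivatives.

(** * Differences of Sobolev functions *)

Section sobolev_differences.
Context {R : realType} {d : nat}.
Local Notation E := 'rV[R]_d.
Local Notation mu := (lebesgue_rV R d).
Implicit Types (h : E) (g u w : E -> R) (Omega : set E) (s : seq 'I_d) (nu : 'I_d -> nat) (p : R).

(** Sums replace the maximum of the constants and the minimum of the radii, and the added 1 keeps
    both positive even for an empty index type. *)
Lemma finite_uniform_bounds (T : finType) (P : T -> R -> R -> Prop) :
  (forall t (C C' h h' : R), C <= C' -> h' <= h -> P t C h -> P t C' h') ->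
  (forall t, exists C h : R, [/\ 0 < C, 0 < h & P t C h]) ->
  exists C h : R, [/\ 0 < C, 0 < h & forall t, P t C h].
Proof.
move=> Pmono /choice[C /choice[h Ch]].
have C0 t : 0 <= C t by have [/ltW] := Ch t.
have h0 t : 0 < (h t)^-1 by have [_ hp _] := Ch t; rewrite invr_gt0.
have S0 : 0 < 1 + \sum_t (h t)^-1.
  by rewrite ltr_pwDl// sumr_ge0// => t _; exact/ltW/h0.
exists (1 + \sum_t C t), (1 + \sum_t (h t)^-1)^-1; split.
- by rewrite ltr_pwDl// sumr_ge0.
- by rewrite invr_gt0.
- move=> t; have [_ hp Pt] := Ch t; apply: Pmono Pt.
    by rewrite (bigD1 t)//= addrCA lerDl addr_ge0// sumr_ge0.
  rewrite -[leRHS]invrK lef_pV2 ?posrE// (bigD1 t)//= addrCA lerDl addr_ge0// sumr_ge0// => i _.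
  exact/ltW/h0.
Qed.

Lemma count_mindex_seq nu j : count_mem j (mindex_seq nu) = nu j.
Proof.
rewrite /mindex_seq count_flatten -map_comp sumnE big_map big_enum /=.
rewrite (bigD1 j)//= [X in (X + _)%N]count_nseq /= eqxx mul1n big1 ?addn0// => i /negbTE ij.
by rewrite count_nseq /= ij.
Qed.

(** Counting occurrences turns a sequence of directions into an element of the index type over which
    the seminorms sum; no count exceeds the size. *)
Lemma mindex_of_seq s : exists nu : {ffun 'I_d -> 'I_(size s).+1},
  mindex_abs (mindex nu) = size s /\ perm_eq (mindex_seq (mindex nu)) s.
Proof.
pose nu : {ffun 'I_d -> 'I_(size s).+1} := [ffun i => inord (count_mem i s)].
have nus : perm_eq (mindex_seq (mindex nu)) s.
  apply/allP => j _ /=; rewrite count_mindex_seq /mindex /nu ffunE inordK//.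
  by rewrite ltnS count_size.
by exists nu; split => //; rewrite -size_mindex_seq (perm_size nus).
Qed.

Lemma sobolev_partials_difference Omega u p (sg : R) s : (0 < d)%N ->
  bounded_set Omega -> lipschitz_domain Omega -> 1 <= p ->
  Ck_on Omega (Num.truncn sg) u -> sobolev sg Omega p u -> 0 < sg - (Num.truncn sg)%:R ->
  size s = Num.truncn sg ->
  exists C h0 : R, [/\ 0 < C, 0 < h0 & forall h, `|h| <= h0 ->
    (Jp mu (ddom Omega 1 h) p (finite_diff 1 h (partials s u)) <=
      (C * `|h| `^ ((sg - (Num.truncn sg)%:R) * p))%:E)%E].
Proof.
move=> d0 bO lO p1 Cu [[_ su] gu] b0 sm; have [oO _ _] := lO.
have p0 : 0 < p by exact: lt_le_trans p1.
move: Cu su gu; rewrite -sm => Cu su gu.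
have [nu [nus nuE]] := mindex_of_seq s.
have [wd _] := su (mindex nu) (eq_leq nus).
have [_ [mw _] _] := wd.
have := gu _ ; rewrite sm => /(_ b0); rewrite -sm => {}gu.
have gnu : (gagliardo Omega p (sg - (size s)%:R) (weak_deriv Omega (mindex nu) u) < +oo)%E.
  apply: le_lt_trans gu; rewrite (bigD1 nu)/=; last by rewrite nus.
  rewrite leeDl// sume_ge0// => i _; apply: integral_ge0 => x _; apply: integral_ge0 => y _.
  by rewrite lee_fin divr_ge0 ?powR_ge0.
rewrite -sm in b0.
apply: (gagliardo_difference d0 bO lO p0 b0 mw gnu).
  by apply: (@Ck_on_measurable _ _ _ 0) => //; apply: Ck_on_partials; rewrite addn0.
have := @weak_deriv_classical _ _ Omega (mindex nu) u _ oO _ wd; rewrite nus => /(_ Cu).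
apply: filterS => x /= H Ox; have [<-] := H Ox.
by apply: (perm_partials oO Cu) => //; rewrite perm_sym.
Qed.

(** Starts from the derivatives of order floor sg, where the Gagliardo seminorm is available. Each
    step replaces a derivative by one more difference and gains |h|^p. *)
Lemma sobolev_difference_order Omega u p (sg : R) j s : (0 < d)%N ->
  bounded_set Omega -> lipschitz_domain Omega -> 1 <= p ->
  Ck_on Omega (Num.truncn sg) u -> sobolev sg Omega p u -> 0 < sg - (Num.truncn sg)%:R ->
  (size s + j)%N = Num.truncn sg ->
  exists C h0 : R, [/\ 0 < C, 0 < h0 & forall h, `|h| <= h0 ->
    (Jp mu (ddom Omega j.+1%:R h) p (finite_diff j.+1 h (partials s u)) <=
      (C * `|h| `^ ((sg - (size s)%:R) * p))%:E)%E].
Proof.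
move=> d0 bO lO p1 Cu su b0; have [oO _ _] := lO.
have p0 : 0 < p by exact: lt_le_trans p1.
elim: j s => [|j IH] s sj.
  rewrite addn0 in sj; rewrite sj; exact: sobolev_partials_difference.
have [||C [h0 [C0 h00 CH]]] := @finite_uniform_bounds 'I_d (fun i (C h0 : R) => forall h, `|h| <= h0 ->
    (Jp mu (ddom Omega j.+1%:R h) p (finite_diff j.+1 h (partial i (partials s u))) <=
      (C * `|h| `^ ((sg - (size s).+1%:R) * p))%:E)%E).
- move=> i C C' h0 h0' CC hh H h /le_trans/(_ hh) /H; move/le_trans; apply.
  by rewrite lee_fin ler_wpM2r ?powR_ge0.
- by move=> i; apply: (IH (i :: s)); rewrite addSn -sj addnS.
exists (2 `^ p * d%:R `^ p * (d%:R * C)), h0; split=> //.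
  by rewrite !mulr_gt0 ?powR_gt0 ?ltr0n.
move=> h hh0.
have C1 : Ck_on Omega 1 (partials s u).
  by apply: Ck_on_partials; apply: Ck_onW Cu; rewrite -sj leq_add2l.
apply: le_trans (Jp_diff_derivatives _ _ oO C1 p1) _.
set e := (sg - (size s).+1%:R) * p.
(* Makes p + e nonzero, so that the power of |h| can be split also at h = 0. *)
have e0 : 0 < e.
  rewrite mulr_gt0// subr_gt0; apply: (@le_lt_trans _ _ (Num.truncn sg)%:R); last by rewrite -subr_gt0.
  by rewrite ler_nat -sj addnS ltnS leq_addr.
have -> : 2 `^ p * d%:R `^ p * (d%:R * C) * `|h| `^ ((sg - (size s)%:R) * p) =
    2 `^ p * (d%:R * `|h|) `^ p * (d%:R * (C * `|h| `^ e)).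
  have -> : (sg - (size s)%:R) * p = p + e by rewrite /e -natr1; ring.
  rewrite powRD; last by rewrite gt_eqF// addr_gt0.
  by rewrite powRM//; ring.
rewrite [leRHS]EFinM; apply: lee_wpmul2l; first by rewrite lee_fin mulr_ge0 ?powR_ge0.
apply: (@le_trans _ _ (\sum_(i < d) (C * `|h| `^ e)%:E)%E).
  by apply: lee_sum => i _; exact: CH.
by rewrite sumEFin lee_fin sumr_const card_ord mulr_natl.
Qed.

Lemma Jp_diff_mono Omega g k r h p : open Omega -> Ck_on Omega 0 g -> 0 <= p -> (k <= r)%N ->
  (Jp mu (ddom Omega r%:R h) p (finite_diff r h g) <=
   ((2 `^ (p + 1)) ^+ (r - k))%:E * Jp mu (ddom Omega k%:R h) p (finite_diff k h g))%E.
Proof.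
move=> oO Cg p0 kr; rewrite -{1 2}(subnKC kr); elim: (r - k)%N => [|n IH].
  by rewrite addn0 expr0 mul1e.
rewrite addnS; apply: le_trans (Jp_diffS _ _ oO Cg p0) _.
by rewrite exprS EFinM -muleA lee_pmul2l// lte_fin powR_gt0.
Qed.

Lemma sobolev_difference Omega u p (sg : R) r : (0 < d)%N ->
  bounded_set Omega -> lipschitz_domain Omega -> 1 <= p ->
  Ck_on Omega (Num.truncn sg) u -> sobolev sg Omega p u -> 0 < sg - (Num.truncn sg)%:R ->
  (Num.truncn sg < r)%N ->
  exists C h0 : R, [/\ 0 < C, 0 < h0 & forall h, `|h| <= h0 ->
    (Jp mu (ddom Omega r%:R h) p (finite_diff r h u) <= (C * `|h| `^ (sg * p))%:E)%E].
Proof.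
move=> d0 bO lO p1 Cu su b0 mr; have [oO _ _] := lO.
have p0 : 0 <= p by exact: le_trans p1.
have [C [h0 [C0 h00 CH]]] := @sobolev_difference_order _ _ _ _ _ [::] d0 bO lO p1 Cu su b0 erefl.
rewrite subr0 in CH.
exists ((2 `^ (p + 1)) ^+ (r - (Num.truncn sg).+1) * C), h0; split => //.
  by rewrite mulr_gt0// exprn_gt0// powR_gt0.
move=> h hh0; apply: le_trans (Jp_diff_mono _ oO (Ck_onW (leq0n _) Cu) p0 mr) _.
rewrite -mulrA EFinM; apply: lee_wpmul2l; last exact: CH.
by rewrite lee_fin exprn_ge0// powR_ge0.
Qed.

End sobolev_differences.

(** * Differences of Hoelder functions away from the boundary *)

Section hoelder_interior.
Context {R : realType} {d : nat}.
Local Notation E := 'rV[R]_d.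
Local Notation mu := (lebesgue_rV R d).
Implicit Types (x y z h : E) (g u w : E -> R) (Omega : set E) (s : seq 'I_d) (t : R).

Lemma enormN x : enorm (- x) = enorm x.
Proof. by rewrite /enorm /dotv; congr Num.sqrt; apply: eq_bigr => i _; rewrite !mxE mulrNN. Qed.

(* A point of the closure with maximal first coordinate cannot be interior. *)
Lemma boundary_neq0 Omega : (0 < d)%N -> bounded_set Omega -> open Omega -> Omega !=set0 ->
  boundary Omega !=set0.
Proof.
move=> d0 bO oO [x0 Ox0]; set i := Ordinal d0.
have cont : {within closure Omega, continuous (fun x : E => x ord0 i)}.
  by apply: continuous_subspaceT => x; exact: coord_continuous.
have [|z /set_mem cz zmax] := compact_EVT_max _ (bounded_compact_closure bO) cont.
  by exists x0; exact: subset_closure.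
exists z; split=> // /interior_subset Oz.
have /nbhs_rVP[e e0 eO] := oO _ Oz.
have /mem_set/zmax : closure Omega (z + (e / 2) *: delta_mx ord0 i).
  apply: subset_closure; apply: eO; rewrite addrAC subrr add0r normrZ norm_delta_mx mulr1.
  by rewrite gtr0_norm ?divr_gt0// ltr_pdivrMr// ltr_pMr// ltr1n.
by rewrite !mxE eqxx mulr1 gerDl leNgt divr_gt0.
Qed.

(** Dilated by c, this Euclidean ball has radius t / 2, hence still lies in the sup-norm ball of
    radius t. *)
Lemma ball_family_ball Omega (c : R) x t : 1 < c -> 0 < t -> nball x t `<=` Omega ->
  ball_family c Omega (ecball x (t / (2 * c))).
Proof.
move=> c1 t0 tO; have c0 : 0 < c by exact: lt_trans c1.
have r0 : 0 < t / (2 * c) by rewrite divr_gt0// mulr_gt0.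
have rt : c * (t / (2 * c)) = t / 2 by field; rewrite gt_eqF.
have t2 : t / 2 < t by rewrite ltr_pdivrMr// ltr_pMr// ltr1n.
have Ot : eball x (c * (t / (2 * c))) `<=` Omega.
  move=> y; rewrite /eball /= rt => yx; apply: tO.
  by apply: le_lt_trans (norm_le_enorm _) (lt_trans yx t2).
exists x, (t / (2 * c)); split => //.
  by apply: tO; rewrite /nball/= subrr normr0.
move=> y yx; apply: Ot; rewrite /eball /=; apply: le_lt_trans yx _.
by rewrite ltr_pMl.
Qed.

Lemma Cla_loc_Ck_on l alpha gamma c Omega u : 1 < c -> open Omega ->
  Cla_loc l alpha gamma c Omega u -> Ck_on Omega l u.
Proof.
move=> c1 oO [uK _].
have c0 : 0 < c by exact: lt_trans c1.
have H x : Omega x -> exists2 r : R, 0 < r & Cl l (ecball x r) u.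
  move=> Ox; have /nbhs_rVP[t t0 tO] := oO _ Ox.
  exists (t / (2 * c)); first by rewrite divr_gt0// mulr_gt0.
  by have [] := uK _ (ball_family_ball c1 t0 tO).
have xx x r : 0 < r -> ecball x r x by move=> r0; rewrite /ecball/= subrr enorm0 ltW.
split=> [s i x sl Ox|s x sl Ox]; have [r r0 [ud uc]] := H x Ox.
  by apply: ud sl _ _ _; exact: xx.
have [ucs _] := uc s sl.
apply/(@cvgrPdist_lt _ _ _ (nbhs x)) => eps eps0; have [del del0 Hdel] := ucs _ eps0.
pose rho := Num.min r del / (d%:R + 1).
have d1 : 0 < (d%:R + 1 : R) by rewrite ltr_wpDl.
have rho0 : 0 < rho by rewrite divr_gt0// lt_min r0.
apply/nbhs_rVP; exists rho => // y yx.
have ey : enorm (x - y) < Num.min r del.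
  apply: le_lt_trans (enorm_le_norm _) _; rewrite -normrN opprB.
  apply: (@le_lt_trans _ _ ((d%:R + 1) * `|y - x|)); first by rewrite ler_wpM2r// lerDl.
  by rewrite mulrC -ltr_pdivlMr.
move: ey; rewrite lt_min => /andP[eyr eyd]; apply: Hdel => //; first exact: xx.
by rewrite /ecball/= -enormN opprB ltW.
Qed.

(** The sets must be nonempty because [inf] of the empty set has the default value 0. *)
Lemma set_dist_ge (A B : set E) (t : R) : A !=set0 -> B !=set0 ->
  (forall x y, A x -> B y -> t <= `|x - y|) -> t <= set_dist A B.
Proof.
move=> [a Aa] [b Bb] tAB; apply: lb_le_inf; first by exists (enorm (a - b)); exists a => //; exists b.
by move=> _ [x Ax [y By <-]]; apply: le_trans (norm_le_enorm _); exact: tAB.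
Qed.

Lemma powR_expr (b e : R) n : 0 <= b -> (b ^+ n) `^ e = (b `^ e) ^+ n.
Proof.
move=> b0; elim: n => [|n IH]; first by rewrite !expr0 powR1.
by rewrite !exprS powRM ?exprn_ge0// IH.
Qed.

Lemma powR_half t (b : R) : 0 < t -> (t / 2) `^ (- b) = 2 `^ b * t `^ (- b).
Proof.
move=> t0; rewrite powRM ?ltW// mulrC; congr (_ * _).
by rewrite -powR_inv1// -powRrM mulN1r opprK.
Qed.

(** The ball of radius t / (2 c) keeps distance at least t / 2 from the boundary, so removing the
    weight costs 2^gamma t^(-gamma). The sum over multi-indices dominates its term belonging to s;
    d^alpha passes from the Euclidean to the sup norm. *)
Lemma hoelder_interior_bound l alpha gamma c Omega u : (0 < d)%N -> 1 < c ->
  bounded_set Omega -> open Omega -> 0 <= alpha -> 0 < gamma ->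
  Cla_loc l alpha gamma c Omega u ->
  exists2 M : R, 0 < M & forall x t s y z, 0 < t -> nball x t `<=` Omega -> size s = l ->
    ecball x (t / (2 * c)) y -> ecball x (t / (2 * c)) z ->
    `|partials s u y - partials s u z| <= M * t `^ (- gamma) * `|y - z| `^ alpha.
Proof.
move=> d0 c1 bO oO a0 g0 uC; have Cu := Cla_loc_Ck_on c1 oO uC; have [_ uoo] := uC.
have c0 : 0 < c by exact: lt_trans c1.
have [M0 M00 HM] : exists2 M : R, 0 < M & forall K, ball_family c Omega K ->
    (((set_dist K (boundary Omega)) `^ gamma)%:E * hoelder_seminorm l alpha K u <= M%:E)%E.
  move: uoo; set S := [set _ | _ in _] => uoo.
  have SE K : ball_family c Omega K -> S (((set_dist K (boundary Omega)) `^ gamma)%:E * hoelder_seminorm l alpha K u)%E.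
    by move=> KF; exists K.
  move: uoo (@ereal_sup_ubound _ S); case: (ereal_sup S) => [M| |] // _ HS.
    exists (`|M| + 1); first by rewrite ltr_wpDl.
    move=> K /SE/HS; move/le_trans; apply; rewrite lee_fin.
    by apply: le_trans (ler_norm _) _; rewrite lerDl.
  by exists 1 => // K /SE/HS; move/le_trans; apply; rewrite leNye.
exists (M0 * 2 `^ gamma * d%:R `^ alpha).
  by rewrite !mulr_gt0 ?powR_gt0 ?ltr0n.
move=> x t s y z t0 tO sl Ky Kz; set r := t / (2 * c) in Ky Kz.
have r0 : 0 < r by rewrite divr_gt0// mulr_gt0.
have rt : r <= t / 2.
  by rewrite /r invfM mulrA ler_pdivrMr// ler_peMr ?ltW// divr_gt0.
have KF := ball_family_ball c1 t0 tO.
have [eqyz|yz] := pselect (y = z).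
  by rewrite eqyz subrr normr0 !mulr_ge0 ?powR_ge0 ?(ltW M00).
have Kx : ecball x r x by rewrite /ecball/= subrr enorm0 ltW.
have t2d : t / 2 <= set_dist (ecball x r) (boundary Omega).
  apply: set_dist_ge; first by exists x.
    by apply: boundary_neq0 => //; exists x; apply: tO; rewrite /nball/= subrr normr0.
  move=> a b Ka [_ nb]; have nOb : ~ Omega b by move=> Ob; apply: nb; exact: (oO _ Ob).
  have : ~~ (`|b - x| < t) by apply/negP => /tO.
  rewrite -leNgt => tb; have := norm_le_enorm (a - x); move: Ka; rewrite /ecball/=.
  have := ler_distD a b x; rewrite (distrC b a).
  by move: tb rt; move: (enorm _) (`|a - b|) (`|b - x|) (`|a - x|) => p1 p2 p3 p4; clear; lra.
pose S (nu : {ffun 'I_d -> 'I_l.+1}) := ereal_sup [set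
  (`|mpartial (mindex nu) u z.1 - mpartial (mindex nu) u z.2| / enorm (z.1 - z.2) `^ alpha)%:E |
  z in [set z : E * E | [/\ ecball x r z.1, ecball x r z.2 & z.1 <> z.2]]].
have yzS nu : ((`|mpartial (mindex nu) u y - mpartial (mindex nu) u z| / enorm (y - z) `^ alpha)%:E <= S nu)%E.
  by apply: ereal_sup_ubound; exists (y, z).
have S0 nu : (0 <= S nu)%E by apply: le_trans (yzS nu); rewrite lee_fin divr_ge0 ?powR_ge0.
have [nu [nul nus]] := mindex_of_seq s; rewrite sl in nu nul nus.
have := HM _ KF.
rewrite /hoelder_seminorm (bigD1 nu)/=; last by rewrite nul.
move=> HM'.
have {HM'} : ((t / 2) `^ gamma * (`|mpartial (mindex nu) u y - mpartial (mindex nu) u z| / enorm (y - z) `^ alpha) <= M0).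
  rewrite -lee_fin; apply: le_trans HM'; rewrite EFinM; apply: lee_pmul.
  - by rewrite lee_fin powR_ge0.
  - by rewrite lee_fin divr_ge0 ?powR_ge0.
  - rewrite lee_fin; have t20 : 0 < t / 2 by rewrite divr_gt0.
    by apply: ge0_ler_powR; rewrite ?nnegrE ?(ltW g0) ?(ltW t20)// (le_trans (ltW t20)).
  - apply: le_trans (yzS nu) _; rewrite leeDl// sume_ge0// => i _; exact: S0.
have KO a : ecball x r a -> Omega a.
  move=> Ka; apply: tO; rewrite /nball/=; apply: le_lt_trans (norm_le_enorm _) _.
  by apply: le_lt_trans Ka _; apply: le_lt_trans rt _; rewrite ltr_pdivrMr// ltr_pMr// ltr1n.
have pE a : ecball x r a -> mpartial (mindex nu) u a = partials s u a.
  by move=> /KO Oa; apply: (perm_partials oO Cu) => //; rewrite size_mindex_seq nul.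
rewrite !pE//; set D := `|_|; set e := enorm (y - z).
have e0 : 0 < e.
  apply: lt_le_trans (norm_le_enorm _); rewrite normr_gt0 subr_eq0; exact/eqP.
have t20 : 0 < t / 2 by rewrite divr_gt0.
rewrite mulrA ler_pdivrMr ?powR_gt0// mulrC -ler_pdivlMr ?powR_gt0// => /le_trans; apply.
rewrite -powRN powR_half//.
have : e `^ alpha <= d%:R `^ alpha * `|y - z| `^ alpha.
  rewrite -powRM//; apply: ge0_ler_powR; rewrite ?nnegrE ?mulr_ge0 ?(ltW e0)//; exact: enorm_le_norm.
move=> H; have := ler_wpM2l (mulr_ge0 (mulr_ge0 (ltW M00) (powR_ge0 2 gamma)) (powR_ge0 t (- gamma))) H.
rewrite (_ : M0 * _ * (_ * _) = M0 * 2 `^ gamma * t `^ (- gamma) * e `^ alpha); last by ring.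
by move=> /le_trans; apply; rewrite le_eqVlt; apply/orP; left; apply/eqP; ring.
Qed.

Lemma nball_half x y t : nball x (t / 2) y -> nball y (t / 2) `<=` nball x t.
Proof.
move=> yx z zy; rewrite /nball/= -(subrKA y); apply: le_lt_trans (ler_normD _ _) _.
by rewrite (splitr t) ltrD.
Qed.

(** For r = l + 1, l differences become derivatives and the last one is estimated by the Hoelder
    bound. Each further difference is a triangle inequality between two balls of half the radius. *)
Lemma hoelder_difference l alpha gamma c Omega u r : (0 < d)%N -> 1 < c ->
  bounded_set Omega -> open Omega -> 0 < alpha -> 0 < gamma ->
  Cla_loc l alpha gamma c Omega u -> (l < r)%N ->
  exists A C : R, [/\ 0 < A, 0 < C & forall x t h, 0 < t -> nball x t `<=` Omega ->
    A * `|h| <= t -> `|finite_diff r h u x| <= C * `|h| `^ (l%:R + alpha) * t `^ (- gamma)].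
Proof.
move=> d0 c1 bO oO a0 g0 uC; have Cu := Cla_loc_Ck_on c1 oO uC.
have c0 : 0 < c by exact: lt_trans c1.
elim: r => // r IH; rewrite ltnS leq_eqVlt => /predU1P[<-|/IH{IH}[A [C [A0 C0 H]]]]; last first.
  (* 2 A |h| <= t lets the bound apply with radius t / 2, and 4 |h| <= t keeps the ball around x + h
     inside that around x. *)
  exists (2 * A + 4), (2 * 2 `^ gamma * C); split.
  - by rewrite addr_gt0// mulr_gt0.
  - by rewrite !mulr_gt0 ?powR_gt0.
  move=> x t h t0 tO ht; have t20 : 0 < t / 2 by rewrite divr_gt0.
  have An0 := mulr_ge0 (ltW A0) (normr_ge0 h).
  have Ah : A * `|h| <= t / 2.
    move: ht (normr_ge0 h); rewrite mulrDl -mulrA; move: (A * `|h|) (`|h|) => m n; clear; lra.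
  have h2 : `|h| < t / 2.
    move: ht An0 t0; rewrite mulrDl -mulrA; move: (A * `|h|) (`|h|) => m n; clear; lra.
  have xO : nball x (t / 2) `<=` Omega.
    apply: subset_trans tO; apply: nball_half.
    by rewrite /nball/= subrr normr0.
  have xhO : nball (x + h) (t / 2) `<=` Omega.
    apply: subset_trans tO; apply: nball_half.
    by rewrite /nball/= addrAC subrr add0r.
  rewrite finite_diffS; apply: le_trans (ler_normB _ _) _.
  apply: le_trans (lerD (H _ _ _ t20 xhO Ah) (H _ _ _ t20 xO Ah)) _.
  by rewrite powR_half// le_eqVlt; apply/orP; left; apply/eqP; ring.
have l0 : 0 <= (l%:R : R) by [].
have [M M0 HM] := hoelder_interior_bound d0 c1 bO oO (ltW a0) g0 uC.
(* The first summand keeps the segment of length (l + 1) |h| in the ball of radius t / 2; the second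
   puts y + h in the Euclidean ball of radius (t / 2) / (2 c) around y. *)
exists (4 * l.+1%:R + 4 * c * d%:R), (d%:R ^+ l * M * 2 `^ gamma); split.
- by rewrite ltr_pwDl ?mulr_gt0// !mulr_ge0 ?(ltW c0).
- by rewrite !mulr_gt0 ?exprn_gt0 ?powR_gt0 ?ltr0n.
move=> x t h t0 tO ht; have t20 : 0 < t / 2 by rewrite divr_gt0.
have cdh : 0 <= 4 * c * d%:R * `|h| by rewrite !mulr_ge0 ?(ltW c0).
have lh0 : 0 <= 4 * l.+1%:R * `|h| by rewrite !mulr_ge0.
have lh : l.+1%:R * `|h| < t / 2.
  move: ht; rewrite mulrDl; move: cdh; move: (4 * c * _ * _) => m.
  by rewrite -mulrA; move: (_ * `|h|) t0 => n; clear; lra.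
have dh : enorm h <= t / 2 / (2 * c).
  apply: le_trans (enorm_le_norm _) _; rewrite ler_pdivlMr ?mulr_gt0// ler_pdivlMr//.
  rewrite (_ : _ * 2 = 4 * c * d%:R * `|h|); last by ring.
  by apply: le_trans ht; rewrite [leRHS]mulrDl; move: lh0; rewrite -(lerDr (4 * c * d%:R * `|h|)).
have sub2 : nball x (t / 2) `<=` Omega.
  by move=> y yx; apply: tO; apply: lt_trans yx _; rewrite ltr_pdivrMr// ltr_pMr// ltr1n.
apply: le_trans (@finite_diff_bound _ _ Omega (nball x (t / 2)) h u l (M * (t / 2) `^ (- gamma) * `|h| `^ alpha) oO sub2 Cu _ _ x _) _.
- by rewrite !mulr_ge0 ?powR_ge0 ?(ltW M0).
- move=> s sl y hy; have yx : nball x (t / 2) y.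
    by have := hy 0; rewrite lexx ler01 scale0r addr0; exact.
  rewrite finite_diffS !finite_diff0 -[in `|h| `^ _](addrK y h) [h + y]addrC.
  apply: (HM y) => //.
  + by apply: subset_trans tO; exact: nball_half.
  + by rewrite /ecball/= addrAC subrr add0r.
  + by rewrite /ecball/= subrr enorm0 divr_ge0 ?(ltW t20)// mulr_ge0// ltW.
- move=> s /andP[s0 sl]; rewrite /nball/= addrAC subrr add0r normrZ ger0_norm//.
  by apply: le_lt_trans lh; rewrite ler_wpM2r.
rewrite powR_half// powRD; last by rewrite gt_eqF// ltr_wpDl.
rewrite powR_mulrn// exprMn le_eqVlt; apply/orP; left; apply/eqP; ring.
Qed.

(** Between the distances 2^n t0 and 2^(n+1) t0 the integrand is at most B (2^n t0)^(-a) on a set of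
    measure at most 2 CL 2^n t0. The sum is geometric with ratio 2^(1 - a), which is below 1 because
    a > 1. *)
Lemma layered_integral Omega (D : set E) (f : E -> R) tau a B CL t0 :
  open Omega -> measurable D -> D `<=` Omega -> measurable_fun D f ->
  0 < t0 -> 1 < a -> 0 <= B -> 0 <= CL ->
  (forall t, 0 < t -> (mu (layer Omega t) <= (CL * t)%:E)%E) ->
  (exists T : R, layer Omega T = Omega) ->
  (forall x t, t0 <= t -> D x -> ~ layer Omega t x -> `|f x| `^ tau <= B * t `^ (- a)) ->
  (Jp mu (D `\` layer Omega t0) tau f <=
     (B * (2 * CL) / (1 - 2 `^ (1 - a)) * t0 `^ (1 - a))%:E)%E.
Proof.
move=> oO mD DO mf t00 a1 B0 CL0 HL [T HT] Hf.
have mL t : measurable (layer Omega t) by exact: measurable_layer.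
set q := 2 `^ (1 - a).
have q0 : 0 < q by exact: powR_gt0.
have q1 : q < 1.
  rewrite /q /powR ifF ?gt_eqF// expR_lt1 nmulr_rlt0 ?subr_lt0//.
  by rewrite ln_gt0// ltr1n.
pose A n := D `&` layer Omega (2 ^+ n * t0) `\` layer Omega t0.
have mA n : measurable (A n) by apply: measurableD => //; exact: measurableI.
have mfA n : measurable_fun (A n) f by apply: measurable_funS mf => // x [[]].
have H n : (Jp mu (A n) tau f <= (\sum_(k < n) B * (2 * CL) * (q ^+ k * t0 `^ (1 - a)))%:E)%E.
  elim: n => [|n IH].
    rewrite big_ord0 /A expr0 mul1r (_ : _ `\` _ = set0); first by rewrite /Jp integral_set0.
    by apply/seteqP; split=> x // [[]].
  pose S := (D `&` layer Omega (2 ^+ n.+1 * t0)) `\` layer Omega (2 ^+ n * t0) `\` layer Omega t0.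
  have mS : measurable S by do 2 apply: measurableD => //; exact: measurableI.
  have mfS : measurable_fun S f by apply: measurable_funS mf => // x [[[]]].
  have t2 : 2 ^+ n * t0 <= 2 ^+ n.+1 * t0 by rewrite exprS -mulrA ler_peMl ?ler1n// mulr_ge0 ?exprn_ge0// ltW.
  have -> : A n.+1 = A n `|` S.
    apply/seteqP; split=> [x [[Dx Lx] nLx]|x [[[Dx Lx] nLx]|[[[Dx Lx] _] nLx]]]; last 2 first.
    + by split=> //; split=> //; exact: layerS t2 _ Lx.
    + by [].
    by have [Ln|nLn] := pselect (layer Omega (2 ^+ n * t0) x); [left|right].
  have dAS : [disjoint A n & S].
    by rewrite disj_set2E; apply/eqP/seteqP; split=> x // [[[_ Ln] _] [[_ nLn] _]].
  have mAS : measurable_fun (A n `|` S) (fun x => (`|f x| `^ tau)%:E).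
    by apply/measurable_funU => //; split; exact: measurable_fun_normpow.
  rewrite /Jp ge0_integral_setU//.
  rewrite big_ord_recr /= EFinD leeD//.
  apply: (@le_trans _ _ (\int[mu]_(x in S) (B * (2 ^+ n * t0) `^ (- a))%:E)%E).
    apply: ge0_le_integral_nomeas => x; first by rewrite lee_fin powR_ge0.
    move=> [[[Dx Lx] nLx] nL0]; rewrite lee_fin; apply: Hf => //.
    by rewrite ler_peMl ?(ltW t00)// exprn_ege1// ler1n.
  rewrite integral_cst// (@le_trans _ _ ((B * (2 ^+ n * t0) `^ (- a))%:E * mu (layer Omega (2 ^+ n.+1 * t0)))%E)//.
    apply: lee_wpmul2l; first by rewrite lee_fin mulr_ge0 ?powR_ge0.
    by apply: le_measure; rewrite ?inE// => x [[[]]].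
  have s0 : 0 < 2 ^+ n * t0 by rewrite mulr_gt0 ?exprn_gt0.
  apply: (@le_trans _ _ ((B * (2 ^+ n * t0) `^ (- a))%:E * (CL * (2 ^+ n.+1 * t0))%:E)%E).
    apply: lee_wpmul2l; first by rewrite lee_fin mulr_ge0 ?powR_ge0.
    by apply: HL; rewrite mulr_gt0 ?exprn_gt0.
  rewrite -EFinM lee_fin.
  have -> : q ^+ n * t0 `^ (1 - a) = (2 ^+ n * t0) * (2 ^+ n * t0) `^ (- a).
    have -> : 2 ^+ n * t0 * (2 ^+ n * t0) `^ (- a) = (2 ^+ n * t0) `^ (1 - a).
      by rewrite powRD ?powRr1 ?(ltW s0)// (gt_eqF s0) implybT.
    rewrite powRM ?exprn_ge0 ?(ltW t00)//; congr (_ * _).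
    by rewrite powR_expr.
  by rewrite exprS le_eqVlt; apply/orP; left; apply/eqP; ring.
(* Since the layer of width T is all of Omega, a finite partial sum already covers [D]. *)
have [n Tn] : exists n, T <= 2 ^+ n * t0.
  exists (Num.bound (`|T / t0|)).
  rewrite -ler_pdivrMr//; apply: le_trans (ler_norm _) _.
  apply: le_trans (ltW (archi_boundP (normr_ge0 _))) _.
  by rewrite -natrX ler_nat ltnW// ltn_expl.
have -> : D `\` layer Omega t0 = A n.
  apply/seteqP; split=> [x [Dx nx]|x [[Dx _] nx]]; split => //; split => //.
  by apply: layerS Tn _ _; rewrite HT; exact: DO.
apply: le_trans (H n) _; rewrite lee_fin -mulr_sumr -mulr_suml -[leRHS]mulrA ler_wpM2l ?mulr_ge0//.
rewrite ler_wpM2r ?powR_ge0// -[leRHS]mul1r ler_pdivlMr ?subr_gt0//.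
have := subrX1 q n; move: (exprn_ge0 n (ltW q0)).
move: (q ^+ n) (\sum_(i < n) q ^+ i) => Q S; clear -q1; nra.
Qed.

End hoelder_interior.

(** * Besov spaces *)

Section power_integrals.
Context {R : realType}.
Local Notation mu := (@lebesgue_measure R).

Lemma continuous_powR_gt0 (e t : R) : 0 < t -> {for t, continuous (fun x : R => x `^ e)}.
Proof.
move=> t0; apply: differentiable_continuous; apply/derivable1_diffP.
by apply: derivable_powR; rewrite in_itv/= t0.
Qed.

Lemma integral_powR_itv (a b e : R) : 0 < a < b -> e != 0 ->
  (\int[mu]_(t in `[a, b]) (t `^ (e - 1))%:E = (e^-1 * b `^ e)%:E - (e^-1 * a `^ e)%:E)%E.
Proof.
move=> /andP[a0 ab] e0.
have cF (t : R) : 0 < t -> {for t, continuous (fun x : R => e^-1 * x `^ e)}.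
  by move=> t0; apply: continuousM; [exact: cst_continuous|exact: continuous_powR_gt0].
have dF (t : R) : 0 < t -> is_derive t 1 (fun x : R => e^-1 * x `^ e) (t `^ (e - 1)).
  move=> t0; apply: is_derive_eq; first by apply: is_deriveM; exact: is_derive1_powR.
  by rewrite scaler0 addr0 /GRing.scale/= mulrA mulVf// mul1r.
apply: (@continuous_FTC2 _ _ (fun x : R => e^-1 * x `^ e)) => //.
- apply: continuous_in_subspaceT => t; rewrite inE/= in_itv/= => /andP[at_ _].
  by apply: continuous_powR_gt0; exact: lt_le_trans at_.
- split.
  + move=> t; rewrite in_itv/= => /andP[at_ _]; have := dF t (lt_trans a0 at_).
    by case.
  + by apply: cvg_at_right_filter; exact: cF.
  + by apply: cvg_at_left_filter; apply: cF; exact: lt_trans ab.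
- move=> t; rewrite in_itv/= => /andP[at_ _]; have := dF t (lt_trans a0 at_) => D.
  by rewrite derive1E; exact: derive_val.
Qed.

Lemma integral_nondecreasing_bound (F : (set R)^nat) (f : R -> R) (B : R) :
  nondecreasing_seq F -> (forall n, measurable (F n)) ->
  (forall n, measurable_fun (F n) f) -> (forall n x, F n x -> 0 <= f x) ->
  (forall n, \int[mu]_(x in F n) (f x)%:E <= B%:E)%E ->
  (\int[mu]_(x in \bigcup_n F n) (f x)%:E <= B%:E)%E.
Proof.
move=> ndF mF mf f0 FB.
have mf' n : measurable_fun (F n) (EFin \o f) by exact/measurable_EFinP.
have cF := ge0_nondecreasing_set_cvg_integral (mu := mu) ndF mF mf' (fun n x Fx => f0 n x Fx).
rewrite -(cvg_lim _ cF)//; apply: lime_le; last exact: nearW.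
by apply/cvg_ex; eexists; exact: cF.
Qed.

Lemma measurable_powR_itv (A : set R) (e : R) : measurable A -> measurable_fun A (fun t : R => t `^ e).
Proof. by move=> mA; apply: measurable_funTS; exact: measurable_powR. Qed.

Lemma integral_powR_0 (b e : R) : 0 < b -> 0 < e ->
  (\int[mu]_(t in [set t : R | (0 < t <= b)%R]) (t `^ (e - 1))%:E <= (e^-1 * b `^ e)%:E)%E.
Proof.
move=> b0 e0.
(* [n.+2] keeps the left endpoint strictly below b, as [integral_powR_itv] requires. *)
have -> : [set t : R | (0 < t <= b)%R] = \bigcup_n [set` `[b / n.+2%:R, b]].
  apply/seteqP; split=> [t /= /andP[t0 tb]|t [n _]]; last first.
    by rewrite /= in_itv/= => /andP[bt ->]; rewrite andbT (lt_le_trans _ bt)// divr_gt0.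
  exists (Num.bound (b / t)) => //; rewrite /= in_itv/= tb andbT ler_pdivrMr// mulrC -ler_pdivrMr//.
  apply: le_trans (ltW (archi_boundP (divr_ge0 (ltW b0) (ltW t0)))) _.
  by rewrite ler_nat; apply: leq_trans (leqnSn _) (leqnSn _).
apply: integral_nondecreasing_bound => //.
- apply/nondecreasing_seqP => n; apply/subsetPset => t /=; rewrite !in_itv/= => /andP[bt ->].
  by rewrite andbT (le_trans _ bt)// ler_wpM2l ?(ltW b0)// lef_pV2 ?posrE// ler_nat.
- by move=> n; exact: measurable_powR_itv.
- by move=> n x _; exact: powR_ge0.
move=> n; rewrite integral_powR_itv ?gt_eqF//.
  by rewrite -EFinB lee_fin gerBl mulr_ge0 ?powR_ge0// invr_ge0 ltW.
by rewrite divr_gt0//= ltr_pdivrMr// ltr_pMr// ltr1n.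
Qed.

Lemma integral_powR_oo (a e : R) : 0 < a -> 0 < e ->
  (\int[mu]_(t in [set t : R | (a < t)%R]) (t `^ (- e - 1))%:E <= (e^-1 * a `^ (- e))%:E)%E.
Proof.
move=> a0 e0.
pose F n : set R := [set` `[a, a + n.+1%:R]].
have H : (\int[mu]_(t in [set t : R | (a < t)%R]) (t `^ (- e - 1))%:E <=
    \int[mu]_(t in \bigcup_n F n) (t `^ (- e - 1))%:E)%E.
  apply: ge0_subset_integral.
  - by rewrite (_ : [set t | _] = [set` `]a, +oo[])//; apply/seteqP; split=> t /=; rewrite in_itv/= andbT.
  - by apply: bigcup_measurable => n _; exact: measurable_itv.
  - apply/measurable_EFinP; apply: measurable_powR_itv.
    by apply: bigcup_measurable => n _; exact: measurable_itv.
  - by move=> t _; rewrite lee_fin powR_ge0.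
  - move=> t /= at_; exists (Num.bound (t - a)) => //; rewrite /F /= in_itv/= (ltW at_)/= addrC -lerBlDr.
    have ta : 0 <= t - a by rewrite subr_ge0 ltW.
    by apply: le_trans (ltW (archi_boundP ta)) _; rewrite ler_nat.
apply: (le_trans H); apply: integral_nondecreasing_bound => //.
- apply/nondecreasing_seqP => n; apply/subsetPset => t; rewrite /F /= !in_itv/= => /andP[-> tn].
  by rewrite (le_trans tn)// lerD2l ler_nat.
- by move=> n; exact: measurable_itv.
- by move=> n; apply: measurable_powR_itv; exact: measurable_itv.
- by move=> n x _; exact: powR_ge0.
move=> n; rewrite integral_powR_itv ?oppr_eq0 ?gt_eqF//; last first.
  by rewrite a0/= ltrDl.
rewrite -EFinB lee_fin invrN !mulNr opprK gerDr oppr_le0.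
by rewrite mulr_ge0 ?powR_ge0// invr_ge0 ltW.
Qed.

Lemma integral_power_majorant (G : R -> \bar R) (b e e' A B : R) : 0 < b -> 0 < e -> 0 < e' ->
  0 <= A -> 0 <= B -> (forall t : R, (0 < t)%R -> (0 <= G t)%E) ->
  (forall t : R, 0 < t <= b -> (G t <= (A * t `^ (e - 1))%:E)%E) ->
  (forall t : R, b < t -> (G t <= (B * t `^ (- e' - 1))%:E)%E) ->
  (\int[mu]_(t in [set t : R | (0 < t)%R]) G t < +oo)%E.
Proof.
move=> b0 e0 e'0 A0 B0 G0 GA GB.
set S1 := [set t : R | 0 < t <= b]; set S2 := [set t : R | b < t].
have mS1 : measurable S1.
  by rewrite (_ : S1 = [set` `]0, b]])//; apply/seteqP; split=> t /=; rewrite in_itv/=.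
have mS2 : measurable S2.
  by rewrite (_ : S2 = [set` `]b, +oo[])//; apply/seteqP; split=> t /=; rewrite in_itv/= andbT.
have S12 : [set t : R | 0 < t] = S1 `|` S2.
  apply/seteqP; split=> [t /= t0|t [/andP[]//|/=]]; last exact: lt_trans.
  by have [tb|bt] := leP t b; [left; rewrite /S1/= t0|right].
pose g1 t := ((A * t `^ (e - 1))%:E * (\1_S1 t)%:E)%E.
pose g2 t := ((B * t `^ (- e' - 1))%:E * (\1_S2 t)%:E)%E.
have mg (K a : R) S : measurable S -> measurable_fun [set: R] (fun t => ((K * t `^ a)%:E * (\1_S t)%:E)%E).
  move=> mS; apply: emeasurable_funM; apply/measurable_EFinP; last exact: measurable_indic.
  by apply: measurable_funM; [exact: measurable_cst|exact: measurable_powR].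
have gge0 (K a t : R) S : 0 <= K -> (0 <= (K * t `^ a)%:E * (\1_S t)%:E)%E.
  by move=> K0; rewrite -EFinM lee_fin !mulr_ge0 ?powR_ge0// indicE.
have mS : measurable (S1 `|` S2) by exact: measurableU.
rewrite S12; apply: (@le_lt_trans _ _ (\int[mu]_(t in S1 `|` S2) (g1 t + g2 t))%E).
  apply: ge0_le_integral_nomeas => t; rewrite -S12 => t0; first exact: G0.
  rewrite /g1 /g2 !indicE; have [tb|bt] := leP t b.
    have -> : t \in S1 by apply/mem_set; rewrite /S1/= tb andbT.
    have -> : (t \in S2) = false by apply/memNset; rewrite /S2/=; apply/negP; rewrite -leNgt.
    by rewrite mule1 mule0 adde0; apply: GA; rewrite tb andbT.
  have -> : (t \in S1) = false.
    by apply/memNset; rewrite /S1/=; apply/negP; rewrite negb_and orbC -ltNge bt.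
  have -> : t \in S2 by apply/mem_set.
  by rewrite mule0 mule1 add0e; exact: GB.
rewrite ge0_integralD//; last 4 first.
- by move=> t _; exact: gge0.
- by apply: measurable_funTS; exact: mg.
- by move=> t _; exact: gge0.
- by apply: measurable_funTS; exact: mg.
have fin (K a : R) S M : 0 <= K -> measurable S -> S `<=` S1 `|` S2 ->
    (\int[mu]_(t in S) (t `^ a)%:E <= M%:E)%E ->
    (\int[mu]_(t in S1 `|` S2) ((K * t `^ a)%:E * (\1_S t)%:E) < +oo)%E.
  move=> K0 mS' SS SM; rewrite (_ : integral _ _ _ = \int[mu]_(t in S) (K%:E * (t `^ a)%:E))%E.
    rewrite ge0_integralZl_EFin//.
    - by apply: le_lt_trans (lee_wpmul2l _ SM) _; rewrite ?lee_fin// -EFinM ltry.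
    - by move=> t _; rewrite lee_fin powR_ge0.
    - by apply/measurable_EFinP; exact: measurable_powR_itv.
  rewrite -{2}(setIidr SS) integral_mkcondr; apply: eq_integral => t _; rewrite patchE indicE EFinM.
  by case: (t \in S); rewrite ?mule1 ?mule0.
rewrite lte_add_pinfty//.
  exact: (fin _ _ _ _ A0 mS1 (@subsetUl _ _ _) (integral_powR_0 b0 e0)).
exact: (fin _ _ _ _ B0 mS2 (@subsetUr _ _ _) (integral_powR_oo b0 e'0)).
Qed.

End power_integrals.

(** * From decay of differences to Besov regularity *)

Section besov_decay.
Context {R : realType} {d : nat}.
Local Notation E := 'rV[R]_d.
Local Notation mu := (lebesgue_rV R d).
Implicit Types (h : E) (g u : E -> R) (Omega : set E).

Lemma Lnorm_onE (A : set E) (tau : R) g : 0 < tau ->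
  Lnorm_on A tau g = (Jp mu A tau g `^ tau^-1)%E.
Proof.
move=> tau0; rewrite /Lnorm_on unlock /Jp [in RHS]integral_mkcond; congr (poweR _ _).
apply: eq_integral => x _; rewrite /= !patchE; case: ifPn => // _ /=.
by rewrite normr0 powR0// gt_eqF.
Qed.

Lemma besov_integrand_le Omega r u tau sigma t (Y : R) : 0 < tau -> 0 < t -> 0 <= Y ->
  (forall h, enorm h <= t -> (Jp mu (ddom Omega r%:R h) tau (finite_diff r h u) <= Y%:E)%E) ->
  (((t `^ (- sigma))%:E * modulus r u t Omega tau) `^ tau * (t^-1)%:E <=
     (Y * t `^ (- (sigma * tau) - 1))%:E)%E.
Proof.
move=> tau0 t0 Y0 HY.
have mod0 : (0 <= modulus r u t Omega tau)%E.
  apply: (@le_trans _ _ (Lnorm_on (diff_domain Omega r (0 : E)) tau (finite_diff r 0 u))).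
    by rewrite Lnorm_onE// poweR_ge0.
  by apply: ereal_sup_ubound; exists 0 => //=; rewrite enorm0 ltW.
have modY : (modulus r u t Omega tau <= (Y `^ tau^-1)%:E)%E.
  apply: ge_ereal_sup => _ [h /= ht <-]; rewrite Lnorm_onE// diff_domainE -poweR_EFin.
  apply: gt0_ler_poweR; rewrite ?invr_ge0 ?(ltW tau0)//.
  - by rewrite in_itv/= leey Jp_ge0.
  - by rewrite in_itv/= leey andbT lee_fin.
  - exact: HY.
have ts0 : (0 <= (t `^ (- sigma))%:E)%E by rewrite lee_fin powR_ge0.
apply: (@le_trans _ _ (((t `^ (- sigma))%:E * (Y `^ tau^-1)%:E) `^ tau * (t^-1)%:E)%E).
  apply: lee_wpmul2r; first by rewrite lee_fin invr_ge0 ltW.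
  apply: gt0_ler_poweR; rewrite ?(ltW tau0)//.
  - by rewrite in_itv/= leey mule_ge0.
  - by rewrite in_itv/= leey mule_ge0// lee_fin powR_ge0.
  - exact: lee_wpmul2l.
have -> : ((((t `^ (- sigma))%:E * (Y `^ tau^-1)%:E) `^ tau)%E * (t^-1)%:E)%E =
    ((t `^ (- sigma) * Y `^ tau^-1) `^ tau / t)%:E by [].
rewrite lee_fin powRM ?powR_ge0// -!powRrM mulVf ?gt_eqF// powRr1//.
rewrite powRD; last by rewrite (gt_eqF t0) implybT.
by rewrite powR_inv1 ?(ltW t0)// mulNr [leRHS]mulrA [in leLHS](mulrC _ Y).
Qed.

(** For t <= h0 the decay makes the integrand O(t^((sg - sigma) tau - 1)). For larger t the
    differences are bounded by the L_tau norm of u, which leaves t^(-sigma tau - 1), integrable at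
    infinity. *)
Lemma besov_of_decay Omega r u tau sigma (sg C h0 : R) : open Omega -> Ck_on Omega 0 u ->
  0 < tau -> 0 < sigma < sg -> 0 <= C -> 0 < h0 -> (Jp mu Omega tau u < +oo)%E ->
  (forall h, `|h| <= h0 ->
    (Jp mu (ddom Omega r%:R h) tau (finite_diff r h u) <= (C * `|h| `^ (sg * tau))%:E)%E) ->
  besov r sigma Omega tau u.
Proof.
move=> oO Cu tau0 /andP[sigma0 sigmasg] C0 h00 Joo HC; split.
  split; first exact: Ck_on_measurable Cu.
  by rewrite Lnorm_onE// poweR_lty.
have sg0 : 0 < sg by exact: lt_trans sigmasg.
pose B := (2 `^ (tau + 1)) ^+ r * fine (Jp mu Omega tau u).
have JE : Jp mu Omega tau u = (fine (Jp mu Omega tau u))%:E.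
  by rewrite fineK// ge0_fin_numE// Jp_ge0.
have B0 : 0 <= B by rewrite mulr_ge0 ?exprn_ge0 ?powR_ge0// fine_ge0// Jp_ge0.
have HB h : (Jp mu (ddom Omega r%:R h) tau (finite_diff r h u) <= B%:E)%E.
  apply: le_trans (Jp_diff_mono h oO Cu (ltW tau0) (leq0n r)) _.
  rewrite subn0 finite_diff0 /B EFinM -JE; apply: lee_wpmul2l.
    by rewrite lee_fin exprn_ge0// powR_ge0.
  apply: Jp_subset; [exact: measurable_ddom|exact: rV_open_measurable| |exact: ddom_sub].
  exact: Ck_on_measurable Cu.
apply: (@integral_power_majorant _ _ h0 ((sg - sigma) * tau) (sigma * tau) C B) => //.
- by rewrite mulr_gt0// subr_gt0.
- by rewrite mulr_gt0.
- by move=> t t0; rewrite mule_ge0 ?poweR_ge0// lee_fin invr_ge0 ltW.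
- move=> t /andP[t0 th0]; apply: le_trans (@besov_integrand_le Omega r u tau sigma t (C * t `^ (sg * tau)) tau0 t0 _ _) _.
  + by rewrite mulr_ge0 ?powR_ge0.
  + move=> h ht; have ht' : `|h| <= t by apply: le_trans (norm_le_enorm _) ht.
    apply: le_trans (HC h (le_trans ht' th0)) _; rewrite lee_fin ler_wpM2l//.
    by apply: ge0_ler_powR; rewrite ?nnegrE ?mulr_ge0 ?(ltW sg0) ?(ltW tau0) ?(ltW t0).
  + rewrite -mulrA -powRD; last by rewrite (gt_eqF t0) implybT.
    by rewrite (_ : _ + _ = (sg - sigma) * tau - 1)//; ring.
- move=> t ht; apply: besov_integrand_le => //; exact: lt_trans ht.
Qed.

End besov_decay.

(** * Decay of differences in L_tau *)

Section decay.
Context {R : realType} {d : nat}.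
Local Notation E := 'rV[R]_d.
Local Notation mu := (lebesgue_rV R d).
Implicit Types (x h : E) (u : E -> R) (Omega : set E).

Lemma finite_diff_step0 r u x : finite_diff r.+1 0 u x = 0.
Proof. by rewrite finite_diffS addr0 subrr. Qed.

Lemma Jp_diff_step0 (A : set E) tau r u : (0 < r)%N -> 0 < tau ->
  Jp mu A tau (finite_diff r 0 u) = 0%E.
Proof.
case: r => // r _ tau0; apply: integral0_eq => x _.
by rewrite finite_diff_step0 normr0 powR0// gt_eqF.
Qed.

(** With the threshold y^s, a set of measure a y and a p-th power integral b y^(s p + 1) contribute
    the same power of y in [Jp_split]. *)
Lemma powR_scale_split (y s tau p a b : R) : 0 < y ->
  (y `^ s) `^ tau * (a * y) + (y `^ s) `^ (tau - p) * (b * y `^ (s * p + 1)) =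
  (a + b) * y `^ (s * tau + 1).
Proof.
move=> y0; have yD e f : y `^ (e + f) = y `^ e * y `^ f.
  by rewrite powRD// (gt_eqF y0) implybT.
rewrite -!powRrM mulrBr !yD powRr1 ?ltW//.
have : y `^ (- (s * p)) * y `^ (s * p) = 1 by rewrite -yD addNr powRr0.
move: (y `^ (- (s * p))) (y `^ (s * p)) => P Q PQ.
rewrite (_ : _ * P * _ = y `^ (s * tau) * b * y * (P * Q)); last by ring.
by rewrite PQ; ring.
Qed.

(** The threshold |h|^s in [Jp_split] balances the finite measure of Omega against the L_p bound. *)
Lemma decay_of_sobolev Omega u p (s : R) tau r : (0 < d)%N ->
  bounded_set Omega -> lipschitz_domain Omega -> 1 <= p ->
  Ck_on Omega (Num.truncn s) u -> sobolev s Omega p u -> 0 < s - (Num.truncn s)%:R ->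
  (Num.truncn s < r)%N -> 0 < tau <= p ->
  exists C h0 : R, [/\ 0 < C, 0 < h0 & forall h, `|h| <= h0 ->
    (Jp mu (ddom Omega r%:R h) tau (finite_diff r h u) <= (C * `|h| `^ (s * tau))%:E)%E].
Proof.
move=> d0 bO lO p1 Cu su b0 mr /andP[tau0 taup]; have [oO _ _] := lO.
have [C [h0 [C0 h00 HC]]] := sobolev_difference d0 bO lO p1 Cu su b0 mr.
have C00 := Ck_onW (leq0n _) Cu.
have s0 : 0 < s by apply: le_lt_trans (ler0n R (Num.truncn s)) _; rewrite -subr_gt0.
have mO : measurable Omega by exact: rV_open_measurable.
have [M M0 OM] := bounded_set_norm_lt bO.
have mu_le := measure_bounded mO M0 OM.
set V := (2 * M) ^+ d in mu_le.
have V0 : 0 < V by rewrite exprn_gt0// mulr_gt0.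
exists (V + C), h0; split => //; first by rewrite addr_gt0.
move=> h hh0; have [->|hN0] := eqVneq h 0.
  rewrite Jp_diff_step0// ?(leq_ltn_trans _ mr)// lee_fin.
  by rewrite mulr_ge0 ?powR_ge0// addr_ge0// ltW.
have y0 : 0 < `|h| by rewrite normr_gt0.
have yD e f : `|h| `^ (e + f) = `|h| `^ e * `|h| `^ f.
  by rewrite powRD// (gt_eqF y0) implybT.
have mD := measurable_ddom r%:R h oO.
apply: le_trans (@Jp_split _ _ _ mu _ tau p (`|h| `^ s) _ mD _ _ _) _.
- exact: measurable_finite_diff oO C00.
- by rewrite taup ltW.
- exact: powR_gt0.
have muD : (mu (ddom Omega r%:R h) <= V%:E)%E.
  by apply: le_trans mu_le; apply: le_measure; rewrite ?inE//; exact: ddom_sub.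
apply: (@le_trans _ _ (((`|h| `^ s) `^ tau)%:E * V%:E + ((`|h| `^ s) `^ (tau - p))%:E * (C * `|h| `^ (s * p))%:E)%E).
  apply: leeD; apply: lee_wpmul2l; rewrite ?lee_fin ?powR_ge0//; exact: HC.
rewrite -!EFinM -EFinD lee_fin -!powRrM [X in _ + X <= _]mulrCA -yD -mulrDr subrK.
by rewrite [X in X + _]mulrC -mulrDl.
Qed.

Lemma decay_of_hoelder l alpha gamma gamma' c Omega u p (s : R) tau r : (0 < d)%N ->
  bounded_set Omega -> lipschitz_domain Omega -> 1 <= p -> 1 < c ->
  0 < alpha -> 0 < gamma -> gamma <= gamma' -> 1 < gamma' * tau ->
  Cla_loc l alpha gamma c Omega u ->
  sobolev s Omega p u -> 0 < s - (Num.truncn s)%:R ->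
  (Num.truncn s <= l)%N -> (l < r)%N -> 0 < tau <= p ->
  exists C h0 : R, [/\ 0 < C, 0 < h0 & forall h, `|h| <= h0 ->
    (Jp mu (ddom Omega r%:R h) tau (finite_diff r h u) <=
      (C * (`|h| `^ ((s - p^-1) * tau + 1) + `|h| `^ ((l%:R + alpha - gamma') * tau + 1)))%:E)%E].
Proof.
move=> d0 bO lO p1 c1 a0 g0 gg' g'tau uC su b0 ml lr tau0p; have [oO _ _] := lO.
have /andP[tau0 taup] := tau0p.
have p0 : 0 < p by exact: lt_le_trans p1.
have Cu := Cla_loc_Ck_on c1 oO uC.
have C00 := Ck_onW (leq0n _) Cu.
have [C1 [h0 [C10 h00 HC1]]] := sobolev_difference d0 bO lO p1 (Ck_onW ml Cu) su b0 (leq_ltn_trans ml lr).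
have [A [C2 [A0 C20 HC2]]] := hoelder_difference d0 c1 bO oO a0 g0 uC lr.
have [CL CL0 HL] := layer_measure bO lO.
have [T T0 HT] := layer_all d0 bO.
pose q := 1 - 2 `^ (1 - gamma' * tau).
(* Distances in Omega are at most T, so t^(-gamma) <= T^(gamma' - gamma) t^(-gamma'). This exchange
   buys gamma' tau > 1, without which the dyadic sum would not be geometrically decreasing. *)
pose B0 := (C2 * T `^ (gamma' - gamma)) `^ tau.
have q0 : 0 < q.
  rewrite subr_gt0 /powR ifF ?gt_eqF// expR_lt1 nmulr_rlt0 ?subr_lt0//.
  by rewrite ln_gt0// ltr1n.
pose C3 := B0 * (2 * CL) / q * A `^ (1 - gamma' * tau).
have B00 : 0 < B0 by rewrite powR_gt0// mulr_gt0// powR_gt0.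
have C30 : 0 < C3 by rewrite mulr_gt0 ?powR_gt0// divr_gt0// mulr_gt0// mulr_gt0.
exists (CL * A + C1 + C3), h0; split=> //.
  by rewrite !addr_gt0// mulr_gt0.
move=> h hh0; have [->|hN0] := eqVneq h 0.
  rewrite Jp_diff_step0// ?(leq_ltn_trans _ lr)// lee_fin.
  apply: mulr_ge0; first by rewrite ltW// !addr_gt0// mulr_gt0.
  by apply: addr_ge0; exact: powR_ge0.
have y0 : 0 < `|h| by rewrite normr_gt0.
have yD e f : `|h| `^ (e + f) = `|h| `^ e * `|h| `^ f.
  by rewrite powRD// (gt_eqF y0) implybT.
set D := ddom _ _ _; set f := finite_diff r h u.
have mD : measurable D by exact: measurable_ddom.
have DO : D `<=` Omega by exact: ddom_sub.
have mf : measurable_fun D f by exact: measurable_finite_diff oO C00.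
have t00 : 0 < A * `|h| by exact: mulr_gt0.
(* The smallest width for which the interior estimate holds at every point outside the layer. *)
set t0 := A * `|h| in t00 *.
have mL : measurable (layer Omega t0) by exact: measurable_layer.
have mDL : measurable (D `&` layer Omega t0) by exact: measurableI.
have mDN : measurable (D `\` layer Omega t0) by exact: measurableD.
have -> : Jp mu D tau f = (Jp mu (D `&` layer Omega t0) tau f + Jp mu (D `\` layer Omega t0) tau f)%E.
  rewrite /Jp -{1}(setUIDK D (layer Omega t0)) ge0_integral_setU//.
  - by rewrite setUIDK; exact: measurable_fun_normpow.
  - by rewrite disj_set2E; apply/eqP; rewrite setDE setIACA setICr setI0.
rewrite mulrDr EFinD; apply: leeD.
- have mfL : measurable_fun (D `&` layer Omega t0) f by apply: measurable_funS mf => // x [].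
  (* At this threshold, la^p times the layer measure, of order |h|, equals the L_p bound |h|^(s p)
     up to constants. *)
  have la0 : 0 < `|h| `^ (s - p^-1) by exact: powR_gt0.
  apply: le_trans (@Jp_split _ _ _ mu _ tau p _ _ mDL mfL _ la0) _.
    by rewrite taup ltW.
  apply: (@le_trans _ _ (((`|h| `^ (s - p^-1)) `^ tau)%:E * (CL * t0)%:E +
      ((`|h| `^ (s - p^-1)) `^ (tau - p))%:E * (C1 * `|h| `^ (s * p))%:E)%E).
    apply: leeD; apply: lee_wpmul2l; rewrite ?lee_fin ?powR_ge0//.
      by apply: le_trans (HL _ t00); apply: le_measure; rewrite ?inE.
    by apply: le_trans (HC1 h hh0); apply: Jp_subset => // x [].
  rewrite -!EFinM -EFinD lee_fin /t0 mulrA.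
  have -> : s * p = (s - p^-1) * p + 1 by rewrite mulrBl mulVf ?gt_eqF// subrK.
  rewrite powR_scale_split//.
  by rewrite ler_wpM2r ?powR_ge0// lerDl ltW.
- have B1 : 0 <= B0 * `|h| `^ ((l%:R + alpha) * tau) by rewrite mulr_ge0 ?powR_ge0.
  apply: le_trans (@layered_integral _ _ Omega D f tau (gamma' * tau) _ CL t0 oO mD DO mf t00 g'tau B1 (ltW CL0) HL _ _) _.
  + by exists T.
  + move=> x t t0t Dx nL; have Ox := DO _ Dx.
    have t1 : 0 < t by exact: lt_le_trans t0t.
    have tT : t <= T.
      rewrite leNgt; apply/negP => /ltW/(@layerS _ _ Omega) TL; apply: nL; apply: TL.
      by rewrite HT.
    have tO : nball x t `<=` Omega.
      move=> y yx; apply: contrapT => nOy; apply: nL; split => //.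
      by exists y => //; rewrite distrC.
    have := HC2 x t h t1 tO t0t; rewrite -/f => fx.
    apply: (@le_trans _ _ ((C2 * `|h| `^ (l%:R + alpha) * (T `^ (gamma' - gamma) * t `^ (- gamma'))) `^ tau)).
      have g'0 : 0 <= gamma' - gamma by rewrite subr_ge0.
      apply: ge0_ler_powR; rewrite ?nnegrE ?(ltW tau0)//.
        by rewrite !mulr_ge0 ?powR_ge0// ltW.
      apply: le_trans fx _; rewrite ler_wpM2l//; first by rewrite mulr_ge0 ?powR_ge0// ltW.
      have -> : t `^ (- gamma) = t `^ (gamma' - gamma) * t `^ (- gamma').
        rewrite -powRD; last by rewrite (gt_eqF t1) implybT.
        by congr (_ `^ _); ring.
      have := ge0_ler_powR g'0 (ltW t1 : t \in Num.nneg) (ltW T0 : T \in Num.nneg) tT.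
      by apply: ler_wpM2r; exact: powR_ge0.
    rewrite (_ : C2 * _ * _ = (C2 * T `^ (gamma' - gamma)) * (`|h| `^ (l%:R + alpha) * t `^ (- gamma'))); last by ring.
    rewrite [X in X <= _]powRM ?mulr_ge0 ?powR_ge0 ?(ltW C20)//.
    rewrite [X in _ * X <= _]powRM ?powR_ge0// -!powRrM mulNr mulrA.
    exact: lexx.
  + rewrite lee_fin.
    have -> : (l%:R + alpha - gamma') * tau + 1 = (l%:R + alpha) * tau + (1 - gamma' * tau) by ring.
    rewrite yD /t0 [X in _ * X <= _]powRM ?(ltW A0)//.
    apply: (@le_trans _ _ (C3 * (`|h| `^ ((l%:R + alpha) * tau) * `|h| `^ (1 - gamma' * tau)))).
      by rewrite le_eqVlt; apply/orP; left; apply/eqP; rewrite /C3 -/q; ring.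
    rewrite ler_wpM2r ?mulr_ge0 ?powR_ge0// lerDr addr_ge0// ?mulr_ge0 ?ltW//.
Qed.

End decay.

(** * Choice of the exponents *)

Theorem theorem4p8 (R : realType) (d : nat) (Omega : set 'rV[R]_d)
    (p : R) (f : ('rV[R]_d -> R) -> R) (u : 'rV[R]_d -> R)
    (l : nat) (sbar alpha gamma c : R)
    (d_ge2 : (2 <= d)%N)
    (Omega_bounded : bounded_set Omega)
    (Omega_lipschitz : lipschitz_domain Omega)
    (p_gt1 : 1 < p)
    (f_dual : sobolev_dual Omega p f)
    (u_sol : weak_solution Omega p f u)
    (l_ge1 : (1 <= l)%N)
    (sbar_l : l%:R <= sbar < l.+1%:R)
    (u_sobolev : forall s : R, 0 <= s < sbar -> sobolev s Omega p u)
    (c_gt1 : 1 < c)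
    (u_hoelder : Cla_loc l alpha gamma c Omega u)
    (alpha_range : sbar - l%:R < alpha <= 1)
    (gamma_range : 0 < gamma < l%:R + alpha + p^-1 - (d%:R - 1) / d%:R * sbar) :
  exists2 sigmabar : R, sbar < sigmabar &
    forall (sigma tau : R) (r : nat),
      0 < sigma < sigmabar -> tau^-1 = sigma / d%:R + p^-1 ->
      (Num.truncn sigma + 1 <= r)%N ->
      besov r sigma Omega tau u.
Proof.
have d0 : (0 < d)%N by exact: leq_trans d_ge2.
have [oO _ _] := Omega_lipschitz.
have D2 : 2 <= d%:R :> R by rewrite ler_nat.
have D0 : 0 < d%:R :> R by rewrite ltr0n.
have p0 : 0 < p by exact: lt_trans p_gt1.
have p1 : 1 <= p by exact: ltW.
have pi0 : 0 < p^-1 by rewrite invr_gt0.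
have /andP[lsbar sbarl] := sbar_l.
have l1 : 1 <= l%:R :> R by rewrite ler1n.
have sbar0 : 0 < sbar by exact: lt_le_trans (lt_le_trans ltr01 l1) lsbar.
have /andP[alpha_gt alpha_le] := alpha_range.
have a0 : 0 < alpha by apply: le_lt_trans alpha_gt; rewrite subr_ge0.
have /andP[g0 gamma_lt] := gamma_range.
have Cu := Cla_loc_Ck_on c_gt1 oO u_hoelder.
(* On the boundary layer the decay exponent s + sigma / d exceeds sigma exactly when s > kappa
   sigma. That kappa is positive and below 1 gives room above sbar. *)
pose kappa : R := (d%:R - 1) / d%:R.
have kappa0 : 0 < kappa by rewrite divr_gt0// subr_gt0; lra.
have kappa1 : kappa < 1 by rewrite ltr_pdivrMr// mul1r gtrBl.
have kappaE (sg : R) : kappa * sg = sg - sg / d%:R by rewrite /kappa; field; rewrite gt_eqF.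
(* The first bound makes l + alpha - gamma + 1 / tau exceed sigma; the second admits an s < sbar
   with s > kappa sigma; the third leaves room for gamma' slightly above 1 / tau. *)
pose sigmabar := Num.min (Num.min ((l%:R + alpha + p^-1 - gamma) / kappa) (sbar / kappa)) (l%:R + alpha).
exists sigmabar.
  rewrite !lt_min -andbA; apply/and3P; split.
  - by rewrite ltr_pdivlMr// mulrC; move: gamma_lt; rewrite -/kappa; lra.
  - by rewrite ltr_pdivlMr// gtr_pMr.
  - by move: alpha_gt; lra.
move=> sigma tau r /andP[sigma0 sigmalt] tauE rge.
rewrite addn1 in rge.
have tau_inv0 : 0 < tau^-1 by rewrite tauE addr_gt0// divr_gt0.
have tau0 : 0 < tau by rewrite -invr_gt0.
have taup : tau <= p.
  by rewrite -lef_pV2 ?posrE// tauE lerDr divr_ge0// ltW.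
have tau0p : 0 < tau <= p by rewrite tau0.
have C00 := Ck_onW (leq0n _) Cu.
have mO : measurable Omega by exact: rV_open_measurable.
have mu_fin : (lebesgue_rV R d Omega < +oo)%E.
  have [M M0 OM] := bounded_set_norm_lt Omega_bounded.
  by apply: le_lt_trans (measure_bounded mO M0 OM) _; exact: ltry.
have Jtau : (Jp (lebesgue_rV R d) Omega tau u < +oo)%E.
  have [[[mu_u Lu] _] _] := u_sol.
  have Jpoo : (Jp (lebesgue_rV R d) Omega p u < +oo)%E.
    by move: Lu; rewrite Lnorm_onE//; apply: lty_poweRy; rewrite gt_eqF.
  apply: le_lt_trans (@Jp_split _ _ _ (lebesgue_rV R d) _ tau p 1 _ mO mu_u _ ltr01) _.
    by rewrite taup ltW.
  by rewrite !powR1 !mul1e lte_add_pinfty.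
have sob (m : nat) (s : R) : m%:R < s -> s < m.+1%:R -> s < sbar ->
    [/\ Num.truncn s = m, sobolev s Omega p u & 0 < s - (Num.truncn s)%:R].
  move=> ms sm ss; have tm : Num.truncn s = m by apply: truncn_def; rewrite (ltW ms).
  rewrite tm subr_gt0; split=> //; apply: u_sobolev; rewrite ss andbT.
  by apply: le_trans (ltW ms).
have [ssb|sbs] := ltP sigma sbar.
  have /andP[tr1 tr2] := truncn_itv (ltW sigma0).
  set m := Num.truncn sigma in rge tr1 tr2 *.
  (* Such an s is nonintegral and has the same integer part m as sigma, so differences of any order
     r > m can be estimated. *)
  pose s := (sigma + Num.min sbar m.+1%:R) / 2.
  have : sigma < Num.min sbar m.+1%:R by rewrite lt_min ssb.
  have : Num.min sbar m.+1%:R <= sbar by rewrite ge_min lexx.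
  have : Num.min sbar m.+1%:R <= m.+1%:R :> R by rewrite ge_min lexx orbT.
  move=> mm1 mm2 mm3.
  have ss1 : sigma < s by rewrite /s; move: mm3; lra.
  have ss2 : s < sbar by rewrite /s; move: mm3 mm2; lra.
  have ss3 : s < m.+1%:R by rewrite /s; move: mm3 mm1; lra.
  have [sm ssob sfrac] := sob m s (le_lt_trans tr1 ss1) ss3 ss2.
  have ml : (m <= l)%N by rewrite -ltnS -(ltr_nat R); apply: le_lt_trans tr1 (lt_trans ssb sbarl).
  have [||C [h0 [C0 h00 HC]]] := @decay_of_sobolev _ _ Omega u p s tau r d0 Omega_bounded Omega_lipschitz p1
    _ ssob sfrac _ tau0p.
  - by rewrite sm; exact: Ck_onW Cu.
  - by rewrite sm.
  apply: (besov_of_decay oO C00 tau0 _ (ltW C0) h00 Jtau HC).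
  by rewrite sigma0.
move: sigmalt; rewrite !lt_min -andbA => /and3P[].
rewrite !(ltr_pdivlMr _ _ kappa0) => sl1 sl2 sl3.
have lr : (l < r)%N.
  apply: leq_trans rge; rewrite ltnS truncn_ge_nat ?(ltW sigma0)//.
  exact: le_trans sbs.
(* The largest integer strictly below sbar: l - 1 if sbar = l, and l otherwise. *)
have [m [ml msb sbm]] : exists m : nat, [/\ (m <= l)%N, m%:R < sbar & sbar <= m.+1%:R].
  have [->|ls] := eqVneq sbar l%:R.
    by exists l.-1; rewrite leq_pred prednK// ltr_nat lexx prednK.
  by exists l; rewrite leqnn lt_neqAle eq_sym ls lsbar ltW.
(* s has to exceed m to be nonintegral, and kappa sigma for the boundary layer. *)
pose mx := Num.max m%:R (kappa * sigma).
have mx1 : mx < sbar by rewrite gt_max msb mulrC.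
have mx2 : m%:R <= mx by rewrite le_max lexx.
have mx3 : kappa * sigma <= mx by rewrite le_max lexx orbT.
pose s := (sbar + mx) / 2.
have s1 : mx < s by rewrite /s; move: mx1; lra.
have s2 : s < sbar by rewrite /s; move: mx1; lra.
have [sm ssob sfrac] := sob m s (le_lt_trans mx2 s1) (lt_le_trans s2 sbm) s2.
(* gamma' must exceed 1 / tau for the dyadic sum and stay below l + alpha + 1 / tau - sigma for the
   decay; [eps] is half of that gap. *)
pose eps := (l%:R + alpha - sigma) / 2.
have eps0 : 0 < eps by rewrite divr_gt0// subr_gt0.
pose gamma' := Num.max gamma (tau^-1 + eps).
have gg' : gamma <= gamma' by rewrite le_max lexx.
have g'tau : 1 < gamma' * tau.
  rewrite -ltr_pdivrMr// div1r; apply: (@lt_le_trans _ _ (tau^-1 + eps)); first by rewrite ltrDl.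
  by rewrite le_max lexx orbT.
have [|C [h0 [C0 h00 HC]]] := @decay_of_hoelder _ _ l alpha gamma gamma' c Omega u p s tau r d0
  Omega_bounded Omega_lipschitz p1 c_gt1 a0 g0 gg' g'tau u_hoelder ssob sfrac _ lr tau0p.
  by rewrite sm.
(* The smaller of the two decay exponents dominates both powers once |h| <= 1, hence the radius
   [Num.min h0 1] below. *)
pose sg := Num.min (s - p^-1 + tau^-1) (l%:R + alpha - gamma' + tau^-1).
have sgE (x : R) : (x + tau^-1) * tau = x * tau + 1 by rewrite mulrDl mulVf// gt_eqF.
have sgsigma : sigma < sg.
  rewrite lt_min; apply/andP; split.
    rewrite tauE; move: (le_lt_trans mx3 s1); rewrite kappaE; lra.
  have : gamma' < l%:R + alpha + tau^-1 - sigma; last by lra.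
  rewrite gt_max; apply/andP; split.
    by rewrite tauE; move: sl1; rewrite mulrC kappaE; lra.
  by rewrite /eps; move: sl3; lra.
apply: (@besov_of_decay _ _ Omega r u tau sigma sg (C * 2) (Num.min h0 1) oO C00 tau0) => //.
- by rewrite sigma0.
- by rewrite mulr_ge0// ltW.
- by rewrite lt_min h00 ltr01.
move=> h; rewrite le_min => /andP[hh0 hh1]; apply: le_trans (HC h hh0) _.
rewrite lee_fin -mulrA ler_wpM2l ?(ltW C0)// (mulr_natl _ 2) mulr2n -!sgE.
have sgtau0 : 0 < sg * tau by rewrite mulr_gt0// (lt_trans sigma0).
(* Monotonicity of the power in its exponent needs a positive base; at h = 0 both powers are 0
   because their exponents are positive. *)
have [h00'|hN0] := eqVneq `|h| 0.
  have z (x : R) : sg <= x -> 0 `^ (x * tau) <= 0 `^ (sg * tau) :> R.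
    move=> sx; rewrite powR0 ?powR_ge0// gt_eqF// mulr_gt0//.
    by apply: lt_le_trans sx; exact: lt_trans sgsigma.
  by rewrite h00'; apply: lerD; apply: z; rewrite ge_min lexx ?orbT.
have hp : 0 < `|h| by rewrite lt_neqAle eq_sym hN0 normr_ge0.
by apply: lerD; apply: ger_powR; rewrite ?hp// ler_wpM2r ?(ltW tau0)// ge_min lexx ?orbT.
Qed.
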